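(* Let $1<p<\infty$ and let $B$ be a ball with $\overline B\subset\Omega$. Suppose $(w,v)$ is a $p$-admissible pair of weights and the matrix function $Q$ satisfies $$w(x)|\xi|^p\le|\sqrt{Q(x)}\,\xi|^p\qquad\text{for every }\xi\in\mathbb{R}^n\text{ and a.e. }x\in\Omega.$$ Then the quadratic form $\mathcal{Q}(x,\xi)=\xi^tQ(x)\xi$ has the $p$-Neumann property on $B$ with respect to the weight $v$; in particular, the Neumann problem $$\operatorname{div}\big(|\sqrt{Q}\nabla u|^{p-2}Q\nabla u\big)=|f|^{p-2}f\,v\ \text{ in }B,\qquad \mathbf n^t\cdot Q\nabla u=0\ \text{ on }\partial B$$ has a weak solution for every $f\in L^p(v;B)$.
   Context: Setting: $\Omega\subset\mathbb{R}^n$ is a domain; $Q$ is a function on $\Omega$ with values in the real symmetric positive semi-definite $n\times n$ matrices, with Lebesgue measurable entries; $\sqrt{Q(x)}$ is the positive semi-definite square root. A weight is a non-negative locally integrable function; $v(A)=\int_A v\,dx$. For $1<p<\infty$, $w\in A_p$ means $w$ is a weight on $\mathbb{R}^n$ (positive a.e.) with $\sup_B\big(\frac{1}{|B|}\int_B w\,dx\big)\big(\frac{1}{|B|}\int_B w^{1-p'}\,dx\big)^{p-1}<\infty$, the supremum being over all balls $B$, where $1/p+1/p'=1$. A pair of weights $(w,v)$ on $\mathbb{R}^n$ is $p$-admissible if: (1) $v(x)\ge w(x)$ for a.e. $x\in\mathbb{R}^n$; (2) $w\in A_p$ and $v$ is doubling, i.e. there is $C>0$ with $v(B(x,2r))\le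 Cv(B(x,r))$ for all $x\in\mathbb{R}^n$, $r>0$; (3) there are constants $C>0$ and $q>p$ such that for all balls $B_1=B(x,r)\subset B_2=B(y,s)$, $\frac{r}{s}\Big(\frac{v(B_1)}{v(B_2)}\Big)^{1/q}\le C\Big(\frac{w(B_1)}{w(B_2)}\Big)^{1/p}$. Spaces, for $E=B$: $\|f\|_{L^p(v;E)}=(\int_E|f|^pv\,dx)^{1/p}$. $\mathcal{L}^p_Q(E)$ is the space of measurable $\mathbf{f}:E\to\mathbb{R}^n$ with $\|\mathbf{f}\|_{\mathcal{L}^p_Q(E)}=(\int_E|\sqrt{Q}\,\mathbf{f}|^p\,dx)^{1/p}<\infty$, modulo elements of zero norm. $H^{1,p}_Q(v;E)$ is the completion of the set of $f\in C^1(\overline{E})$ of finite norm with respect to $\|f\|_{H^{1,p}_Q(v;E)}=\|f\|_{L^p(v;E)}+\|\nabla f\|_{\mathcal{L}^p_Q(E)}$. Each of its elements is represented by the unique pair $(u,\mathbf{g})\in L^p(v;E)\times\mathcal{L}^p_Q(E)$ that is the limit of $(f_k,\nabla f_k)$ for a Cauchy sequence $f_k$ representing it. $\tilde{H}^{1,p}_Q(v;E)=\{(u,\mathbf g)\in H^{1,p}_Q(v;E):\int_E u\,v\,dx=0\}$; a function $\varphi\in C^1(\overline E)$ of finite norm is identified with $(\varphi,\nabla\varphi)$. Weak solution: given $f\in L^p(v;E)$, a pair $(u,\mathbf g)\in\tilde{H}^{1,p}_Q(v;E)$ is a weak solution of the Neumann problem if for all $\varphi\in C^1(\overline{E})\cap\tilde{H}^{1,p}_Q(v;E)$,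 $$\int_E|\sqrt{Q}\,\mathbf g|^{p-2}(\nabla\varphi)^tQ\,\mathbf g\,dx=-\int_E|f|^{p-2}f\,\varphi\,v\,dx$$ (expressions $|s|^{p-2}s$ are $0$ at $s=0$, and $|\sqrt Q\mathbf g|^{p-2}Q\mathbf g=0$ where $\sqrt Q\mathbf g=0$). $p$-Neumann property on $E$ (with respect to $v$): (1) for every $f\in L^p(v;E)$ there exists a weak solution $(u,\mathbf g)_f\in\tilde{H}^{1,p}_Q(v;E)$; and (2) there is a constant $D_p>0$ such that for every $f\in L^p(v;E)$ every weak solution satisfies $\|u\|_{L^p(v;E)}\le D_p\|f\|_{L^p(v;E)}$. *)

(* Defs.v *)
From HB Require Import structures.
From mathcomp Require Import all_boot all_order all_algebra.
From mathcomp Require Import all_classical all_reals all_analysis.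

Set Implicit Arguments.
Unset Strict Implicit.
Unset Printing Implicit Defensive.
Import Order.TTheory GRing.Theory Num.Theory.
Import numFieldNormedType.Exports.
Local Open Scope classical_set_scope.
Local Open Scope ring_scope.

(* The space R^n, n >= 1, is written with n.+1 in place of n.  Its points are
   row vectors 'rV[R]_n.+1, with the topology and the differential calculus of
   the library (whose norm on 'rV is the max norm, equivalent to the Euclidean
   one).  The vectors on which matrices act (xi, gradients, the fields g) are
   column vectors 'cV[R]_n.+1. *)

Section lebesgue_outer_measure.
Context {R : realType} (n : nat).
Local Notation E := 'rV[R]_n.+1.
Local Open Scope ereal_scope.

Definition box (ab : E * E) : set E :=
  [set x | forall i, (ab.1 ord0 i < x ord0 i <= ab.2 ord0 i)%R].

Definition box_vol (ab : E * E) : R :=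
  (\prod_i Num.max 0 (ab.2 ord0 i - ab.1 ord0 i))%R.

Definition box_cover (A : set E) : set (nat -> E * E) :=
  [set F | A `<=` \bigcup_k box (F k)].

Definition lebesgue_outer (A : set E) : \bar R :=
  ereal_inf [set \sum_(k <oo) (box_vol (F k))%:E | F in box_cover A].

Lemma box_vol_ge0 ab : (0 <= box_vol ab)%R.
Proof. by apply: prodr_ge0 => i _; rewrite le_max lexx. Qed.

Let volE_ge0 ab : 0 <= (box_vol ab)%:E.
Proof. by rewrite lee_fin box_vol_ge0. Qed.

Lemma box_vol_diag x : box_vol (x, x) = 0%R.
Proof. by rewrite /box_vol big_ord_recl/= subrr maxxx mul0r. Qed.

Lemma lebesgue_outer_ge0 A : 0 <= lebesgue_outer A.
Proof.
by apply: le_ereal_inf_tmp => _ [F _ <-]; exact: nneseries_ge0.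
Qed.

Lemma lebesgue_outer0 : lebesgue_outer set0 = 0.
Proof.
apply/eqP; rewrite eq_le lebesgue_outer_ge0 andbT.
apply: ereal_inf_lbound; exists (fun=> (0%R, 0%R)).
  by rewrite /box_cover/=; exact: sub0set.
by rewrite eseries0// => k _ _; rewrite box_vol_diag.
Qed.

Lemma le_lebesgue_outer : {homo lebesgue_outer : A B / A `<=` B >-> A <= B}.
Proof.
move=> A B AB; apply/ereal_inf_le_tmp => _ [F BF <-].
by exists F => //; exact: subset_trans AB BF.
Qed.

Lemma lebesgue_outer_sigma_subadditive : sigma_subadditive lebesgue_outer.
Proof.
move=> A; have [[i ioo]|] := pselect (exists i, lebesgue_outer (A i) = +oo).
  rewrite (eseries_pinfty _ _ ioo) ?leey// => k _.
  by rewrite -ltNye (lt_le_trans _ (lebesgue_outer_ge0 _)).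
rewrite -forallNE => Aoo.
suff add2e (e : {posnum R}) : lebesgue_outer (\bigcup_k A k) <=
    \sum_(i <oo) lebesgue_outer (A i) + e%:num%:E.
  by apply/lee_addgt0Pr => _/posnumP[].
rewrite (le_trans _ (epsilon_trick _ _ _))//; last first.
  by move=> k; exact: lebesgue_outer_ge0.
pose P k (F : nat -> E * E) := box_cover (A k) F /\
  \sum_(j <oo) (box_vol (F j))%:E <=
    lebesgue_outer (A k) + (e%:num / (2 ^ k.+1)%:R)%:E.
have [G PG] : {G : nat -> nat -> E * E & forall k, P k (G k)}.
  apply: (@choice _ _ P) => k; rewrite /P.
  have fS : lebesgue_outer (A k) \is a fin_num.
    by rewrite ge0_fin_numE ?lebesgue_outer_ge0// ltey; apply/eqP/Aoo.
  have en1 : (0 < e%:num / (2 ^ k.+1)%:R)%R by [].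
  have [_ [F AF <-] /ltW] := lb_ereal_inf_adherent en1 fS.
  by exists F.
pose vol (ij : nat * nat) : \bar R := (box_vol (G ij.1 ij.2))%:E.
have vol_ge0 ij : 0 <= vol ij by exact: volE_ge0.
apply: (@le_trans _ _ (\esum_(i in setT) vol i)).
  apply: ereal_inf_lbound => /=.
  have /card_esym/ppcard_eqP[f] := card_nat2.
  exists (fun k => G (f k).1 (f k).2).
    move=> t [i _ /(PG i).1[j _ Bijt]].
    by exists (f^-1%FUN (i, j)) => //=; rewrite invK ?inE.
  rewrite -(esum_pred_image vol f xpredT) ?[fun=> _]set_true//.
  by rewrite image_eq.
rewrite (_ : esum _ _ = \sum_(i <oo) \sum_(j <oo) vol (i, j)); last first.
  pose J : nat -> set (nat * nat) := fun i => [set (i, j) | j in setT].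
  rewrite (_ : setT = \bigcup_k J k); last first.
    by rewrite predeqE => -[a b]; split => // _; exists a => //; exists b.
  rewrite esum_bigcupT //=; last first.
    apply/trivIsetP => i j _ _ ij.
    rewrite predeqE => -[k m] /=; split => //= -[] [_] _ [<-{k} _].
    by move=> [m' _] [] /esym/eqP; rewrite (negbTE ij).
  rewrite -(image_id [set: nat]) -fun_true esum_pred_image//; last first.
    by move=> k _; exact: esum_ge0.
  apply: eq_eseriesr => /= j _.
  rewrite -(esum_pred_image vol (pair j) predT)//=; last first.
    by move=> ? ? _ _; exact: (@can_inj _ _ _ snd).
  by congr esum; rewrite predeqE => -[a b]; split; move=> [i _ <-]; exists i.
apply: lee_lim.
- by apply: is_cvg_nneseries => k _ _; exact: nneseries_ge0.
- apply: is_cvg_nneseries => k _ _; apply: adde_ge0 => //.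
  exact: lebesgue_outer_ge0.
- by near=> k; apply: lee_sum => i _; exact: (PG i).2.
Unshelve. all: by end_near. Qed.

HB.instance Definition _ := isOuterMeasure.Build R E lebesgue_outer
  lebesgue_outer0 lebesgue_outer_ge0 le_lebesgue_outer
  lebesgue_outer_sigma_subadditive.

End lebesgue_outer_measure.

(* 'rV[R]_n.+1 carries the sigma-algebra of Lebesgue (not only Borel)
   measurable sets. *)
HB.instance Definition _ (R : realType) (n : nat) :=
  @isMeasurable.Build (caratheodory_display (@lebesgue_outer R n))
    'rV[R]_n.+1 (@lebesgue_outer R n).-caratheodory
    (caratheodory_measurable_set0 (@lebesgue_outer R n))
    (@caratheodory_measurable_setC _ _ (@lebesgue_outer R n))
    (@caratheodory_measurable_bigcup _ _ (@lebesgue_outer R n)).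

Definition lebesgue {R : realType} {n : nat} : set 'rV[R]_n.+1 -> \bar R :=
  @lebesgue_outer R n.

HB.instance Definition _ (R : realType) (n : nat) :=
  isMeasure.Build _ _ _ (@lebesgue R n)
    (lebesgue_outer0 n)
    (@lebesgue_outer_ge0 R n)
    (@caratheodory_measure_sigma_additive _ _ (@lebesgue_outer R n)).

Section euclidean_space.
Context {R : realType}.

(* Applied to row and column vectors only, where it is the Euclidean norm. *)
Definition enorm {m k} (x : 'M[R]_(m, k)) : R :=
  Num.sqrt (\sum_i \sum_j x i j ^+ 2).

Definition eball {n} (x : 'rV[R]_n) (r : R) : set 'rV[R]_n :=
  [set y | enorm (y - x) < r].

Definition domain {n} (Omega : set 'rV[R]_n.+1) : Prop :=
  [/\ Omega !=set0, open Omega & connected Omega].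

Definition psd {n} (A : 'M[R]_n) : Prop :=
  A^T = A /\ forall xi : 'cV[R]_n, 0 <= (xi^T *m A *m xi) ord0 ord0.

(* The default value 0 is irrelevant: a positive semi-definite matrix has
   exactly one positive semi-definite square root. *)
Definition psd_sqrt {n} (A : 'M[R]_n) : 'M[R]_n :=
  xget 0 [set S | psd S /\ S *m S = A].

Definition grad {n} (f : 'rV[R]_n.+1 -> R) (x : 'rV[R]_n.+1) : 'cV[R]_n.+1 :=
  \col_i 'D_(delta_mx ord0 i) f x.

(* C^1 of the closure of an open set E: continuously differentiable in E, the
   function and its gradient extending continuously to the closure.  Values
   outside the closure play no role. *)
Definition C1_closure {n} (E : set 'rV[R]_n.+1) (f : 'rV[R]_n.+1 -> R) : Prop :=
  [/\ {within closure E, continuous f},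
      forall x, E x -> differentiable f x &
      exists G : 'rV[R]_n.+1 -> 'cV[R]_n.+1,
        {within closure E, continuous G} /\ forall x, E x -> grad f x = G x].

End euclidean_space.

Section weights.
Context {R : realType} {n : nat}.
Local Notation E := 'rV[R]_n.+1.
Implicit Types (w v : E -> R) (p : R).

Definition weight v : Prop :=
  [/\ measurable_fun [set: E] v, forall x, 0 <= v x &
      forall K : set E, compact K -> lebesgue.-integrable K (EFin \o v)].

(* v(A); real-valued, and only used for balls, where the integral of a weight
   is finite. *)
Definition wmass v (A : set E) : R := \int[lebesgue]_(x in A) v x.

Definition average (A : set E) (f : E -> R) : \bar R :=
  ((fine (lebesgue A))^-1%:E * \int[lebesgue]_(x in A) (f x)%:E)%E.

Definition dual_exponent p : R := p / (p - 1).

(* The averages are taken in \bar R, so that an infinite integral of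
   w^(1-p') violates the condition.  The value of w^(1-p') where w vanishes
   is immaterial, as w is positive a.e. *)
Definition muckenhoupt p w : Prop :=
  [/\ weight w, {ae lebesgue, forall x, 0 < w x} &
    (ereal_sup [set average (eball xr.1 xr.2) w *
          poweR (average (eball xr.1 xr.2)
                   (fun y => w y `^ (1 - dual_exponent p))%R) (p - 1)
        | xr in [set xr : E * R | (0 < xr.2)%R]] < +oo)%E].

Definition doubling v : Prop :=
  exists2 C : R, 0 < C & forall (x : E) (r : R), 0 < r ->
    wmass v (eball x (2 * r)) <= C * wmass v (eball x r).

Definition balanced p w v : Prop :=
  exists C q : R, [/\ 0 < C, p < q &
    forall (x y : E) (r s : R), 0 < r -> 0 < s -> eball x r `<=` eball y s ->
      r / s * (wmass v (eball x r) / wmass v (eball y s)) `^ q^-1 <=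
      C * (wmass w (eball x r) / wmass w (eball y s)) `^ p^-1].

Definition admissible p w v : Prop :=
  [/\ weight w /\ weight v, {ae lebesgue, forall x, w x <= v x},
      muckenhoupt p w /\ doubling v & balanced p w v].

End weights.

Section neumann.
Context {R : realType} {n : nat}.
Local Notation pt := 'rV[R]_n.+1.
Variables (p : R) (v : pt -> R) (Q : pt -> 'M[R]_n.+1) (E : set pt).
Implicit Types (u f phi : pt -> R) (g : pt -> 'cV[R]_n.+1).

(* Elements of L^p(v;E) and of L^p_Q(E) are handled through representatives:
   all notions below depend only on the classes modulo null norm. *)

Definition Lp_norm u : \bar R :=
  poweR (\int[lebesgue]_(x in E) (`|u x| `^ p * v x)%:E)%E p^-1.

Definition Lp u : Prop := measurable_fun E u /\ (Lp_norm u < +oo)%E.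

Definition LQ_norm g : \bar R :=
  poweR (\int[lebesgue]_(x in E) (enorm (psd_sqrt (Q x) *m g x) `^ p)%:E)%E
    p^-1.

Definition LQ g : Prop :=
  (forall i, measurable_fun E (fun x => g x i ord0)) /\ (LQ_norm g < +oo)%E.

Definition H1_norm f : \bar R := (Lp_norm f + LQ_norm (grad f))%E.

Definition C1_fin f : Prop := C1_closure E f /\ (H1_norm f < +oo)%E.

Definition H1_cauchy (f_ : nat -> pt -> R) : Prop :=
  forall e : R, 0 < e -> exists N : nat, forall j k : nat,
    (N <= j)%N -> (N <= k)%N -> (H1_norm (f_ j \- f_ k)%R < e%:E)%E.

(* The completion H^{1,p}_Q(v;E), as the set of limits in L^p x L^p_Q of
   (f_k, grad f_k) for Cauchy sequences f_k. *)
Definition H1 u g : Prop :=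
  [/\ Lp u, LQ g & exists f_ : nat -> pt -> R,
    [/\ forall k, C1_fin (f_ k), H1_cauchy f_,
        Lp_norm (f_ k \- u) @[k --> \oo] --> 0%E &
        LQ_norm (grad (f_ k) \- g) @[k --> \oo] --> 0%E]].

Definition H1_mean0 u g : Prop :=
  H1 u g /\ (\int[lebesgue]_(x in E) (u x * v x)%:E = 0)%E.

(* No special case is needed for |s|^(p-2) s at s = 0: the factor s = 0 makes
   the product vanish (and sqrt(Q) g = 0 implies Q g = 0). *)
Definition weak_solution f u g : Prop :=
  H1_mean0 u g /\ forall phi, C1_closure E phi -> H1_mean0 phi (grad phi) ->
  (\int[lebesgue]_(x in E)
     (enorm (psd_sqrt (Q x) *m g x) `^ (p - 2) *
       ((grad phi x)^T *m Q x *m g x) ord0 ord0)%:E =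
   - \int[lebesgue]_(x in E) (`|f x| `^ (p - 2) * f x * phi x * v x)%:E)%E.

Definition neumann_solvable : Prop :=
  forall f, Lp f -> exists u g, weak_solution f u g.

Definition neumann_property : Prop :=
  neumann_solvable /\
  exists2 D : R, 0 < D & forall f u g, Lp f -> weak_solution f u g ->
    (Lp_norm u <= D%:E * Lp_norm f)%E.

End neumann.

(* Main.v *)
(* A C^1 function f differs from its mean over the ball B by the sum over k of
   r 2^-k times the mean of |grad f| over the image of B under the homothety of
   ratio 2^-k centred at x.  The A_p condition turns these means into w-weighted
   L^p means, and the balance condition with q > p, together with reverse doubling
   of v, makes the k-th contribution decay geometrically in L^p(v).  Hence the
   Poincare inequality of f - c in L^p(v;B) against |grad f| in L^p(w;B), and a
   fortiori against |sqrt(Q) grad f| in L^p(B).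

   Given f, the functional (1/p) int |sqrt(Q) grad u|^p + int |f|^(p-2) f u v is
   therefore coercive on C^1 functions of v-mean zero.  By uniform convexity a
   minimizing sequence is Cauchy; its limit in H^{1,p}_Q satisfies the
   Euler-Lagrange equation, which is the weak Neumann problem.  Testing the
   equation with the solution itself gives the bound on u.

   The positivity of the measure of a ball is never proved: if B is null, every
   integral over B vanishes and the statement is trivial. *)
Require Import Defs.
From mathcomp Require Import all_boot all_order all_algebra.
From mathcomp Require Import all_classical all_reals all_analysis.
From mathcomp Require Import measurable_realfun ring lra.
Import Order.TTheory GRing.Theory Num.Theory.
Import numFieldNormedType.Exports.
Local Open Scope classical_set_scope.
Local Open Scope ring_scope.
Set Implicit Arguments.
Unset Strict Implicit.
Unset Printing Implicit Defensive.

(** * Lebesgue measure *)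

(** Estimates are carried out on p-th powers of norms, and Hölder's inequality always takes the form
    of Young's inequality [a^(p-1) b <= e a^p + e^(1-p) b^p] with a free parameter [e], chosen each
    time so that one term is absorbed.

    The matrix [psd_sqrt (Q x)] comes from a choice operator, so the measurability of what is
    integrated has to be drawn from [Q]: the root enters the integrands only through products
    [<S a, S b>], which equal [<a, Q b>] almost everywhere.

    The functional is evaluated on C^1 functions only. The k-th term of the minimizing sequence is
    accurate to [t_k^2] with [t_k = 1/(k+1)] and is perturbed by [t_k phi]; convexity bounds the
    increment by the flux at the perturbed point, and dominated convergence gives the Euler-Lagrange
    inequality for the limit. The pointwise convergence and the dominating function come from the
    extraction that proves completeness, where [w > 0] and the lower bound on [|sqrt(Q) xi|] turn
    smallness of [sqrt(Q)] times an increment into smallness of the increment. *)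

Section lebesgue_facts.
Context {R : realType} {n : nat}.
Local Notation E := 'rV[R]_n.+1.
Implicit Types (A : set E) (ab : E * E).

Definition box_le (i : 'I_n.+1) (c : R) ab : E * E :=
  (ab.1, \row_j (if j == i then Num.min (ab.2 ord0 j) c else ab.2 ord0 j)).

Definition box_gt (i : 'I_n.+1) (c : R) ab : E * E :=
  (\row_j (if j == i then Num.max (ab.1 ord0 j) c else ab.1 ord0 j), ab.2).

Lemma box_vol_split i c ab :
  box_vol ab = box_vol (box_le i c ab) + box_vol (box_gt i c ab).
Proof.
rewrite /box_vol (bigD1 i)//= [in RHS](bigD1 i)//= [X in _ = _ + X](bigD1 i)//=.
rewrite !mxE eqxx.
under [X in _ = _ * X + _]eq_bigr => j ji do rewrite mxE (negbTE ji).
under [X in _ = _ + _ * X]eq_bigr => j ji do rewrite mxE (negbTE ji).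
rewrite -mulrDl; congr (_ * _).
rewrite /Num.max /Num.min.
move: (ab.1 ord0 i) (ab.2 ord0 i) => a b.
by case: (ltrP b c) => ?; case: (ltrP a c) => ?; repeat case: ltrP => ?; lra.
Qed.

(** Carathéodory's criterion: cutting every box of a cover of [X] by the hyperplane gives covers of
    the two parts of [X] with unchanged total volume. *)
Lemma measurable_halfspace (i : 'I_n.+1) (c : R) :
  measurable [set x : E | x ord0 i <= c].
Proof.
apply: le_caratheodory_measurable => X.
apply: le_ereal_inf_tmp => _ [F XF <-].
pose H := [set x : E | x ord0 i <= c].
have h1 : (lebesgue_outer (X `&` H) <=
    \sum_(k <oo) (box_vol (box_le i c (F k)))%:E)%E.
  apply: ereal_inf_lbound; exists (fun k => box_le i c (F k)) => //.
  move=> x [/XF[k _ Fkx] Hx]; exists k => // j; have := Fkx j; rewrite /= mxE.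
  by case: eqP => [->|//]; rewrite le_min => /andP[-> ->]/=.
have h2 : (lebesgue_outer (X `&` ~` H) <=
    \sum_(k <oo) (box_vol (box_gt i c (F k)))%:E)%E.
  apply: ereal_inf_lbound; exists (fun k => box_gt i c (F k)) => //.
  move=> x [/XF[k _ Fkx] Hx]; exists k => // j; have := Fkx j; rewrite /= mxE.
  case: eqP => [->|//]; rewrite gt_max => /andP[-> ->]/=; rewrite andbT.
  by rewrite ltNge; apply/negP.
apply: le_trans (leeD h1 h2) _.
rewrite -nneseriesD//; try by move=> *; rewrite lee_fin box_vol_ge0.
rewrite le_eqVlt; apply/orP; left; apply/eqP.
by apply: eq_eseriesr => k _; rewrite (box_vol_split i c (F k)) EFinD.
Qed.

Lemma measurable_box ab : measurable (box ab).
Proof.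
rewrite (_ : box ab = \bigcap_(i in [set: 'I_n.+1])
  ([set x : E | x ord0 i <= ab.2 ord0 i] `\` [set x | x ord0 i <= ab.1 ord0 i])).
  apply: fin_bigcap_measurable => // i _.
  by apply: measurableD; exact: measurable_halfspace.
apply/seteqP; split => x.
  by move=> H i _; have /andP[] := H i => h1 h2; split => //=; apply/negP; rewrite -ltNge.
by move=> H i; have [/= h1 /negP] := H i I; rewrite -ltNge h1 => ->.
Qed.

Lemma rV_ball (x y : E) (e : R) : 0 < e ->
  (forall i, `|x ord0 i - y ord0 i| < e) -> ball x e y.
Proof. by move=> e0 H; split=> //i j; rewrite (ord1 i); exact: H. Qed.

Lemma open_measurable_rV A : open A -> measurable A.
Proof.
move=> oA.
(* Boxes with rational centre and half-side [1/(m+1)] form a countable family. The centre is picked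
   above [x] in each coordinate by less than [d < e/2], so the box contains [x] and stays within [e]
   of it. *)
pose c (q : 'rV[rat]_n.+1 * nat) : E * E :=
  (\row_i (ratr (q.1 ord0 i) - (q.2.+1%:R)^-1), \row_i (ratr (q.1 ord0 i) + (q.2.+1%:R)^-1)).
have -> : A = \bigcup_(q in [set q | box (c q) `<=` A]) box (c q).
  apply/seteqP; split=> [x Ax|x [q qA]]; last exact: qA.
  have /nbhs_ballP[e /= e0 eA] := open_nbhs_nbhs (conj oA Ax).
  have [m _ /(_ m (leqnn m)) me] := near_infty_natSinv_lt (PosNum (divr_gt0 e0 (ltr0n R 2))).
  pose d : R := m.+1%:R^-1; have d0 : 0 < d by rewrite invr_gt0.
  have /choice[z zP] i : exists z : rat, x ord0 i < ratr z < x ord0 i + d.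
    have [|z] := @rat_in_itvoo R (x ord0 i) (x ord0 i + d); first by rewrite ltrDl.
    by rewrite in_itv/=; exists z.
  have me' : d < e / 2 by [].
  exists (\row_i z i, m).
    move=> y /= cy; apply: eA; apply: rV_ball => // i.
    have := cy i; have := zP i; rewrite !mxE -/d => /andP[? ?] /andP[? ?].
    by rewrite ltr_norml; apply/andP; split; lra.
  by move=> i; have /andP[] := zP i; rewrite /= !mxE -/d => *; apply/andP; split; lra.
rewrite bigcup_mkcond; apply: countable_bigcupT_measurable => // q.
by case: ifP => // _; exact: measurable_box.
Qed.

Lemma continuous_measurable_rV A (f : E -> R) :
  open A -> {in A, continuous f} -> measurable_fun A f.
Proof.
move=> oA; rewrite -(continuous_open_subspace f oA) => /continuousP cf.
move=> mA; apply: (measurability _ (RGenOpens.measurableE R)) => //.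
move=> _ [_ [a [b ->] <-]]; have /open_subspaceP[V oV VD] : open (from_subspace A f @^-1` `]a, b[%classic).
  exact/cf/interval_open.
rewrite setIC -VD; exact/open_measurable_rV/openI.
Qed.

Definition affine_map (t : R) (b : E) (x : E) : E := b + t *: x.

Lemma lebesgue_outer_affine_le (t : R) (b : E) A : 0 < t ->
  ((t ^+ n.+1)%:E * lebesgue_outer (affine_map t b @^-1` A) <= lebesgue_outer A)%E.
Proof.
move=> t0; apply: le_ereal_inf_tmp => _ [F AF <-].
pose s (x : E) : E := t^-1 *: (x - b).
rewrite -lee_pdivlMl ?exprn_gt0// -nneseriesZl//; last first.
  by move=> *; rewrite lee_fin box_vol_ge0.
apply: ereal_inf_lbound; exists (fun k => (s (F k).1, s (F k).2)).
  move=> x /= /AF[k _ Fk]; exists k => // i; have /andP[] := Fk i.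
  rewrite /= !mxE => h1 h2; apply/andP; split.
    by rewrite mulrC ltr_pdivrMr// ltrBlDl (mulrC _ t).
  by rewrite mulrC ler_pdivlMr// lerBrDl (mulrC _ t).
apply: eq_eseriesr => k _; rewrite -EFinM; congr EFin.
rewrite /box_vol -exprVn -[in X in _ = X * _](card_ord n.+1) -prodr_const -big_split/=.
apply: eq_bigr => i _; rewrite !mxE -mulrBr opprB addrA subrK.
by rewrite maxr_pMr ?invr_ge0 ?ltW// mulr0.
Qed.

(** The inequality for [t] and the inequality for the inverse map, of ratio [t^-1], are the two
    directions. *)
Lemma lebesgue_outer_affine (t : R) (b : E) A : 0 < t ->
  lebesgue_outer (affine_map t b @^-1` A) = (((t ^+ n.+1)^-1)%:E * lebesgue_outer A)%E.
Proof.
move=> t0; apply/eqP; rewrite eq_le; apply/andP; split.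
  by rewrite lee_pdivlMl ?exprn_gt0// lebesgue_outer_affine_le.
have t0' : 0 < t^-1 by rewrite invr_gt0.
have := lebesgue_outer_affine_le (- (t^-1 *: b)) (affine_map t b @^-1` A) t0'.
rewrite -comp_preimage exprVn (_ : _ \o _ = id) ?preimage_id//.
apply/funext => x; rewrite /affine_map/= scalerDr scalerN !scalerA divff ?gt_eqF//.
by rewrite !scale1r addrA subrr add0r.
Qed.

Lemma measurable_affine (t : R) (b : E) : 0 < t ->
  measurable_fun [set: E] (affine_map t b).
Proof.
move=> t0 _ A mA; rewrite setTI; apply: le_caratheodory_measurable => X.
have {}mA Z : (lebesgue_outer Z = lebesgue_outer (Z `&` A) + lebesgue_outer (Z `&` ~` A))%E.
  exact: mA.
have t0' : 0 < t^-1 by rewrite invr_gt0.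
(* The map is a bijection, so every test set is a preimage and the criterion for the preimage of [A]
   is a multiple of the one for [A]. *)
have [Y ->] : exists Y, X = affine_map t b @^-1` Y.
  exists (affine_map t^-1 (- (t^-1 *: b)) @^-1` X).
  apply/seteqP; split => x; rewrite /preimage/affine_map/= scalerDr scalerA;
  by rewrite mulVf ?gt_eqF// scale1r addrA addNr add0r.
have : (lebesgue_outer (affine_map t b @^-1` (Y `&` A)) +
    lebesgue_outer (affine_map t b @^-1` (Y `&` ~` A)) <=
    lebesgue_outer (affine_map t b @^-1` Y))%E.
  do 3 rewrite lebesgue_outer_affine//.
  by rewrite [in leRHS](mA Y) ge0_muleDr// lebesgue_outer_ge0.
by rewrite preimage_setI preimage_setI -preimage_setC; exact.
Qed.

Lemma lebesgue_box_lty ab : (lebesgue (box ab) < +oo)%E.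
Proof.
apply: (@le_lt_trans _ _ (box_vol ab)%:E); last exact: ltry.
apply: ereal_inf_lbound; exists (fun k => if k == 0%N then ab else (0, 0)).
  by move=> x abx; exists 0%N.
rewrite (nneseriesD1 (n := 0%N)) => [|k|] //; last first.
  by rewrite lee_fin box_vol_ge0.
rewrite eseries0 ?adde0// => k _ /= k0; by rewrite (negbTE k0) box_vol_diag.
Qed.

(** By the scaling of the outer measure, the pushforward of [lebesgue] under the affine map is
    [lebesgue] times [t^-(n+1)]. *)
Lemma ge0_integral_affine (t : R) (b : E) A (h : E -> \bar R) : 0 < t ->
  measurable A -> measurable_fun A h -> (forall x, A x -> 0 <= h x)%E ->
  (\int[lebesgue]_(x in affine_map t b @^-1` A) h (affine_map t b x) =
   ((t ^+ n.+1)^-1)%:E * \int[lebesgue]_(x in A) h x)%E.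
Proof.
move=> t0 mA mh h0.
have tn0 : 0 <= (t ^+ n.+1)^-1 by rewrite invr_ge0 exprn_ge0// ltW.
rewrite -(ge0_integral_mscale lebesgue mA (NngNum tn0))//.
rewrite -(ge0_integral_pushforward (measurable_affine b t0)) => //; last first.
  by move=> x; rewrite inE => /h0.
apply: eq_measure_integral => [mT B mB|mT B mB BA].
  exact: (measurable_affine b t0).
exact: (lebesgue_outer_affine b B t0).
Qed.

End lebesgue_facts.

(** * Euclidean norm and balls *)

Lemma cvg_sumr {R : realType} {T I : Type} (F : set_system T) (s : seq I)
    (f : I -> T -> R) (l : I -> R) : Filter F ->
  (forall i, f i x @[x --> F] --> l i) ->
  \sum_(i <- s) f i x @[x --> F] --> \sum_(i <- s) l i.
Proof.
move=> FF fl; elim: s => [|i s IHs].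
  by under eq_fun do rewrite big_nil; rewrite big_nil; exact: cvg_cst.
under eq_fun do rewrite big_cons; rewrite big_cons.
by apply: cvgD => //; exact: fl.
Qed.

Section euclidean_norm.
Context {R : realType} {m k : nat}.
Implicit Types (x y z : 'M[R]_(m, k)).

Definition mdot x y : R := \sum_i \sum_j x i j * y i j.

Lemma mdotC x y : mdot x y = mdot y x.
Proof. by apply: eq_bigr => i _; apply: eq_bigr => j _; rewrite mulrC. Qed.

Lemma mdotDl x y z : mdot (x + y) z = mdot x z + mdot y z.
Proof.
rewrite -big_split; apply: eq_bigr => i _ /=; rewrite -big_split/=.
by apply: eq_bigr => j _; rewrite mxE mulrDl.
Qed.

Lemma mdotZl c x y : mdot (c *: x) y = c * mdot x y.
Proof.
rewrite mulr_sumr; apply: eq_bigr => i _; rewrite mulr_sumr.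
by apply: eq_bigr => j _; rewrite mxE mulrA.
Qed.

Lemma mdotDr x y z : mdot x (y + z) = mdot x y + mdot x z.
Proof. by rewrite mdotC mdotDl !(mdotC x). Qed.

Lemma mdotZr c x y : mdot x (c *: y) = c * mdot x y.
Proof. by rewrite mdotC mdotZl mdotC. Qed.

Lemma mdotNl x y : mdot (- x) y = - mdot x y.
Proof. by rewrite -scaleN1r mdotZl mulN1r. Qed.

Lemma mdotNr x y : mdot x (- y) = - mdot x y.
Proof. by rewrite mdotC mdotNl mdotC. Qed.

Lemma mdot_ge0 x : 0 <= mdot x x.
Proof. by do 2 (apply: sumr_ge0 => ? _); rewrite -expr2 sqr_ge0. Qed.

Lemma enormE x : enorm x = Num.sqrt (mdot x x).
Proof.
by congr Num.sqrt; apply: eq_bigr => i _; apply: eq_bigr => j _; rewrite expr2.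
Qed.

Lemma enorm_ge0 x : 0 <= enorm x. Proof. exact: sqrtr_ge0. Qed.

Lemma sqr_enorm x : enorm x ^+ 2 = mdot x x.
Proof. by rewrite enormE sqr_sqrtr// mdot_ge0. Qed.

Lemma coord_le_enorm x i j : `|x i j| <= enorm x.
Proof.
rewrite -ler_sqr ?nnegrE ?enorm_ge0// sqr_enorm real_normK ?num_real//.
rewrite /mdot (bigD1 i)//= (bigD1 j)//= expr2 -addrA lerDl.
by rewrite addr_ge0//; do ?(apply: sumr_ge0 => ? _); rewrite -expr2 sqr_ge0.
Qed.

Lemma enorm_le_sum x : enorm x <= \sum_i \sum_j `|x i j|.
Proof.
have [->|x0] := eqVneq (enorm x) 0; first by do 2 (apply: sumr_ge0 => ? _).
rewrite -(ler_pM2r (x := enorm x)) ?lt0r ?x0 ?enorm_ge0// -expr2 sqr_enorm.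
rewrite mulr_suml; apply: ler_sum => i _; rewrite mulr_suml.
apply: ler_sum => j _; apply: le_trans (ler_norm _) _; rewrite normrM.
by rewrite ler_wpM2l// coord_le_enorm.
Qed.

Lemma enorm_eq0 x : enorm x = 0 -> x = 0.
Proof.
move=> x0; apply/matrixP => i j; apply/eqP; rewrite mxE -normr_le0.
by rewrite -x0 coord_le_enorm.
Qed.

Lemma enorm0 : enorm (0 : 'M[R]_(m, k)) = 0.
Proof.
by rewrite enormE -(scale0r 0) mdotZl mul0r sqrtr0.
Qed.

Lemma enormZ c x : enorm (c *: x) = `|c| * enorm x.
Proof. by rewrite !enormE mdotZl mdotZr mulrA -expr2 sqrtrM ?sqr_ge0// sqrtr_sqr. Qed.

Lemma enormN x : enorm (- x) = enorm x.
Proof. by rewrite -scaleN1r enormZ normrN1 mul1r. Qed.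

(** Cauchy-Schwarz, by expanding the square of the difference of the normalised vectors. *)
Lemma mdot_le x y : mdot x y <= enorm x * enorm y.
Proof.
have [/enorm_eq0->|y0] := eqVneq (enorm y) 0.
  by rewrite -(scale0r 0) mdotZr mul0r mulr_ge0 ?enorm_ge0.
have [/enorm_eq0->|x0] := eqVneq (enorm x) 0.
  by rewrite -(scale0r 0) mdotZl mul0r mulr_ge0 ?enorm_ge0.
have := mdot_ge0 ((enorm x)^-1 *: x - (enorm y)^-1 *: y).
rewrite mdotDl !mdotDr !mdotNl !mdotNr !mdotZl !mdotZr -!sqr_enorm (mdotC y x).
have xp : 0 < enorm x by rewrite lt0r x0 enorm_ge0.
have yp : 0 < enorm y by rewrite lt0r y0 enorm_ge0.
rewrite expr2 mulKf// mulVf// expr2 mulKf// mulVf// => h.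
have : (enorm x)^-1 * ((enorm y)^-1 * mdot x y) <= 1.
  by move: h; rewrite [_^-1 * (_ * mdot x y)]mulrCA; lra.
by rewrite mulrA -invfM mulrC ler_pdivrMr ?mulr_gt0// mul1r.
Qed.

Lemma enormD x y : enorm (x + y) <= enorm x + enorm y.
Proof.
rewrite -ler_sqr ?nnegrE ?addr_ge0 ?enorm_ge0// sqr_enorm mdotDl !mdotDr.
by rewrite (mdotC y x) -!sqr_enorm; have := mdot_le x y; nra.
Qed.

Lemma enormB_sym x y : enorm (x - y) = enorm (y - x).
Proof. by rewrite -enormN opprB. Qed.

Lemma enormB_trans x y z : enorm (x - z) <= enorm (x - y) + enorm (y - z).
Proof. by rewrite -{1}(subrK y x) -addrA enormD. Qed.

Lemma continuous_mdot : continuous (fun x => mdot x x).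
Proof.
move=> x; apply: (@cvg_sumr _ _ _ (nbhs x)) => i.
apply: (@cvg_sumr _ _ _ (nbhs x)) => j.
by apply: cvgM; exact: coord_continuous.
Qed.

Lemma continuous_enorm : continuous (@enorm R m k).
Proof.
move=> x; rewrite (_ : enorm = Num.sqrt \o (fun x => mdot x x)); last first.
  by apply/funext => y; rewrite enormE.
by apply: continuous_comp; [exact: continuous_mdot|exact: sqrt_continuous].
Qed.

End euclidean_norm.

Section euclidean_balls.
Context {R : realType} {n : nat}.
Local Notation E := 'rV[R]_n.+1.
Implicit Types (x y z : E) (r s : R).

Lemma eball_sub x y r s : enorm (x - y) + r <= s -> eball x r `<=` eball y s.
Proof.
move=> h z /= zx; apply: le_lt_trans (enormB_trans z x y) _.
by apply: lt_le_trans h; rewrite addrC ltrD2l.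
Qed.

Lemma continuous_edist x : continuous (fun y : E => enorm (y - x)).
Proof.
move=> y; apply: (@cvg_comp _ _ _ (fun y => y - x) enorm _ (nbhs (y - x))).
  exact: (cvgB cvg_id (cvg_cst _)).
exact: continuous_enorm.
Qed.

Lemma open_eball x r : open (eball x r).
Proof.
rewrite (_ : eball x r = (fun y => enorm (y - x)) @^-1` [set t | t < r])//.
apply: open_comp; last exact: open_lt.
by move=> y _; exact: continuous_edist.
Qed.

Lemma measurable_eball x r : measurable (eball x r).
Proof. exact/open_measurable_rV/open_eball. Qed.

Lemma ceball_compact x r : compact [set y : E | enorm (y - x) <= r].
Proof.
apply: bounded_closed_compact.
  exists (`|r| + enorm x); split; first exact: num_real.
  move=> M Mr y /= yr; rewrite [leLHS]/Num.norm/= mx_normrE; apply/bigmax_leP; split => [|[i j] _ /=].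
    by apply/ltW/le_lt_trans/Mr; rewrite addr_ge0// enorm_ge0.
  apply: le_trans (coord_le_enorm _ _ _) _; apply/ltW/le_lt_trans/Mr.
  rewrite -{1}(subrK x y); apply: le_trans (enormD _ _) _.
  by rewrite lerD2r; exact: le_trans yr (ler_norm _).
rewrite (_ : mkset _ = (fun y => enorm (y - x)) @^-1` [set t | t <= r])//.
apply: preimage_closed; last exact: closed_le.
by move=> y _; exact: continuous_edist.
Qed.

Lemma closure_eball_sub x r : closure (eball x r) `<=` [set y | enorm (y - x) <= r].
Proof.
have /compact_closed cl : compact [set y : E | enorm (y - x) <= r] by exact: ceball_compact.
rewrite [X in _ `<=` X](closure_id _).1; first by apply: closure_subset => y /ltW.
by apply: cl; exact: norm_hausdorff.
Qed.

Lemma compact_closure_eball x r : compact (closure (eball x r)).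
Proof.
apply: subclosed_compact (@ceball_compact x r) _; first exact: closed_closure.
exact: closure_eball_sub.
Qed.

Lemma lebesgue_eball_lty x r : (lebesgue (eball x r) < +oo)%E.
Proof.
pose c : E := const_mx (`|r| + 1).
apply: le_lt_trans (lebesgue_box_lty (x - c, x + c)).
apply: le_lebesgue_outer => y yx i /=; rewrite !mxE.
have := le_lt_trans (coord_le_enorm (y - x) ord0 i) yx; rewrite !mxE => h.
have := lt_le_trans h (ler_norm r); rewrite ltr_norml => /andP[? ?].
by apply/andP; split; lra.
Qed.

End euclidean_balls.

(** * Inequalities for powers *)

Section power_inequalities.
Context {R : realType}.
Implicit Types (a b p e : R).

Lemma powR_le a b p : 0 <= p -> 0 <= a -> a <= b -> a `^ p <= b `^ p.
Proof.
by move=> p0 a0 ab; apply: ge0_ler_powR; rewrite ?nnegrE//; exact: le_trans ab.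
Qed.

Lemma powRVK a p : p != 0 -> 0 <= a -> (a `^ p^-1) `^ p = a.
Proof. by move=> p0 a0; rewrite -powRrM mulVf// powRr1. Qed.

Lemma powRKV a p : p != 0 -> 0 <= a -> (a `^ p) `^ p^-1 = a.
Proof. by move=> p0 a0; rewrite -powRrM mulfV// powRr1. Qed.

Lemma powRD_le a b p : 0 <= p -> 0 <= a -> 0 <= b ->
  (a + b) `^ p <= 2 `^ p * (a `^ p + b `^ p).
Proof.
move=> p0 a0 b0; wlog ab : a b a0 b0 / a <= b.
  move=> H; have [/H->//|/ltW/H H'] := leP a b.
  by rewrite addrC [in leRHS]addrC H'.
apply: (@le_trans _ _ ((2 * b) `^ p)).
  by apply: powR_le => //; [exact: addr_ge0|lra].
by rewrite powRM// ler_wpM2l ?powR_ge0// lerDr powR_ge0.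
Qed.

(** If [b <= e a] the first term on the right suffices; otherwise [a <= b/e] and the second one
    does. *)
Lemma young_le a b p e : 1 <= p -> 0 <= a -> 0 <= b -> 0 < e ->
  a `^ (p - 1) * b <= e * a `^ p + e `^ (1 - p) * b `^ p.
Proof.
move=> p1 a0 b0 e0; have p0 : 0 < p by lra.
have [be|be] := leP b (e * a).
  apply: (@le_trans _ _ (e * a `^ p)); last by rewrite lerDl mulr_ge0 ?powR_ge0.
  rewrite -(mulr_powRB1 a0 p0) (mulrC _ b) mulrA ler_wpM2r ?powR_ge0//.
have ab : a <= b / e by rewrite ler_pdivlMr// mulrC ltW.
apply: (@le_trans _ _ (e `^ (1 - p) * b `^ p)); last first.
  by rewrite lerDr mulr_ge0 ?powR_ge0// ltW.
rewrite -(mulr_powRB1 b0 p0) mulrCA (mulrC b) ler_wpM2r//.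
apply: (le_trans (powR_le _ a0 ab)); first by rewrite subr_ge0.
rewrite powRM ?invr_ge0//; last exact: ltW.
by rewrite mulrC -powR_inv1 ?(ltW e0)// -powRrM mulN1r opprB.
Qed.

(** The expression equals [2] at [x = 0], and its derivative is positive on the open interval. *)
Lemma powR_sym_gt2 p (x : R) : 1 < p -> 0 < x < 1 ->
  2 < (1 + x) `^ p + (1 - x) `^ p.
Proof.
move=> p1 /andP[x0 x1].
pose f (s : R) := (1 + s) `^ p + (1 - s) `^ p.
pose f' (s : R) := p * (1 + s) `^ (p - 1) - p * (1 - s) `^ (p - 1).
have df (s : R) : 0 <= s -> s < 1 -> is_derive s 1 f (f' s).
  move=> s0 s1.
  have dp : is_derive (1 + s) 1 (fun a => a `^ p) (p * (1 + s) `^ (p - 1)).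
    by apply: is_derive1_powR; lra.
  have dm : is_derive (1 - s) 1 (fun a => a `^ p) (p * (1 - s) `^ (p - 1)).
    by apply: is_derive1_powR; lra.
  have d1 : is_derive s 1 (fun s => 1 + s) (0 + 1) by apply: is_deriveD.
  have d2 : is_derive s 1 (fun s => 1 - s) (0 - 1) by apply: is_deriveB.
  have h1 := @is_derive1_comp _ (fun a => a `^ p) (fun s => 1 + s) _ _ _ dp d1.
  have h2 := @is_derive1_comp _ (fun a => a `^ p) (fun s => 1 - s) _ _ _ dm d2.
  have := is_deriveD h1 h2.
  by rewrite add0r sub0r mulr1 mulrN1.
have [||c] := @MVT _ f f' 0 x x0.
- by move=> s; rewrite in_itv/= => /andP[? ?]; apply: df; lra.
- apply: derivable_within_continuous => s; rewrite in_itv/= => /andP[? ?].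
  by apply: ex_derive; apply: df; lra.
- rewrite in_itv/= => /andP[c0 cx]; rewrite /f addr0 !subr0 powR1 => fx.
  suff : 0 < f' c * x by rewrite -fx; lra.
  rewrite mulr_gt0// /f' -mulrBr mulr_gt0//; first lra.
  by rewrite subr_gt0 gt0_ltr_powR ?nnegrE//; lra.
Qed.

(** The graph of the power lies above its tangent at [m]: this is Young's inequality for
    [s * m^(p-1)] with exponents [p] and [p/(p-1)]. *)
Lemma powR_tangent_le p s m : 1 < p -> 0 <= s -> 0 <= m ->
  m `^ p + p * m `^ (p - 1) * (s - m) <= s `^ p.
Proof.
move=> p1 s0 m0; have p0 : 0 < p by lra.
have q0 : 0 < p / (p - 1) by rewrite divr_gt0//; lra.
have := @conjugate_powR _ s (m `^ (p - 1)) p (p / (p - 1)) s0 (powR_ge0 _ _) p0 q0.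
rewrite -powRrM (_ : (p - 1) * (p / (p - 1)) = p); last by field; lra.
rewrite invf_div => /(_ _)/wrap[]; first by field; lra.
have := mulr_powRB1 m0 p0.
move: (m `^ (p - 1)) (m `^ p) (s `^ p) => a b c <-.
move=> h.
have : p * (s * a) <= p * (c / p + m * a * ((p - 1) / p)) by rewrite ler_pM2l.
have -> : p * (c / p + m * a * ((p - 1) / p)) = c + m * a * (p - 1) by field; lra.
nra.
Qed.

(** [1 + e] and [1 - e] are convex combinations of [1] with [1 + x] and [1 - x], of weight [e/x].
    Hence the excess over [2] at [e] is at most [e/x] times the excess at [x]; since it is positive,
    it is at most the excess at [x]. *)
Lemma powR_sym_ge p x e : 1 < p -> 0 < e -> e <= x -> x <= 1 ->
  (1 + e) `^ p + (1 - e) `^ p <= (1 + x) `^ p + (1 - x) `^ p.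
Proof.
move=> p1 e0 ex x1.
have cvx y z : -1 <= y -> y <= 1 -> z = e / x * y -> (1 + z) `^ p - 1 <= e / x * ((1 + y) `^ p - 1).
  move=> y1 y2 zE.
  have ex1 : 0 < e / x <= 1 by rewrite divr_gt0 ?ler_pdivrMr ?mul1r//; lra.
  have z1 : 0 <= 1 + z by rewrite zE; nra.
  have := @powR_tangent_le p (1 + y) (1 + z) p1.
  have := @powR_tangent_le p 1 (1 + z) p1.
  rewrite powR1 => /(_ ler01 z1) h1 /(_ _ z1) => /(_ _)/wrap[|h2]; first lra.
  move: zE h1 h2; move: (e / x) ex1 => l /andP[l0 l1].
  move: (p * _) ((1 + z) `^ p) ((1 + y) `^ p) => A B C zE h1 h2.
  have H : l * (B + A * (1 + y - (1 + z))) <= l * C by rewrite ler_pM2l.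
  have H' : (1 - l) * (B + A * (1 - (1 + z))) <= (1 - l) * 1 by rewrite ler_wpM2l//; lra.
  have : l * (B + A * (1 + y - (1 + z))) + (1 - l) * (B + A * (1 - (1 + z))) = B.
    by rewrite zE; ring.
  lra.
have x0 : 0 < x by lra.
have := ex; rewrite -(ler_pM2r (x := x^-1)) ?invr_gt0// divff ?gt_eqF// => l1.
have l0 : 0 < e / x by rewrite divr_gt0.
have H1 : (1 + e) `^ p - 1 <= e / x * ((1 + x) `^ p - 1).
  by apply: cvx; [lra|lra|field; lra].
have H2 : (1 - e) `^ p - 1 <= e / x * ((1 - x) `^ p - 1).
  by apply: cvx; [lra|lra|field; lra].
have := @powR_sym_gt2 p e p1.
have [->|e1] := eqVneq e x; first by [].
rewrite e0 => /(_ _)/wrap[|H3]; first by lra.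
move: H1 H2 H3 l0 l1; move: (e / x) ((1 + e) `^ _) ((1 - e) `^ _) ((1 + x) `^ _) ((1 - x) `^ _).
by move=> l A B C D *; nra.
Qed.

Lemma powR_mean_le p s t : 1 < p -> 0 <= s -> 0 <= t ->
  ((s + t) / 2) `^ p <= (s `^ p + t `^ p) / 2.
Proof.
move=> p1 s0 t0; have m0 : 0 <= (s + t) / 2 by lra.
have := powR_tangent_le p1 s0 m0; have := powR_tangent_le p1 t0 m0.
by move: (p * _) => A; lra.
Qed.

(** With [M] the mean, [s = M (1 + x)] and [t = M (1 - x)]; the relative gap means [x >= e], and
    [powR_sym_ge] applies after division by [M^p]. *)
Lemma powR_mean_gap p e s t : 1 < p -> 0 < e < 1 -> 0 <= s -> 0 <= t ->
  e * (s + t) <= `|s - t| ->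
  (((1 + e) `^ p + (1 - e) `^ p) / 2 - 1) * ((s + t) / 2) `^ p <=
  (s `^ p + t `^ p) / 2 - ((s + t) / 2) `^ p.
Proof.
move=> p1 /andP[e0 e1] s0 t0; wlog st : s t s0 t0 / t <= s => [H|].
  have [/H|/ltW/H] := leP t s; first exact.
  by rewrite distrC (addrC t) (addrC (t `^ p)); exact.
rewrite ger0_norm ?subr_ge0// => h.
have [sE|m0] := eqVneq s 0.
  have -> : t = 0 by lra.
  rewrite sE.
  have pn0 : p != 0 by rewrite gt_eqF//; lra.
  by rewrite addr0 mul0r powR0// mulr0 addr0 mul0r subr0.
have sp : 0 < s by rewrite lt0r m0.
have mp : 0 < (s + t) / 2 by lra.
pose x := (s - t) / (s + t).
have xE : s = (s + t) / 2 * (1 + x) by rewrite /x; field; lra.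
have yE : t = (s + t) / 2 * (1 - x) by rewrite /x; field; lra.
have x1 : x <= 1 by rewrite ler_pdivrMr; lra.
have ex : e <= x by rewrite ler_pdivlMr; lra.
have := powR_sym_ge p1 e0 ex x1.
have -> : s `^ p = ((s + t) / 2) `^ p * (1 + x) `^ p by rewrite -powRM -?xE//; lra.
have -> : t `^ p = ((s + t) / 2) `^ p * (1 - x) `^ p by rewrite -powRM -?yE//; lra.
have := powR_ge0 ((s + t) / 2) p.
move: (_ `^ p) ((1 + e) `^ p) ((1 - e) `^ p) ((1 + x) `^ p) ((1 - x) `^ p) => M A B C D.
by move=> *; nra.
Qed.

Lemma powR_sub_ge p m z : 1 <= p -> 0 <= z -> z <= m ->
  m `^ (p - 1) * (m - z) <= m `^ p - z `^ p.
Proof.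
move=> p1 z0 zm; have p0 : 0 < p by lra.
have m0 : 0 <= m by lra.
have := powR_le (p := p - 1) _ z0 zm; rewrite subr_ge0 => /(_ p1).
have := mulr_powRB1 m0 p0; have := mulr_powRB1 z0 p0.
by move: (m `^ (p - 1)) (z `^ (p - 1)) (m `^ p) (z `^ p) => A B C D; nra.
Qed.

(** The scalars stand for [|a|], [|b|], [|(a+b)/2|] and [|a-b|], and the last hypothesis is the
    parallelogram identity. If the lengths differ much, or the midpoint is much shorter than the
    mean length [M], the convexity gap is at least [c M^p]. Otherwise [u] is small against [M], and
    its power is absorbed by the [e]-term. *)
Lemma powR_uniform_convexity p e : 1 < p -> 0 < e ->
  exists2 C : R, 0 < C & forall s t z u : R,
  0 <= s -> 0 <= t -> 0 <= z -> 0 <= u -> z <= (s + t) / 2 -> u <= s + t ->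
  u ^+ 2 = (s - t) ^+ 2 + 4 * (((s + t) / 2) ^+ 2 - z ^+ 2) ->
  u `^ p <= e * (s `^ p + t `^ p) + C * ((s `^ p + t `^ p) / 2 - z `^ p).
Proof.
move=> p1 e0; have p0 : 0 < p by lra.
(* [d] separates the cases; in the last one [u <= 3 d M]. *)
have [d [d0 d1 de]] : exists d : R, [/\ 0 < d, d < 1 & (3 * d) `^ p <= e].
  have q0 : 0 < e `^ p^-1 by rewrite powR_gt0.
  exists (Num.min 2^-1 (e `^ p^-1 / 3)); split.
  - by rewrite lt_min; apply/andP; split; lra.
  - by rewrite gt_min; apply/orP; left; lra.
  - rewrite -[leRHS](powRVK (p := p)) ?gt_eqF//; last exact: ltW.
    apply: powR_le; [lra| |].
      by rewrite mulr_ge0// le_min; apply/andP; split; lra.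
    by rewrite mulrC -ler_pdivlMr// ge_min lexx orbT.
(* The first bound on [c] is the gap for lengths that differ. The second serves a short midpoint,
   where [M^p - z^p >= M^(p-1) (M - z) >= d^2 M^p / 2]. As [u <= 2 M], either case gives the
   constant [2^p / c]. *)
have [c [c0 c1 c2]] : exists c : R, [/\ 0 < c,
    c <= ((1 + d) `^ p + (1 - d) `^ p) / 2 - 1 & c <= d ^+ 2 / 2].
  exists (Num.min (((1 + d) `^ p + (1 - d) `^ p) / 2 - 1) (d ^+ 2 / 2)).
  rewrite !ge_min !lexx orbT lt_min divr_gt0 ?exprn_gt0// andbT; split => //.
  by have := @powR_sym_gt2 p d p1; rewrite d0 d1 => /(_ isT); lra.
exists (2 `^ p / c); first by rewrite divr_gt0// powR_gt0.
have C0 : 0 <= 2 `^ p / c by rewrite divr_ge0 ?powR_ge0// ltW.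
move=> s t z u s0 t0 z0 u0; pose M := (s + t) / 2.
have stM : s + t = 2 * M by rewrite /M; lra.
have D1 : M `^ p <= (s `^ p + t `^ p) / 2 by exact: powR_mean_le.
have gap := @powR_mean_gap p d s t p1 _ s0 t0.
rewrite -/M stM; rewrite d0 d1 -/M stM in gap; move: gap => /(_ isT) gap.
have sp := powR_ge0 s p; have tp := powR_ge0 t p.
move: M D1 gap {stM} => M D1 gap zM uM uE.
have M0 : 0 <= M by exact: le_trans zM.
have Mp := powR_ge0 M p.
have D2' : z `^ p <= M `^ p by apply: powR_le => //; exact: ltW.
have key : c * M `^ p <= (s `^ p + t `^ p) / 2 - z `^ p -> u `^ p <=
    e * (s `^ p + t `^ p) + 2 `^ p / c * ((s `^ p + t `^ p) / 2 - z `^ p).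
  move=> h; apply: (@le_trans _ _ (2 `^ p / c * (c * M `^ p))).
    rewrite mulrA divfK ?gt_eqF// -powRM//.
    by apply: powR_le => //; exact: ltW.
  apply: (@le_trans _ _ (2 `^ p / c * ((s `^ p + t `^ p) / 2 - z `^ p))).
    by rewrite ler_wpM2l.
  by rewrite lerDr mulr_ge0 ?addr_ge0// ltW.
have [st|st] := leP (d * (2 * M)) `|s - t|.
  apply: key; apply: (@le_trans _ _ ((s `^ p + t `^ p) / 2 - M `^ p)).
    by apply: le_trans (gap st); rewrite ler_wpM2r.
  by rewrite lerD2l lerN2.
have [zd|zd] := leP (d ^+ 2 * M ^+ 2) (M ^+ 2 - z ^+ 2).
  apply: key; apply: (@le_trans _ _ (d ^+ 2 / 2 * M `^ p)); first by rewrite ler_wpM2r.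
  apply: (@le_trans _ _ (M `^ p - z `^ p)); last by rewrite lerD2r.
  apply: le_trans (powR_sub_ge (ltW p1) z0 zM).
  rewrite -(mulr_powRB1 M0 p0) mulrA (mulrC _ (M - z)) ler_wpM2r ?powR_ge0//.
  have [M00|Mn0] := eqVneq M 0.
    by move: zM z0; rewrite M00 mulr0 sub0r oppr_ge0.
  have Mgt0 : 0 < M by rewrite lt0r Mn0.
  rewrite -(ler_pM2r Mgt0); move: zd (sqr_ge0 (M - z)); clear.
  by move: (d ^+ 2) => X; nra.
apply: (@le_trans _ _ (e * (s `^ p + t `^ p))); last first.
  by rewrite lerDl mulr_ge0// subr_ge0; exact: le_trans D1.
have d30 : 0 <= 3 * d by rewrite mulr_ge0// ltW.
apply: (@le_trans _ _ ((3 * d * M) `^ p)).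
  apply: powR_le => //; first exact: ltW.
  have dM0 : 0 <= 3 * d * M by rewrite mulr_ge0.
  rewrite -ler_sqr ?nnegrE// uE.
  have : (s - t) ^+ 2 <= (d * (2 * M)) ^+ 2.
    rewrite -[leLHS]real_normK ?num_real// ler_sqr ?nnegrE//; first exact: ltW.
    by rewrite !mulr_ge0// ltW.
  have -> : (d * (2 * M)) ^+ 2 = 4 * (d ^+ 2 * M ^+ 2) by ring.
  have -> : (3 * d * M) ^+ 2 = 9 * (d ^+ 2 * M ^+ 2) by ring.
  have := mulr_ge0 (sqr_ge0 d) (sqr_ge0 M).
  move: (d ^+ 2 * M ^+ 2) (M ^+ 2) (z ^+ 2) zd ((s - t) ^+ 2) => X Y Z; clear.
  by move=> ? ? ? ?; lra.
rewrite powRM//; apply: (@le_trans _ _ (e * M `^ p)); first by rewrite ler_wpM2r.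
rewrite ler_wpM2l//; first exact: ltW.
by apply: (le_trans D1); rewrite ler_pdivrMr// ler_peMr ?ler1n// addr_ge0.
Qed.

Lemma enorm_uniform_convexity p e (m k : nat) : 1 < p -> 0 < e ->
  exists2 C : R, 0 < C & forall a b : 'M[R]_(m, k),
  enorm (a - b) `^ p <= e * (enorm a `^ p + enorm b `^ p) +
    C * ((enorm a `^ p + enorm b `^ p) / 2 - enorm (2^-1 *: (a + b)) `^ p).
Proof.
move=> p1 e0; have [C C0 H] := powR_uniform_convexity p1 e0.
exists C => // a b; apply: H; rewrite ?enorm_ge0//.
- by rewrite enormZ ger0_norm ?invr_ge0// mulrC ler_pM2r ?invr_gt0// enormD.
- by rewrite -(enormN b) enormD.
- rewrite sqr_enorm enormZ ger0_norm ?invr_ge0//.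
  rewrite (_ : (2^-1 * enorm (a + b)) ^+ 2 = 2^-1 ^+ 2 * enorm (a + b) ^+ 2); last first.
    by rewrite exprMn.
  rewrite sqr_enorm !(mdotDl, mdotDr, mdotNl, mdotNr) (mdotC b a) -!sqr_enorm.
  by field.
Qed.

Lemma powR_sub2M p (t : R) : 1 < p -> 0 <= t -> t `^ (p - 2) * (t * t) = t `^ p.
Proof.
move=> p1; rewrite le_eqVlt => /predU1P[<-|t0].
  by rewrite mul0r mulr0 powR0// gt_eqF//; lra.
rewrite -expr2 -powR_mulrn ?ltW// -powRD; last by rewrite (gt_eqF t0) implybT.
by rewrite subrK.
Qed.

Lemma powR_sub2_mdot p (m k : nat) (a b : 'M[R]_(m, k)) : 1 < p ->
  `|enorm a `^ (p - 2) * mdot a b| <= enorm a `^ (p - 1) * enorm b.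
Proof.
move=> p1; have [a0|a0] := eqVneq (enorm a) 0.
  have -> : mdot a b = 0 by rewrite (enorm_eq0 a0) -(scale0r 0) mdotZl mul0r.
  by rewrite mulr0 normr0 mulr_ge0 ?powR_ge0 ?enorm_ge0.
have -> : enorm a `^ (p - 1) = enorm a `^ (p - 2) * enorm a.
  rewrite -[X in _ * X](powRr1 (enorm_ge0 a)) -powRD; last by rewrite a0 implybT.
  by congr (_ `^ _); ring.
rewrite normrM ger0_norm ?powR_ge0// -mulrA ler_wpM2l ?powR_ge0//.
by rewrite ler_norml mdot_le andbT lerNl -mdotNr -[in leRHS](enormN b) mdot_le.
Qed.

(** The tangent inequality is based at the perturbed point [a + t b], not at [a], so it bounds the
    increment from above. This is the direction in which a minimality condition is exploited. *)
Lemma enorm_powR_convex p (m k : nat) (a b : 'M[R]_(m, k)) (t : R) : 1 < p -> 0 < t ->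
  enorm (a + t *: b) `^ p - enorm a `^ p <=
  t * (p * (enorm (a + t *: b) `^ (p - 2) * mdot (a + t *: b) b)).
Proof.
move=> p1 t0; have p0 : 0 < p by lra.
have [c cE] : exists c, c = a + t *: b by exists (a + t *: b).
have aE : a = c - t *: b by rewrite cE addrK.
rewrite -cE.
have -> : t * (p * (enorm c `^ (p - 2) * mdot c b)) =
    p * (enorm c `^ p - enorm c `^ (p - 2) * mdot c a).
  rewrite -(powR_sub2M p1 (enorm_ge0 c)) -expr2 sqr_enorm aE.
  by rewrite mdotDr mdotNr mdotZr; ring.
have := powR_tangent_le p1 (enorm_ge0 a) (enorm_ge0 c).
have := mulr_powRB1 (enorm_ge0 c) p0.
have := le_trans (ler_norm _) (powR_sub2_mdot c a p1).
move: (enorm c) (enorm a) => u v; move: (u `^ (p - 2) * _) (u `^ (p - 1)) (u `^ p) (v `^ p).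
by move=> A B C D; nra.
Qed.

Lemma powR_cvg (u : nat -> R) (l r : R) : 0 < l -> u k @[k --> \oo] --> l ->
  u k `^ r @[k --> \oo] --> l `^ r.
Proof.
move=> l0; apply: (@continuous_cvg _ _ _ _ _ u (fun x => x `^ r)).
apply: differentiable_continuous; apply/derivable1_diffP.
by apply: derivable_powR; rewrite in_itv/= l0.
Qed.

Lemma cvg_powR0 (u : nat -> R) (r : R) : 0 < r -> (forall k, 0 <= u k) ->
  u k @[k --> \oo] --> 0 -> u k `^ r @[k --> \oo] --> 0.
Proof.
move=> r0 u0 /cvgr0Pnorm_lt cu; apply/cvgr0Pnorm_lt => e e0.
have := cu (e `^ r^-1) (powR_gt0 _ e0); apply: filterS => k.
rewrite !ger0_norm ?powR_ge0// => h.
rewrite -[ltRHS](powRVK (p := r)) ?gt_eqF//; last exact: ltW.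
by apply: gt0_ltr_powR; rewrite ?nnegrE ?powR_ge0.
Qed.

Lemma cvg_powR (u : nat -> R) (l r : R) : 0 < r -> (forall k, 0 <= u k) ->
  u k @[k --> \oo] --> l -> u k `^ r @[k --> \oo] --> l `^ r.
Proof.
move=> r0 u0 ul; have : 0 <= l.
  by rewrite -(cvg_lim (@Rhausdorff R) ul); apply: limr_ge; [apply/cvg_ex; exists l|exact: nearW].
rewrite le_eqVlt => /predU1P[l0|l0]; last exact: powR_cvg.
by rewrite -l0 powR0 ?gt_eqF//; apply: cvg_powR0 => //; rewrite l0.
Qed.

Lemma enorm_cvg (m k : nat) (a : nat -> 'M[R]_(m, k)) (l : 'M[R]_(m, k)) :
  (forall i j, a h i j @[h --> \oo] --> l i j) -> enorm (a h) @[h --> \oo] --> enorm l.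
Proof.
move=> al; apply: (@continuous_cvg _ _ _ _ _ _ Num.sqrt); first exact: sqrt_continuous.
apply: (@cvg_sumr _ _ _ (nbhs \oo)) => i; apply: (@cvg_sumr _ _ _ (nbhs \oo)) => j.
by rewrite expr2; under eq_fun do rewrite expr2; apply: cvgM; exact: al.
Qed.

Lemma mulmx_cvg (m k q : nat) (A : 'M[R]_(q, m)) (a : nat -> 'M[R]_(m, k)) (l : 'M[R]_(m, k)) :
  (forall i j, a h i j @[h --> \oo] --> l i j) ->
  forall i j, (A *m a h) i j @[h --> \oo] --> (A *m l) i j.
Proof.
move=> al i j; rewrite mxE; under eq_fun do rewrite mxE.
apply: (@cvg_sumr _ _ _ (nbhs \oo)) => x.
by apply: cvgM; [exact: cvg_cst|exact: al].
Qed.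

(** At a zero limit the factor [|.|^(p-2)] may blow up when [p < 2]; there the product is squeezed
    by [|a|^(p-1) |b|]. *)
Lemma powR_sub2_mdot_cvg p (m k : nat) (a : nat -> 'M[R]_(m, k)) (l b : 'M[R]_(m, k)) :
  1 < p -> (forall i j, a h i j @[h --> \oo] --> l i j) ->
  enorm (a h) `^ (p - 2) * mdot (a h) b @[h --> \oo] --> enorm l `^ (p - 2) * mdot l b.
Proof.
move=> p1 al.
have ab : mdot (a h) b @[h --> \oo] --> mdot l b.
  apply: (@cvg_sumr _ _ _ (nbhs \oo)) => i; apply: (@cvg_sumr _ _ _ (nbhs \oo)) => j.
  by apply: cvgM; [exact: al|exact: cvg_cst].
have ea := enorm_cvg al.
have [l0|l0] := eqVneq (enorm l) 0; last first.
  by apply: cvgM => //; apply: powR_cvg => //; rewrite lt0r l0 enorm_ge0.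
rewrite (_ : mdot l b = 0); last by rewrite (enorm_eq0 l0) -(scale0r 0) mdotZl mul0r.
rewrite mulr0; apply/norm_cvg0P.
have c0 : enorm (a h) `^ (p - 1) * enorm b @[h --> \oo] --> 0.
  rewrite -[X in _ --> X](mul0r (enorm b)); apply: cvgM; last exact: cvg_cst.
  apply: cvg_powR0; [by rewrite subr_gt0|by move=> h; exact: enorm_ge0|].
  by rewrite -l0.
apply: (squeeze_cvgr _ (cvg_cst 0) c0).
by apply: nearW => h; rewrite normr_ge0/= powR_sub2_mdot.
Qed.

End power_inequalities.

(** * C^1 functions on a ball *)

Section measurability.
Context {R : realType} d {T : measurableType d}.
Implicit Types (D : set T).

Lemma measurable_mdot m k D (g h : T -> 'M[R]_(m, k)) :
  (forall i j, measurable_fun D (fun x => g x i j)) ->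
  (forall i j, measurable_fun D (fun x => h x i j)) ->
  measurable_fun D (fun x => mdot (g x) (h x)).
Proof.
move=> mg mh; apply: measurable_sum => i; apply: measurable_sum => j.
exact: measurable_funM.
Qed.

Lemma measurable_enorm m k D (g : T -> 'M[R]_(m, k)) :
  (forall i j, measurable_fun D (fun x => g x i j)) ->
  measurable_fun D (fun x => enorm (g x)).
Proof.
move=> mg; under eq_fun do rewrite enormE.
apply: (@measurableT_comp _ _ _ _ _ _ (@Num.sqrt R)); last exact: measurable_mdot.
by apply: continuous_measurable_fun; exact: sqrt_continuous.
Qed.

End measurability.

Section C1_functions.
Context {R : realType} {n : nat}.
Local Notation E := 'rV[R]_n.+1.
Variables (x0 : E) (r0 : R).
Let B := eball x0 r0.
Implicit Types (f : E -> R) (x y : E).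

Lemma measurable_C1_closure f : C1_closure B f -> measurable_fun B f.
Proof.
move=> [_ df _]; apply: continuous_measurable_rV; first exact: open_eball.
by move=> x; rewrite inE => /df /differentiable_continuous.
Qed.

Lemma C1_closure_continuous_coord (G : E -> 'cV[R]_n.+1) i :
  {within closure B, continuous G} -> {in B, continuous (fun x => G x i ord0)}.
Proof.
move=> cG; have := continuous_subspaceW (@subset_closure _ B) cG.
rewrite continuous_open_subspace; last exact: open_eball.
move=> H x xB; apply: (@continuous_comp _ _ _ G (fun M : 'cV[R]_n.+1 => M i ord0)).
  exact: H.
exact: coord_continuous.
Qed.

Lemma measurable_grad_coord f i : C1_closure B f ->
  measurable_fun B (fun x => grad f x i ord0).
Proof.
move=> [_ _ [G [cG fG]]].
apply: (@eq_measurable_fun _ _ _ _ _ (fun x => G x i ord0)).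
  by move=> x; rewrite inE => /fG->.
apply: continuous_measurable_rV; first exact: open_eball.
exact: C1_closure_continuous_coord.
Qed.

Lemma measurable_enorm_grad f : C1_closure B f ->
  measurable_fun B (fun x => enorm (grad f x)).
Proof.
by move=> C1f; apply: measurable_enorm => i j; rewrite ord1; exact: measurable_grad_coord.
Qed.

Lemma C1_closure_bounded f : C1_closure B f ->
  exists2 M, 0 <= M & forall x, B x -> `|f x| <= M.
Proof.
move=> [cf _ _].
have /compact_bounded[M [_ HM]] := continuous_compact cf (@compact_closure_eball _ _ x0 r0).
exists (`|M| + 1) => [|x Bx]; first by rewrite addr_ge0.
apply: HM; first by rewrite (le_lt_trans (ler_norm _))// ltrDl.
by exists x => //; exact: subset_closure.
Qed.

Lemma grad_bounded f : C1_closure B f ->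
  exists2 M, 0 <= M & forall x, B x -> enorm (grad f x) <= M.
Proof.
move=> [_ _ [G [cG fG]]].
have /compact_bounded[M [_ HM]] := continuous_compact cG (@compact_closure_eball _ _ x0 r0).
exists (\sum_(i < n.+1) \sum_(j < 1) (`|M| + 1)).
  by do 2 (apply: sumr_ge0 => ? _); rewrite addr_ge0.
move=> x Bx; apply: le_trans (enorm_le_sum _) _.
apply: ler_sum => i _; apply: ler_sum => j _; rewrite fG//.
apply: le_trans (HM (`|M| + 1) _ (G x) _); last 2 first.
- by rewrite (le_lt_trans (ler_norm _))// ltrDl.
- by exists x => //; exact: subset_closure.
rewrite [leRHS]/Num.norm/= mx_normrE.
exact: (le_bigmax _ (fun ij : 'I_n.+1 * 'I_1 => `|G x ij.1 ij.2|) (i, j)).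
Qed.

Lemma derive_mdot f x y : differentiable f x -> 'D_y f x = mdot (grad f x) y^T.
Proof.
move=> df; rewrite deriveE// {1}(row_sum_delta y) linear_sum/=.
apply: eq_bigr => i _; rewrite linearZ/= big_ord1 !mxE deriveE// mulrC.
by [].
Qed.

Lemma enorm_tr m k (A : 'M[R]_(m, k)) : enorm A^T = enorm A.
Proof.
congr Num.sqrt; rewrite exchange_big; apply: eq_bigr => i _.
by apply: eq_bigr => j _; rewrite mxE.
Qed.

Lemma derive_le f x y : differentiable f x -> `|'D_y f x| <= enorm (grad f x) * enorm y.
Proof.
move=> df; rewrite derive_mdot// -(enorm_tr y) ler_norml mdot_le andbT lerNl.
by rewrite -mdotNl -(enormN (grad f x)) mdot_le.
Qed.

Lemma eball_convex x y (t : R) : B x -> B y -> 0 <= t -> t <= 1 ->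
  B (affine_map t ((1 - t) *: x) y).
Proof.
rewrite /B /eball /affine_map/= => Bx By t0 t1.
have -> : (1 - t) *: x + t *: y - x0 = (1 - t) *: (x - x0) + t *: (y - x0).
  by apply/matrixP => i j; rewrite !mxE; ring.
apply: le_lt_trans (enormD _ _) _; rewrite !enormZ !ger0_norm ?subr_ge0//.
have [->|t0'] := eqVneq t 0; first by rewrite subr0 mul0r addr0 mul1r.
have : t * enorm (y - x0) < t * r0 by rewrite ltr_pM2l// lt0r t0'.
have : (1 - t) * enorm (x - x0) <= (1 - t) * r0 by rewrite ler_wpM2l ?subr_ge0// ltW.
by lra.
Qed.

Lemma continuous_affine (t : R) b : continuous (@affine_map R n t b).
Proof.
move=> x; apply: (@cvgD _ _ _ (nbhs x) _ (fun=> b) (fun x => t *: x)).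
  exact: cvg_cst.
exact: scaler_continuous.
Qed.

(* The image of B under the homothety of centre x and ratio t. *)
Definition shrunk (t : R) x := eball ((1 - t) *: x + t *: x0) (t * r0).

Lemma affine_preimage_shrunk t x : 0 < t ->
  affine_map t ((1 - t) *: x) @^-1` shrunk t x = B.
Proof.
move=> t0; apply/seteqP; split => y; rewrite /shrunk /preimage /B /eball /affine_map/=;
  rewrite opprD addrACA subrr add0r -scalerBr enormZ gtr0_norm// ltr_pM2l//.
Qed.

Lemma shrunk_sub s t x : B x -> s <= t -> shrunk s x `<=` shrunk t x.
Proof.
move=> Bx st; apply: eball_sub.
have -> : (1 - s) *: x + s *: x0 - ((1 - t) *: x + t *: x0) = (t - s) *: (x - x0).
  by apply/matrixP => i j; rewrite !mxE; ring.
rewrite enormZ ger0_norm ?subr_ge0//.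
have : (t - s) * enorm (x - x0) <= (t - s) * r0 by rewrite ler_wpM2l ?subr_ge0// ltW.
by lra.
Qed.

Lemma shrunk1 x : shrunk 1 x = B.
Proof. by rewrite /shrunk subrr scale0r scale1r add0r mul1r. Qed.

Lemma lebesgue_shrunk t x : 0 < t ->
  lebesgue (shrunk t x) = ((t ^+ n.+1)%:E * lebesgue B)%E.
Proof.
move=> t0; have tn : 0 < t ^+ n.+1 by rewrite exprn_gt0.
have := lebesgue_outer_affine ((1 - t) *: x) (shrunk t x) t0.
rewrite affine_preimage_shrunk// /lebesgue => ->.
by rewrite muleA -EFinM mulfV ?gt_eqF// mul1e.
Qed.

Section mean_along_segments.
Variables (f : E -> R) (x : E).
Hypotheses (C1f : C1_closure B f) (Bx : B x).

Let fseg t y := f (affine_map t ((1 - t) *: x) y).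
Let F t := \int[lebesgue]_(y in B) fseg t y.

Let mB : measurable B. Proof. exact: measurable_eball. Qed.

Let continuous_fseg (t : R) y : 0 <= t -> t <= 1 -> B y -> {for y, continuous (fseg t)}.
Proof.
move=> t0 t1 By; apply: (@continuous_comp _ _ _ (affine_map t _) f).
  exact: continuous_affine.
have [_ df _] := C1f.
by apply: differentiable_continuous; apply: df; exact: eball_convex.
Qed.

Let measurable_fseg (t : R) : 0 <= t -> t <= 1 -> measurable_fun B (fseg t).
Proof.
move=> t0 t1; apply: continuous_measurable_rV; first exact: open_eball.
by move=> y; rewrite inE => By; exact: continuous_fseg.
Qed.

Let integrable_cstB (M : R) : lebesgue.-integrable B (EFin \o cst M).
Proof.
apply: measurable_bounded_integrable => //; first exact: lebesgue_eball_lty.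
exact: bounded_cst.
Qed.

Let integrable_fseg (t : R) : 0 <= t -> t <= 1 ->
  lebesgue.-integrable B (EFin \o fseg t).
Proof.
move=> t0 t1; have [M M0 fM] := C1_closure_bounded C1f.
apply: le_integrable (integrable_cstB M) => //.
  exact/measurable_EFinP/measurable_fseg.
move=> y By /=; rewrite lee_fin (ger0_norm M0).
by apply: fM; exact: eball_convex.
Qed.

Let cvg_segment (t_ : nat -> R) (t : R) : (forall m, 0 <= t_ m /\ t_ m <= 1) ->
  t_ m @[m --> \oo] --> t -> 0 <= t -> t <= 1 -> F (t_ m) @[m --> \oo] --> F t.
Proof.
move=> t_01 t_t t0 t1; have [M M0 fM] := C1_closure_bounded C1f.
apply: fine_cvg; rewrite fineK; last by apply: integrable_fin_num => //; exact: integrable_fseg.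
apply: (@dominated_cvg _ _ _ lebesgue B mB (fun m y => (fseg (t_ m) y)%:E) _ (EFin \o cst M)) => //=.
- by move=> m; apply/measurable_EFinP; apply: measurable_fseg; case: (t_01 m).
- move=> y By; apply: cvg_EFin; first exact: nearW.
  have [_ df _] := C1f.
  apply: (@cvg_comp _ _ _ (fun m => affine_map (t_ m) ((1 - t_ m) *: x) y) f _
      (nbhs (affine_map t ((1 - t) *: x) y))); last first.
    exact: (differentiable_continuous (df _ (eball_convex Bx By t0 t1))).
  apply: cvgD; apply: cvgZ => //; try exact: cvg_cst.
  by apply: cvgB => //; exact: cvg_cst.
- move=> m y By; rewrite lee_fin; apply: fM; have [? ?] := t_01 m.
  exact: eball_convex.
Qed.

Let derive_fseg (t : R) y : 0 <= t -> t <= 1 -> B y ->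
  derivable (fseg^~ y) t 1 /\
  'D_1 (fseg^~ y) t = 'D_(y - x) f (affine_map t ((1 - t) *: x) y).
Proof.
move=> t0 t1 By; have [_ df _] := C1f.
have H : (fun h : R => h^-1 *: (fseg (h *: 1 + t) y - fseg t y)) =
    (fun h : R => h^-1 *: (f (h *: (y - x) + affine_map t ((1 - t) *: x) y) -
      f (affine_map t ((1 - t) *: x) y))).
  apply/funext => h; rewrite /fseg; congr (_ *: (f _ - _)).
  by rewrite [h *: 1]mulr1; apply/matrixP => i j; rewrite !mxE; ring.
split; last by rewrite /derive; congr (lim _); rewrite /= H.
rewrite /derivable /= H; apply: diff_derivable; apply: df.
exact: eball_convex.
Qed.

(** Differentiation under the integral sign: the derivative along the segment is at most
    [|y - x| |grad f|] with [|y - x| <= 2 r0], and the change of variables moves the integral to the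
    shrunk ball with Jacobian [t^-(n+1)]. *)
Let derive_mean (t : R) : 0 < t -> t < 1 ->
  derivable F t 1 /\ (`|derive1 F t|%:E <= (2 * r0 * (t ^+ n.+1)^-1)%:E *
    \int[lebesgue]_(y in shrunk t x) (enorm (grad f y))%:E)%E.
Proof.
move=> t0 t1; have [M M0 gM] := grad_bounded C1f.
have It : t \in `]0, 1[ by rewrite in_itv/= t0 t1.
have r00 : 0 < r0 by move: Bx; rewrite /B/eball/=; apply: le_lt_trans; exact: enorm_ge0.
have I01 (s : R) : s \in `]0, 1[ -> 0 <= s /\ s <= 1 by rewrite in_itv/= => /andP[/ltW ? /ltW ?].
have yx y : B y -> enorm (y - x) <= 2 * r0.
  move=> By; apply: le_trans (enormB_trans y x0 x) _.
  by rewrite (enormB_sym x0); move: Bx By; rewrite /B/eball/= => *; lra.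
have intf (s : R) : s \in `]0, 1[ -> lebesgue.-integrable B (EFin \o fseg s).
  by move=> /I01[? ?]; exact: integrable_fseg.
have df (s : R) y : s \in `]0, 1[ -> B y -> derivable (fseg^~ y) s 1.
  by move=> /I01[? ?] By; have [] := derive_fseg (t := s) (y := y).
have dle (s : R) y : s \in `]0, 1[ -> B y -> `|partial1of2 fseg s y| <=
    2 * r0 * enorm (grad f (affine_map s ((1 - s) *: x) y)).
  move=> /I01[s0 s1] By; rewrite partial1of2E.
  have [_ ->] := derive_fseg s0 s1 By; have [_ dif _] := C1f.
  apply: le_trans (derive_le _ (dif _ (eball_convex Bx By s0 s1))) _.
  by rewrite mulrC ler_wpM2r ?enorm_ge0// yx.
have dleM (s : R) y : s \in `]0, 1[ -> B y -> `|partial1of2 fseg s y| <= cst (2 * r0 * M) y.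
  move=> Is By; apply: (le_trans (dle s y Is By)) => /=.
  have r20 : 0 <= 2 * r0 by rewrite mulr_ge0// ltW.
  rewrite ler_wpM2l//; apply: gM.
  by have [? ?] := I01 s Is; exact: eball_convex.
have G0 (y : E) : 0 <= cst (2 * r0 * M) y by rewrite /= !mulr_ge0// ltW.
have iG := @integrable_cstB (2 * r0 * M).
have h1 := derivable_under_integral mB It intf df G0 iG dleM.
have h2 := differentiation_under_integral mB It intf df G0 iG dleM.
split; first exact: h1.
have r20 : 0 <= 2 * r0 by rewrite mulr_ge0// ltW.
have tn : 0 < t ^+ n.+1 by rewrite exprn_gt0.
have msh : measurable (shrunk t x) by exact: measurable_eball.
have shB : shrunk t x `<=` B by rewrite -(shrunk1 x); apply: shrunk_sub => //; exact: ltW.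
have mh : measurable_fun (shrunk t x) (fun y => (enorm (grad f y))%:E).
  apply/measurable_EFinP; apply: measurable_funS mB shB _.
  exact: measurable_enorm_grad.
have h0 y : shrunk t x y -> (0 <= (enorm (grad f y))%:E)%E by rewrite lee_fin enorm_ge0.
have := ge0_integral_affine ((1 - t) *: x) t0 msh mh h0.
rewrite affine_preimage_shrunk// => cov.
rewrite EFinM -muleA -cov -ge0_integralZl//; last 2 first.
- apply: (@measurable_comp _ _ _ _ _ _ (shrunk t x) (fun y => (enorm (grad f y))%:E)) => //.
    by move=> _ [y By <-]; rewrite -(affine_preimage_shrunk x t0) in By.
  exact: measurable_funS (measurable_affine _ t0).
- by move=> y _; rewrite lee_fin enorm_ge0.
have md1 : measurable_fun B (partial1of2 fseg t).
  apply: (@eq_measurable_fun _ _ _ _ _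
      (fun y => mdot (grad f (affine_map t ((1 - t) *: x) y)) (y - x)^T)).
    move=> y; rewrite inE => By; have [t0' t1'] := I01 t It.
    have [_ dif _] := C1f; rewrite partial1of2E; have [_ ->] := derive_fseg t0' t1' By.
    by rewrite derive_mdot//; apply: dif; exact: eball_convex.
  apply: measurable_mdot => i j; rewrite ord1.
    apply: (@measurable_comp _ _ _ _ _ _ B (fun y => grad f y i ord0)).
    - exact: mB.
    - by move=> _ [y By <-]; have [? ?] := I01 t It; exact: eball_convex.
    - exact: measurable_grad_coord.
    - exact: measurable_funS (measurable_affine _ t0).
  apply: continuous_measurable_rV; first exact: open_eball.
  move=> y _; rewrite (_ : (fun x1 : E => _) = (fun y : E => y ord0 i - x ord0 i)).
    have cc : {for y, continuous (fun y : E => y ord0 i)} by exact: coord_continuous.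
    exact: (cvgB cc (cvg_cst _)).
  by apply/funext => z; rewrite !mxE.
rewrite h2; apply: (@le_trans _ _ (\int[lebesgue]_(y in B) `|(partial1of2 fseg t y)%:E|)%E).
  apply: le_trans (le_abse_integral _ mB _); last exact/measurable_EFinP.
  by rewrite /Rintegral; case: (integral _ _ _) => //=; rewrite normr0 leey.
apply: ge0_le_integral.
- exact: mB.
- by move=> y _; exact: abse_ge0.
- exact/measurable_EFinP/(measurableT_comp (@normr_measurable R setT))/md1.
- apply/measurable_EFinP; apply: measurable_funM; first exact: measurable_cst.
  apply: (@measurable_comp _ _ _ _ _ _ B (fun y => enorm (grad f y))).
  + exact: mB.
  + by move=> _ [y By <-]; have [? ?] := I01 t It; exact: eball_convex.
  + exact: measurable_enorm_grad.
  + exact: measurable_funS (measurable_affine _ t0).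
- by move=> y By; rewrite -EFinM lee_fin; exact: dle.
Qed.

Let integral_grad_fin (t : R) : t <= 1 ->
  (\int[lebesgue]_(y in shrunk t x) (enorm (grad f y))%:E)%E \is a fin_num.
Proof.
move=> t1; have [M M0 gM] := grad_bounded C1f.
have shB : shrunk t x `<=` B by rewrite -(shrunk1 x); exact: shrunk_sub.
have msh : measurable (shrunk t x) by exact: measurable_eball.
apply: integrable_fin_num => //.
apply: (le_integrable msh _ _ (integrableS mB msh shB (integrable_cstB M))).
  apply/measurable_EFinP; apply: measurable_funS mB shB _; exact: measurable_enorm_grad.
by move=> y /shB By; rewrite /= lee_fin !ger0_norm ?enorm_ge0//; exact: gM.
Qed.

(** The mean value theorem on []t/2, t[]: for [c] in this interval the shrunk ball of ratio [c] lies
    in that of ratio [t], and [c^-(n+1)] is at most [2^(n+1) / t^(n+1)]. *)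
Let mean_step (t : R) : 0 < t -> t <= 1 -> `|F t - F (t / 2)| <=
  t * r0 * (2 ^+ n.+1 / t ^+ n.+1) *
  fine (\int[lebesgue]_(y in shrunk t x) (enorm (grad f y))%:E)%E.
Proof.
move=> t0 t1; set I := fine _; set K := _ * I.
have r00 : 0 < r0 by move: Bx; rewrite /B/eball/=; apply: le_lt_trans; exact: enorm_ge0.
have I0 : 0 <= I by apply: fine_ge0; apply: integral_ge0 => y _; rewrite lee_fin enorm_ge0.
have dF c : t / 2 <= c -> c < t -> `|derive1 F c| <= 2 * r0 * (2 ^+ n.+1 / t ^+ n.+1) * I.
  move=> tc ct; have c0 : 0 < c by apply: lt_le_trans tc; rewrite divr_gt0.
  have [_] := derive_mean c0 (lt_le_trans ct t1).
  rewrite -lee_fin => /le_trans; apply.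
  rewrite [leRHS]EFinM /I fineK; last exact: integral_grad_fin.
  apply: lee_pmul.
  - by rewrite lee_fin !mulr_ge0// ?invr_ge0 ?exprn_ge0 ?(ltW r00)// ltW.
  - by apply: integral_ge0 => y _; rewrite lee_fin enorm_ge0.
  - rewrite lee_fin ler_wpM2l//; first by rewrite mulr_ge0// ltW.
    rewrite -expr_div_n -exprVn lerXn2r// ?nnegrE ?invr_ge0 ?(ltW c0)//.
      by rewrite divr_ge0// ltW.
    by rewrite -[leRHS]invrK lef_pV2 ?posrE ?invr_gt0// ?divr_gt0// invf_div.
  - apply: ge0_subset_integral; [exact: measurable_eball|exact: measurable_eball| | |].
    + apply/measurable_EFinP; apply: measurable_funS mB _ _; last exact: measurable_enorm_grad.
      by rewrite -(shrunk1 x); exact: shrunk_sub.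
    + by move=> y _; rewrite lee_fin enorm_ge0.
    + by apply: shrunk_sub => //; exact: ltW.
have bound s : t / 2 < s -> s < t -> `|F s - F (t / 2)| <= K.
  move=> ts st; have [||c] := @MVT _ F (derive1 F) _ _ ts.
  - move=> c; rewrite in_itv/= => /andP[h1 h2]; rewrite derive1E; apply/derivableP.
    by have [] := @derive_mean c _ _ => //; lra.
  - apply: derivable_within_continuous => c; rewrite in_itv/= => /andP[h1 h2].
    by have [] := @derive_mean c _ _ => //; lra.
  rewrite in_itv/= => /andP[h1 h2] ->; rewrite normrM.
  rewrite (_ : K = 2 * r0 * (2 ^+ n.+1 / t ^+ n.+1) * I * (t / 2)); last by rewrite /K; field; rewrite expf_neq0// gt_eqF.
  apply: ler_pM => //; first by apply: dF; lra.
  by rewrite ger0_norm; lra.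
have h01 (m : nat) : 0 < harmonic m :> R /\ harmonic m <= 1 :> R.
  by split; rewrite /harmonic/= ?invr_gt0// invf_le1 ?ler1n.
(* Differentiability of [F] is known in []0, 1[] only, so the endpoint [t], which may be [1], is
   reached as a limit of points of []t/2, t[]. *)
pose u (m : nat) : R := t - t / 4 * harmonic m.
have u_t : u m @[m --> \oo] --> t.
  rewrite -[X in _ --> X]subr0 -[X in _ --> t - X](mulr0 (t / 4)).
  by apply: cvgB; [exact: cvg_cst|apply: cvgM; [exact: cvg_cst|exact: cvg_harmonic]].
have Fu : F (u m) @[m --> \oo] --> F t.
  apply: cvg_segment => //; last exact: ltW.
  by move=> m; have [? ?] := h01 m; rewrite /u; split; nra.
have Fb : `|F (u m) - F (t / 2)| @[m --> \oo] --> `|F t - F (t / 2)|.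
  by apply: cvg_norm; apply: cvgB => //; exact: cvg_cst.
rewrite -(cvg_lim (@Rhausdorff R) Fb); apply: limr_le; first by apply/cvg_ex; eexists; exact: Fb.
by apply: nearW => m; have [? ?] := h01 m; apply: bound; rewrite /u; nra.
Qed.

(** Telescoping of [F (2^-k)] between [F 1], the integral of [f], and [F 0 = f x * m]. The
    hypothesis on [b] says that [r0 2^-k] times the mean of [|grad f|] over the k-th shrunk ball is
    at most [b k]; the factor [2^(n+1)] is the Jacobian lost in one halving. *)
Lemma chain_bound (m S : R) (b : nat -> R) : lebesgue B = m%:E -> 0 < m ->
  (forall k, (\int[lebesgue]_(y in shrunk (2 ^- k) x) (enorm (grad f y))%:E <=
    (b k * ((2 ^- k) ^+ n.+1 * m) / (r0 * 2 ^- k))%:E)%E) ->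
  (forall N, \sum_(k < N) b k <= S) ->
  `|f x - (\int[lebesgue]_(y in B) f y) / m| <= 2 ^+ n.+1 * S.
Proof.
move=> Bm m0 hb bS.
have r00 : 0 < r0 by move: Bx; rewrite /B/eball/=; apply: le_lt_trans; exact: enorm_ge0.
have k0 k : 0 < 2 ^- k :> R by rewrite invr_gt0 exprn_gt0.
have k1 k : 2 ^- k <= 1 :> R by rewrite invf_le1 ?exprn_gt0// exprn_ege1// ler1n.
have step k : `|F (2 ^- k) - F (2 ^- k.+1)| <= 2 ^+ n.+1 * m * b k.
  have := mean_step (k0 k) (k1 k); rewrite (_ : 2 ^- k / 2 = 2 ^- k.+1 :> R); last by rewrite exprSr invfM.
  move=> /le_trans; apply; have := hb k.
  rewrite -[X in (X <= _)%E]fineK; last exact: integral_grad_fin.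
  rewrite lee_fin; move: (fine _) (k0 k) => I; move: (2 ^- k) => t t0 hI.
  have tn : t ^+ n.+1 != 0 by rewrite expf_neq0// gt_eqF.
  have -> : 2 ^+ n.+1 * m * b k =
     t * r0 * (2 ^+ n.+1 / t ^+ n.+1) * (b k * (t ^+ n.+1 * m) / (r0 * t)).
    by field; rewrite tn !gt_eqF.
  rewrite ler_wpM2l// !mulr_ge0 ?invr_ge0 ?exprn_ge0 ?ltW//.
have tel N : `|F (2 ^- N) - F 1| <= 2 ^+ n.+1 * m * \sum_(k < N) b k.
  elim: N => [|N IH]; first by rewrite expr0 invr1 subrr normr0 big_ord0 mulr0.
  rewrite big_ord_recr/= mulrDr; apply: le_trans (lerD IH (step N)).
  rewrite (_ : F (2 ^- N.+1) - F 1 = (F (2 ^- N) - F 1) - (F (2 ^- N) - F (2 ^- N.+1))).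
    exact: ler_normB.
  by rewrite opprB [RHS]addrC addrA subrK.
have F0 : F 0 = f x * m.
  rewrite /F (_ : fseg 0 = cst (f x)); last first.
    by apply/funext => y; rewrite /fseg /affine_map subr0 scale1r scale0r addr0.
  by rewrite Rintegral_cst//; congr (_ * _); rewrite -[m]/(fine m%:E) -Bm.
have F1 : F 1 = \int[lebesgue]_(y in B) f y.
  congr Rintegral; apply/funext => y.
  by rewrite /fseg /affine_map subrr scale0r scale1r add0r.
have p0 : (2 ^- k : R) @[k --> \oo] --> 0.
  under eq_fun do rewrite -exprVn; apply: cvg_expr.
  by rewrite ger0_norm ?invr_ge0// invf_lt1// ltr1n.
have Fu : F (2 ^- k) @[k --> \oo] --> F 0.
  have p01 k : 0 <= 2 ^- k :> R /\ 2 ^- k <= 1 :> R by split; [exact: ltW|exact: k1].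
  exact: (cvg_segment p01 p0 (lexx 0) ler01).
have Fb : `|F (2 ^- k) - F 1| @[k --> \oo] --> `|F 0 - F 1|.
  by apply: cvg_norm; apply: cvgB => //; exact: cvg_cst.
have : `|F 0 - F 1| <= 2 ^+ n.+1 * m * S.
  rewrite -(cvg_lim (@Rhausdorff R) Fb); apply: limr_le.
    by apply/cvg_ex; eexists; exact: Fb.
  apply: nearW => N; apply: (le_trans (tel N)).
  by rewrite ler_wpM2l// mulr_ge0 ?exprn_ge0// ltW.
rewrite F0 F1 (_ : f x * m - _ = m * (f x - (\int[lebesgue]_(y in B) f y) / m)).
  by rewrite normrM gtr0_norm// -mulrA mulrCA ler_pM2l.
by field; rewrite gt_eqF.
Qed.

End mean_along_segments.

End C1_functions.

(** * Packing of balls *)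

Section packing.
Context {R : realType} {n : nat}.
Local Notation E := 'rV[R]_n.+1.
Implicit Types (x y z : E) (zs : seq E) (r s : R).

Lemma lebesgue_eball z r : 0 < r ->
  lebesgue (eball z r) = ((r ^+ n.+1)%:E * lebesgue (eball (0%R : E) 1))%E.
Proof.
move=> r0; have rn : 0 < r ^+ n.+1 by rewrite exprn_gt0.
have := lebesgue_outer_affine z (eball z r) r0.
have -> : affine_map r z @^-1` eball z r = eball 0 1.
  apply/seteqP; split => y; rewrite /preimage /eball /affine_map/= addrAC subrr add0r subr0 enormZ gtr0_norm//;
  by rewrite gtr_pMr.
by rewrite /lebesgue => ->; rewrite muleA -EFinM mulfV ?gt_eqF// mul1e.
Qed.

Definition separated s zs := pairwise (fun z z' => s <= enorm (z - z')) zs.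

Lemma lebesgue_separated s zs : 0 < s -> separated s zs ->
  lebesgue (\big[setU/set0]_(z <- zs) eball z (s / 2)) =
  ((size zs)%:R%:E * ((s / 2) ^+ n.+1)%:E * lebesgue (eball (0%R : E) 1))%E.
Proof.
move=> s0; have s20 : 0 < s / 2 by rewrite divr_gt0.
have mU zs' : measurable (\big[setU/set0]_(z <- zs') eball z (s / 2)).
  by apply: bigsetU_measurable => z _; exact: measurable_eball.
elim: zs => [_|z zs IH]; first by rewrite big_nil measure0 !mul0e.
rewrite /separated/= => /andP[/allP zzs /IH{}IH]; rewrite big_cons measureU//.
- rewrite [X in (X + _)%E]lebesgue_eball// [X in (_ + X)%E]IH /= (_ : (size zs).+1%:R = (size zs)%:R + 1); last by rewrite natr1.
  rewrite -!EFinM mulrDl mul1r.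
  by rewrite EFinD ge0_muleDl ?lee_fin ?mulr_ge0 ?exprn_ge0 ?(ltW s20)// addeC.
- exact: measurable_eball.
- rewrite -subset0 => u []; rewrite -bigcup_seq => zu [z' /= z'zs z'u].
  have := zzs _ z'zs; rewrite leNgt => /negP; apply.
  apply: le_lt_trans (enormB_trans z u z') _; rewrite (enormB_sym z u).
  by move: zu z'u; rewrite /eball/= => *; lra.
Qed.

Hypothesis ball_gt0 : (0 < lebesgue (eball (0%R : E) 1))%E.

(** The balls of radius [s/2] about the points are disjoint and lie in the ball of radius [r + s/2];
    all these volumes are multiples of that of the unit ball, which is positive and finite. *)
Lemma packing y r s zs : 0 < s -> 0 < r -> separated s zs ->
  (forall z, z \in zs -> enorm (z - y) < r) ->
  (size zs)%:R * (s / 2) ^+ n.+1 <= (r + s / 2) ^+ n.+1.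
Proof.
move=> s0 r0 zsep zsr; have := lebesgue_separated s0 zsep.
have U : \big[setU/set0]_(z <- zs) eball z (s / 2) `<=` eball y (r + s / 2).
  rewrite -bigcup_seq => u [z /= /zsr zr zu]; apply: le_lt_trans (enormB_trans u z y) _.
  by rewrite addrC ltrD.
have := le_lebesgue_outer U; rewrite -/lebesgue => /[swap].
rewrite /lebesgue => ->; rewrite -/lebesgue [leRHS]lebesgue_eball; last by rewrite addr_gt0// divr_gt0.
move: ball_gt0 (lebesgue_eball_lty (0 : E) 1).
case: (lebesgue _) => [w| |]//; rewrite !lte_fin => w0 _.
by rewrite -!EFinM lee_fin ler_pM2r.
Qed.

(** A separated family of maximal size, the size being bounded by [packing]: a point at distance at
    least [s] from all its members could be added. *)
Lemma net_exists x0 r0 s : 0 < s -> 0 < r0 -> exists zs,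
  [/\ separated s zs, forall z, z \in zs -> eball x0 r0 z &
     forall x, eball x0 r0 x -> exists2 z, z \in zs & enorm (x - z) < s].
Proof.
move=> s0 r00; pose P k := `[< exists2 zs, size zs = k &
  separated s zs /\ forall z, z \in zs -> eball x0 r0 z >].
have P0 : exists k, P k by exists 0%N; apply/asboolP; exists [::].
have s20 : 0 < (s / 2) ^+ n.+1 by rewrite exprn_gt0// divr_gt0.
have Pub k : P k -> (k <= Num.truncn ((r0 + s / 2) ^+ n.+1 / (s / 2) ^+ n.+1))%N.
  move=> /asboolP[zs <- [zsep zB]].
  have r1 : 0 <= (r0 + s / 2) ^+ n.+1 by rewrite exprn_ge0//; lra.
  rewrite truncn_ge_nat; last exact: divr_ge0 r1 (ltW s20).
  by rewrite ler_pdivlMr//; exact: packing zB.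
have := ex_maxnP P0 Pub; case=> k /asboolP[zs szs [zsep zB]] kmax.
exists zs; split => // x Bx; apply: contrapT => H.
have /kmax : P k.+1; last by rewrite ltnn.
apply/asboolP; exists (x :: zs); first by rewrite /= szs.
split; last by move=> z; rewrite inE => /predU1P[->|/zB].
rewrite /separated/=; apply/andP; split => //; apply/allP => z zzs.
by rewrite leNgt; apply/negP => xz; apply: H; exists z.
Qed.

(** [7] is the ratio of the radii [3 s + s/2] and [s/2] in the comparison of volumes. *)
Lemma count_separated_le y s zs : 0 < s -> separated s zs ->
  (count (fun z => enorm (z - y) < 3 * s)%R zs <= 7 ^ n.+1)%N.
Proof.
move=> s0 zsep; rewrite -size_filter -(ler_nat R) natrX.
have s20 : 0 < (s / 2) ^+ n.+1 by rewrite exprn_gt0// divr_gt0.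
rewrite -(ler_pM2r s20); apply: le_trans (@packing y (3 * s) s _ s0 _ _ _) _.
- by rewrite mulr_gt0.
- exact: pairwise_filter.
- by move=> z; rewrite mem_filter => /andP[].
- by rewrite -exprMn ler_pXn2r ?nnegrE//; lra.
Qed.

End packing.

(** * Doubling and Muckenhoupt weights *)

Section weights_on_balls.
Context {R : realType} {n : nat}.
Local Notation E := 'rV[R]_n.+1.
Implicit Types (x y z : E) (r s : R) (u w v : E -> R).
Hypothesis ball_gt0 : (0 < lebesgue (eball (0%R : E) 1))%E.

Lemma lebesgue_eball_gt0 x r : 0 < r -> (0 < lebesgue (eball x r))%E.
Proof. by move=> r0; rewrite lebesgue_eball// mule_gt0// lte_fin exprn_gt0. Qed.

Lemma integral_gt0 (D : set E) u : measurable D -> (0 < lebesgue D)%E ->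
  measurable_fun D u -> (forall x, 0 <= u x) -> {ae lebesgue, forall x, 0 < u x} ->
  (0 < \int[lebesgue]_(x in D) (u x)%:E)%E.
Proof.
move=> mD D0 mu u0 up; rewrite lt0e integral_ge0 ?andbT; last first.
  by move=> x _; rewrite lee_fin.
apply/eqP => I0.
have mfu : measurable_fun D (EFin \o u) by exact/measurable_EFinP.
have [H _] := ae_eq_integral_abs lebesgue mD mfu.
have {}u00 : ae_eq lebesgue D (EFin \o u) (cst 0%E).
  by apply: H; rewrite -I0; apply: eq_integral => x _ /=; rewrite ger0_norm.
suff : lebesgue D = 0%E by move=> D00; rewrite D00 ltxx in D0.
have : {ae lebesgue, forall x, ~ D x}.
  apply: filterS2 up u00 => x h Dxu Dx.
  by have [ux] := Dxu Dx; rewrite ux ltxx in h.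
case=> N [mN N0 DN]; apply: (@subset_measure0 _ _ _ lebesgue D N) => //.
by move=> x Dx; apply: DN => /=; exact.
Qed.

Lemma weight_integrable u x r : weight u ->
  lebesgue.-integrable (eball x r) (EFin \o u).
Proof.
move=> [_ _ /(_ _ (@compact_closure_eball _ _ x r))] h.
apply: integrableS h; last exact: subset_closure.
  rewrite -[closure _]setCK; apply: measurableC; apply: open_measurable_rV.
  exact/closed_openC/closed_closure.
exact: measurable_eball.
Qed.

Lemma wmassE u x r : weight u ->
  (\int[lebesgue]_(y in eball x r) (u y)%:E)%E = (wmass u (eball x r))%:E.
Proof.
move=> wu; rewrite /wmass /Rintegral fineK//; apply: integrable_fin_num.
  exact: measurable_eball.
exact: weight_integrable.
Qed.

Lemma weight_measurable u (D : set E) : weight u -> measurable D -> measurable_fun D u.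
Proof. by move=> [mu _ _] mD; exact: measurable_funS mu. Qed.

Lemma wmass_gt0 u x r : weight u -> {ae lebesgue, forall x, 0 < u x} -> 0 < r ->
  0 < wmass u (eball x r).
Proof.
move=> wu up r0; rewrite -lte_fin -wmassE//; apply: integral_gt0 => //.
- exact: measurable_eball.
- exact: lebesgue_eball_gt0.
- by apply: weight_measurable => //; exact: measurable_eball.
- by case: wu.
Qed.

Lemma wmass_ge0 u (D : set E) : weight u -> 0 <= wmass u D.
Proof. by move=> [_ u0 _]; exact: Rintegral_ge0. Qed.

Lemma le_wmass u x y r s : weight u -> eball x r `<=` eball y s ->
  wmass u (eball x r) <= wmass u (eball y s).
Proof.
move=> wu rs; rewrite -lee_fin -!wmassE//; apply: ge0_subset_integral => //.
- exact: measurable_eball.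
- exact: measurable_eball.
- by apply/measurable_EFinP; apply: weight_measurable => //; exact: measurable_eball.
- by move=> z _; rewrite lee_fin; case: wu.
Qed.

Lemma wmass_disjoint u x y z r s t : weight u ->
  eball x r `<=` eball z t -> eball y s `<=` eball z t -> [disjoint eball x r & eball y s]%classic ->
  wmass u (eball x r) + wmass u (eball y s) <= wmass u (eball z t).
Proof.
move=> wu xz yz xy; have u0 : forall a, 0 <= u a by case: wu.
rewrite -lee_fin EFinD -!wmassE// -ge0_integral_setU//; last first.
- by move=> a _; rewrite lee_fin.
- by apply/measurable_EFinP; apply: weight_measurable => //; apply: measurableU; exact: measurable_eball.
- exact: measurable_eball.
- exact: measurable_eball.
apply: ge0_subset_integral => //.
- by apply: measurableU; exact: measurable_eball.
- exact: measurable_eball.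
- by apply/measurable_EFinP; apply: weight_measurable => //; exact: measurable_eball.
- by move=> a _; rewrite lee_fin.
- by rewrite subUset.
Qed.

Lemma doubling_iter v : weight v -> doubling v -> exists2 C, 0 < C &
  forall j x r, 0 < r -> wmass v (eball x (2 ^+ j * r)) <= C ^+ j * wmass v (eball x r).
Proof.
move=> wv [C C0 dbl]; exists C => // j x r r0.
elim: j => [|j IH]; first by rewrite !expr0 !mul1r.
rewrite !exprS -!mulrA; apply: le_trans (dbl x (2 ^+ j * r) _) _.
  by rewrite mulr_gt0// exprn_gt0.
by rewrite ler_pM2l.
Qed.

(** Besides the concentric half ball, a ball of radius [r] contains a disjoint ball of radius [r/4]
    whose centre is at distance [3 r/4]. Doubling the latter three times covers the half ball, so it
    carries a fixed share of the mass. *)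
Lemma reverse_doubling v : weight v -> doubling v -> exists2 g, 0 < g < 1 &
  forall j x r, 0 < r -> wmass v (eball x (2 ^- j * r)) <= g ^+ j * wmass v (eball x r).
Proof.
move=> wv dv; have [C C0 dbl] := doubling_iter wv dv.
pose K := C ^+ 3; have K0 : 0 < K by rewrite exprn_gt0.
have K1 : 0 < 1 + K by rewrite addr_gt0.
(* With [a], [c], [b] the masses of the half ball, the small ball and the whole ball, [a <= K c] and
   [a + c <= b] give [a <= K/(1+K) b]. *)
exists (K / (1 + K)).
  by rewrite divr_gt0// ltr_pdivrMr// mul1r ltrDr ltr01.
have half x r : 0 < r -> wmass v (eball x (r / 2)) <= K / (1 + K) * wmass v (eball x r).
  move=> r0; pose e : E := delta_mx ord0 ord0.
  have e1 : enorm e = 1.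
    rewrite enormE (_ : mdot e e = 1) ?sqrtr1// /mdot big_ord1 (bigD1 ord0)//=.
    rewrite !mxE/= mulr1 big1 ?addr0// => j j0; rewrite !mxE/= (negbTE j0) mul0r.
    by [].
  pose x' := x + (3 * r / 4) *: e.
  have xx' : enorm (x - x') = 3 * r / 4.
    by rewrite /x' opprD addrA subrr sub0r enormN enormZ e1 mulr1 ger0_norm//; lra.
  have h1 : wmass v (eball x (r / 2)) <= K * wmass v (eball x' (r / 4)).
    have r4 : 0 < r / 4 by rewrite divr_gt0.
    apply: (le_trans _ (dbl 3%N x' _ r4)).
    by apply: le_wmass => //; apply: eball_sub; rewrite xx' !exprS expr0; lra.
  have h2 : wmass v (eball x (r / 2)) + wmass v (eball x' (r / 4)) <= wmass v (eball x r).
    apply: wmass_disjoint => //.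
    - by apply: eball_sub; rewrite subrr enorm0; lra.
    - by apply: eball_sub; rewrite enormB_sym xx'; lra.
    - apply/disj_setPS => z [/= zx zx']; have := enormB_trans x z x'.
      by rewrite xx' (enormB_sym x z); move: zx zx'; rewrite /eball/= => *; lra.
  rewrite mulrAC ler_pdivlMr//.
  have := wmass_ge0 (eball x' (r / 4)) wv.
  move: h1 h2; move: (wmass _ _) (wmass _ (eball x r)) (wmass _ (eball x' _)) => a b c h1 h2 c0.
  by have : K * (a + c) <= K * b; [rewrite ler_pM2l|lra].
elim=> [|j IH] x r r0; first by rewrite !expr0 invr1 !mul1r.
have -> : 2 ^- j.+1 * r = 2 ^- j * r / 2 by rewrite exprS invfM; ring.
apply: le_trans (half _ _ _) _.
  by rewrite mulr_gt0// invr_gt0 exprn_gt0.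
rewrite [in leRHS]exprS -[leRHS]mulrA ler_pM2l; first exact: IH.
by rewrite divr_gt0.
Qed.

(** Hölder's inequality in Young form. With [c = w^(1-p')], hence [w = c^(1-p)], one has
    [h <= l c + l^(1-p) h^p w] pointwise for every [l > 0]; this is integrated, and the integral of
    [c] is then bounded by the [A_p] condition. *)
Lemma muckenhoupt_average p w : 1 < p -> muckenhoupt p w -> exists2 K, 0 < K &
  forall x r (h : E -> R) (m i H : R), 0 < r -> measurable_fun (eball x r) h ->
  (forall y, 0 <= h y) -> lebesgue (eball x r) = m%:E ->
  (\int[lebesgue]_(y in eball x r) (h y)%:E)%E = i%:E ->
  (\int[lebesgue]_(y in eball x r) (h y `^ p * w y)%:E)%E = H%:E ->
  (i / m) `^ p * wmass w (eball x r) <= K * H.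
Proof.
move=> p1 [ww wp]; set S := (X in ereal_sup X) => Soo.
have p0 : 0 < p by lra.
have w0 : forall x, 0 <= w x by case: ww.
pose c y := w y `^ (1 - dual_exponent p).
have c0 y : 0 <= c y by exact: powR_ge0.
have cw : {ae lebesgue, forall y, 0 < c y /\ w y = c y `^ (1 - p)}.
  apply: filterS wp => y wy; split; first exact: powR_gt0.
  rewrite /c -powRrM (_ : _ * _ = 1) ?powRr1// /dual_exponent.
  by field; lra.
have mc (D : set E) : measurable D -> measurable_fun D c.
  move=> mD; apply: (measurableT_comp (measurable_powR _)).
  exact: weight_measurable.
have avg_ge0 x r u : (forall y, 0 <= u y) -> (0 <= average (eball x r) u)%E.
  move=> u0; apply: mule_ge0; first by rewrite lee_fin invr_ge0 fine_ge0.
  by apply: integral_ge0 => y _; rewrite lee_fin.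
have Sp : (0 <= ereal_sup S)%E.
  apply: le_trans (ereal_sup_ubound (ex_intro2 _ _ (0%R, 1%R) ltr01 erefl)).
  by apply: mule_ge0; [exact: avg_ge0|exact: poweR_ge0].
have [K0 SK K00] : exists2 K0 : R, (ereal_sup S <= K0%:E)%E & 0 <= K0.
  move: Sp Soo; case: (ereal_sup S) => [K0| |]// K00 _.
  by exists K0 => //; rewrite lee_fin in K00.
exists (2 `^ p * (K0 + 1)); first by rewrite mulr_gt0 ?powR_gt0//; lra.
move=> x r h m i H r0 mh h0 bm hi hH.
have mb : measurable (eball x r) by exact: measurable_eball.
have m0 : 0 < m by rewrite -lte_fin -bm lebesgue_eball_gt0.
have W0 := wmass_gt0 x ww wp r0.
have H0 : 0 <= H.
  by rewrite -lee_fin -hH; apply: integral_ge0 => y _; rewrite lee_fin mulr_ge0 ?powR_ge0.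
have i0 : 0 <= i by rewrite -lee_fin -hi; apply: integral_ge0 => y _; rewrite lee_fin.
have : (average (eball x r) w * poweR (average (eball x r) c) (p - 1) <= K0%:E)%E.
  by apply: le_trans SK; apply: ereal_sup_ubound; exists (x, r).
rewrite {1}/average [X in fine X]bm wmassE//= -EFinM.
have sig0 : (0 < \int[lebesgue]_(y in eball x r) (c y)%:E)%E.
  apply: integral_gt0 => //; [exact: lebesgue_eball_gt0|exact: mc|].
  by apply: filterS cw => y [].
rewrite /average [X in fine X]bm /=.
have [sig sigE] : exists sig : R, (\int[lebesgue]_(y in eball x r) (c y)%:E)%E = sig%:E \/
    (\int[lebesgue]_(y in eball x r) (c y)%:E)%E = +oo%E.
  move: sig0; case: (integral _ _ _) => [sig| |]// _.
  - by exists sig; left.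
  - by exists 0; right.
(* An infinite integral of [c] would make the [A_p] product infinite, because [w] has positive mass
   on the ball. *)
case: sigE => sigE; last first.
  rewrite sigE gt0_muley ?lte_fin ?invr_gt0// poweRyr ?subr_eq0 ?(gt_eqF p1)//.
  by rewrite gt0_muley ?lte_fin ?mulr_gt0 ?invr_gt0//; rewrite leye_eq.
rewrite sigE in sig0 *; rewrite lte_fin in sig0.
rewrite -(EFinM m^-1 sig) poweR_EFin -EFinM lee_fin => hA.
have [->|in0] := eqVneq i 0.
  by rewrite mul0r powR0 ?gt_eqF// mul0r !mulr_ge0 ?powR_ge0//; lra.
have ip : 0 < i by rewrite lt0r in0.
(* This [l] makes [l * sig] equal to half of [i], which is absorbed; the factor [2^p] of the
   constant pays for it. *)
have [l l0 lE] : exists2 l, 0 < l & l = i / (2 * sig).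
  by exists (i / (2 * sig)) => //; rewrite divr_gt0// mulr_gt0.
have key : i <= l * sig + l `^ (1 - p) * H.
  have mc' : measurable_fun (eball x r) (fun y => (c y)%:E) by apply/measurable_EFinP; exact: mc.
  have mhw : measurable_fun (eball x r) (fun y => (h y `^ p * w y)%:E).
    apply/measurable_EFinP; apply: measurable_funM; last exact: weight_measurable.
    exact: (measurableT_comp (measurable_powR _)).
  have e1 : (\int[lebesgue]_(y in eball x r) (l%:E * (c y)%:E) = l%:E * sig%:E)%E.
    rewrite -sigE; apply: ge0_integralZl_EFin => //; last exact: ltW.
    by move=> y _; rewrite lee_fin.
  have e2 : (\int[lebesgue]_(y in eball x r) ((l `^ (1 - p))%:E * (h y `^ p * w y)%:E) =
      (l `^ (1 - p))%:E * H%:E)%E.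
    rewrite -hH; apply: ge0_integralZl_EFin => //; last exact: powR_ge0.
    by move=> y _; rewrite lee_fin mulr_ge0 ?powR_ge0.
  rewrite -lee_fin EFinD !EFinM -hi -e1 -e2 -ge0_integralD//; last 4 first.
  - by move=> y _; rewrite -EFinM lee_fin mulr_ge0 ?(ltW l0).
  - exact: measurable_funeM.
  - by move=> y _; rewrite -EFinM lee_fin !mulr_ge0 ?powR_ge0.
  - exact: measurable_funeM.
  apply: ae_ge0_le_integral; first exact: measurable_eball.
  - by move=> y _; rewrite lee_fin.
  - exact/measurable_EFinP.
  - by move=> y _; rewrite -!EFinM -EFinD lee_fin addr_ge0// !mulr_ge0 ?powR_ge0 ?(ltW l0).
  - by apply: emeasurable_funD; exact: measurable_funeM.
  apply: filterS cw => y [cy wy] _; rewrite -!EFinM -EFinD lee_fin.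
  have := @young_le _ 1 (h y) p (l * c y) (ltW p1) ler01 (h0 y) (mulr_gt0 l0 cy).
  rewrite !powR1 mul1r mulr1 powRM ?(ltW l0)// => /le_trans; apply.
  by rewrite lerD2l -wy -mulrA (mulrC (w y)).
have {}key : (i / 2) `^ p <= sig `^ (p - 1) * H.
  have : i / 2 <= l `^ (1 - p) * H.
    have -> : i / 2 = i - l * sig by rewrite lE; field; rewrite gt_eqF.
    by rewrite lerBlDl.
  rewrite -(ler_pM2l (powR_gt0 (p - 1) l0)) [leRHS]mulrA -powRD; last by rewrite (gt_eqF l0) implybT.
  rewrite (_ : p - 1 + (1 - p) = 0) ?powRr0 ?mul1r => [h1|]; last by ring.
  have i20 : 0 <= i / 2 by rewrite divr_ge0.
  rewrite -(mulr_powRB1 i20 p0).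
  have -> : i / 2 = l * sig by rewrite lE; field; rewrite gt_eqF.
  rewrite powRM ?(ltW l0) ?(ltW sig0)//.
  have : sig `^ (p - 1) * (l `^ (p - 1) * (i / 2)) <= sig `^ (p - 1) * H.
    by rewrite ler_wpM2l ?powR_ge0.
  apply: le_trans; have -> : i / 2 = l * sig by rewrite lE; field; rewrite gt_eqF.
  by rewrite le_eqVlt; apply/orP; left; apply/eqP; ring.
have -> : i / m = 2 * m^-1 * (i / 2) by field; rewrite gt_eqF.
have m10 : 0 <= m^-1 by rewrite invr_ge0 ltW.
rewrite (@powRM _ (2 * m^-1) (i / 2)) ?(@powRM _ 2 m^-1) ?mulr_ge0 ?divr_ge0// -(mulr_powRB1 m10 p0).
rewrite powRM ?(ltW sig0)// in hA.
have s1 := powR_ge0 m^-1 (p - 1).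
apply: (@le_trans _ _ (2 `^ p * (m^-1 * m^-1 `^ (p - 1)) * (sig `^ (p - 1) * H) * wmass w (eball x r))).
  by rewrite ler_wpM2r ?(ltW W0)// ler_wpM2l// !mulr_ge0 ?powR_ge0.
have -> : 2 `^ p * (m^-1 * m^-1 `^ (p - 1)) * (sig `^ (p - 1) * H) * wmass w (eball x r) =
  2 `^ p * (m^-1 * wmass w (eball x r) * (m^-1 `^ (p - 1) * sig `^ (p - 1))) * H by ring.
rewrite ler_wpM2r// ler_wpM2l ?powR_ge0//; apply: (le_trans hA); lra.
Qed.

End weights_on_balls.

(** * The weighted Poincare inequality *)

Section poincare.
Context {R : realType} {n : nat}.
Local Notation E := 'rV[R]_n.+1.
Variables (x0 : E) (r0 p m : R) (w v : E -> R).
Hypotheses (r00 : 0 < r0) (p1 : 1 < p) (adm : admissible p w v).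
Let B := eball x0 r0.
Hypotheses (Bm : lebesgue B = m%:E) (m0 : 0 < m).

Let p0 : 0 < p. Proof. exact: lt_trans ltr01 p1. Qed.

(** All balls are scaled copies of the unit ball, so the positive measure of [B] passes to it. *)
Lemma unit_eball_gt0 : (0 < lebesgue (eball (0%R : E) 1))%E.
Proof.
rewrite lt0e measure_ge0 andbT; apply/eqP => b0.
by have := lebesgue_eball x0 r00; rewrite -/B Bm b0 mule0 => -[] mm; have := m0; rewrite mm ltxx.
Qed.

Let ww : weight w. Proof. by case: adm => -[]. Qed.
Let wv : weight v. Proof. by case: adm => -[]. Qed.
Let w_gt0 : {ae lebesgue, forall x, 0 < w x}.
Proof. by case: adm => _ _ [[]]. Qed.
Let v_gt0 : {ae lebesgue, forall x, 0 < v x}.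
Proof. by case: adm => _ wlev _ _; apply: filterS2 w_gt0 wlev => x; exact: lt_le_trans. Qed.

Let sh k x := shrunk x0 r0 (2 ^- k) x.

Let pow2_gt0 k : 0 < 2 ^- k :> R. Proof. by rewrite invr_gt0 exprn_gt0. Qed.
Let pow2_le1 k : 2 ^- k <= 1 :> R.
Proof. by rewrite invf_le1 ?exprn_gt0// exprn_ege1// ler1n. Qed.
(* The Muckenhoupt condition bounds the mean of h over the shrunk ball by the
   w-weighted L^p mean, and the balance condition trades the factor 2^-k and the
   w-mass for a power of the v-mass; since p < q, the surplus power of the v-mass
   decays geometrically in k by reverse doubling. *)
Lemma local_estimate : exists q C : R, [/\ p < q, 0 < C &
  forall k x (h : E -> R) (I H : R), B x ->
  measurable_fun B h -> (forall y, 0 <= h y) ->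
  (\int[lebesgue]_(y in sh k x) (h y)%:E)%E = I%:E ->
  (\int[lebesgue]_(y in sh k x) (h y `^ p * w y)%:E)%E = H%:E ->
  (r0 * 2 ^- k * (I / ((2 ^- k) ^+ n.+1 * m))) `^ p <=
  C * (wmass v (sh k x) `^ (- (p / q)) * H)].
Proof.
have [_ _ [mw _] [C [q [C0 pq bal]]]] := adm.
have [K K0 avg] := muckenhoupt_average unit_eball_gt0 p1 mw.
have q0 : 0 < q by exact: lt_trans pq.
have wB := wmass_gt0 unit_eball_gt0 x0 ww w_gt0 r00.
have vB := wmass_gt0 unit_eball_gt0 x0 wv v_gt0 r00.
(* [K] comes from the [A_p] condition; [C^p], [v(B)^(p/q)] and [1/w(B)] from the balance condition
   between the shrunk ball and [B]. *)
exists q, (r0 `^ p * (C `^ p * wmass v B `^ (p / q) * K / wmass w B)); split => //.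
  by rewrite !mulr_gt0// ?powR_gt0// ?invr_gt0.
move=> k x h I H Bx mh h0 hI hH.
have t0 := pow2_gt0 k; have sr0 : 0 < 2 ^- k * r0 by rewrite mulr_gt0.
have shB : sh k x `<=` B by rewrite /B -(shrunk1 x0 r0 x); apply: shrunk_sub.
have wk : 0 < wmass w (sh k x) by rewrite /sh /shrunk; apply: (wmass_gt0 unit_eball_gt0 _ ww w_gt0 sr0).
have vk : 0 < wmass v (sh k x) by rewrite /sh /shrunk; apply: (wmass_gt0 unit_eball_gt0 _ wv v_gt0 sr0).
have m' : lebesgue (sh k x) = ((2 ^- k) ^+ n.+1 * m)%:E.
  by rewrite [LHS]lebesgue_shrunk// EFinM -Bm.
have mk : 0 < (2 ^- k) ^+ n.+1 * m by rewrite mulr_gt0// exprn_gt0.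
have h1 := avg _ _ h _ I H sr0 (measurable_funS (@measurable_eball _ _ x0 r0) shB mh) h0 m' hI hH.
have h2 := bal _ _ _ _ sr0 r00 shB.
rewrite -/(sh k x) -/B in h2.
have I0 : 0 <= I by rewrite -lee_fin -hI; apply: integral_ge0 => y _; rewrite lee_fin.
move: h1 h2; rewrite -/(shrunk x0 r0 (2 ^- k) x) -/(sh k x) mulfK ?gt_eqF//.
have J0 : 0 <= I / ((2 ^- k) ^+ n.+1 * m) by rewrite divr_ge0// ltW.
move: (I / _) J0 (wmass w (sh k x)) wk (wmass v (sh k x)) vk (wmass w B) wB (wmass v B) vB.
move: (2 ^- k) t0 => {m' mk hI hH shB sr0} t t0 J J0 W W0 V V0 WB WB0 VB VB0 h1 h2.
have H0 : 0 <= H.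
  rewrite -(pmulr_rge0 _ K0); apply: le_trans h1.
  by rewrite mulr_ge0 ?powR_ge0// ltW.
have {}h2 : t `^ p * (V `^ (p / q) / VB `^ (p / q)) <= C `^ p * (W / WB).
  have VVB : 0 <= V / VB by rewrite divr_ge0// ltW.
  have WWB : 0 <= W / WB by rewrite divr_ge0// ltW.
  have := powR_le (ltW p0) (mulr_ge0 (ltW t0) (powR_ge0 _ _)) h2.
  rewrite (@powRM _ t _ p) ?(@powRM _ C _ p) ?powR_ge0 ?(ltW t0) ?(ltW C0)//.
  rewrite powRVK ?gt_eqF// -powRrM (mulrC q^-1).
  rewrite powRM ?invr_ge0 ?(ltW V0) ?(ltW VB0)//.
  by rewrite -(powR_inv1 (ltW VB0)) powRAC powR_inv1 ?powR_ge0.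
rewrite !powRM ?mulr_ge0 ?(ltW r00) ?(ltW t0)// powRN.
have Vp : 0 < V `^ (p / q) by rewrite powR_gt0.
have VBp : 0 < VB `^ (p / q) by rewrite powR_gt0.
have rp : 0 < r0 `^ p by rewrite powR_gt0.
rewrite -!mulrA ler_pM2l//.
have Jp := powR_ge0 J p; have Cp := powR_ge0 C p.
move: (V `^ _) (VB `^ _) (J `^ p) (C `^ p) (t `^ p) Vp VBp Jp Cp h1 h2 => a b j c s a0 b0 j0 c0 h1 h2.
have h3 : s * a <= c * W / WB * b.
  by have := h2; rewrite mulrA ler_pdivrMr// mulrA.
apply: (@le_trans _ _ ((c * W / WB * b) / a * j)).
  by rewrite ler_wpM2r// ler_pdivlMr.
have -> : c * W / WB * b / a * j = (c / WB * b / a) * (j * W) by ring.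
have -> : c * (b * (K * (WB^-1 * (a^-1 * H)))) = (c / WB * b / a) * (K * H) by ring.
by rewrite ler_wpM2l// !mulr_ge0// ?invr_ge0 ltW.
Qed.

Let measurableB : measurable B. Proof. exact: measurable_eball. Qed.

Lemma integral_bounded_fin (D : set E) (h : E -> R) (M : R) : measurable D -> D `<=` B ->
  measurable_fun B h -> (forall y, 0 <= h y) -> (forall y, B y -> h y <= M) ->
  exists I : R, (\int[lebesgue]_(y in D) (h y)%:E)%E = I%:E.
Proof.
move=> mD DB mh h0 hM; exists (fine (\int[lebesgue]_(y in D) (h y)%:E)%E).
rewrite fineK//; apply: integrable_fin_num => //.
apply: integrableS DB _ => //; apply: measurable_bounded_integrable => //.
  exact: lebesgue_eball_lty.
exists M; split; first exact: num_real.
by move=> N MN y By /=; rewrite ger0_norm//; exact: le_trans (hM _ By) (ltW MN).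
Qed.

Lemma integral_bounded_weight_fin (D : set E) (h : E -> R) (M : R) : measurable D -> D `<=` B ->
  measurable_fun B h -> (forall y, 0 <= h y) -> (forall y, B y -> h y <= M) ->
  exists I : R, (\int[lebesgue]_(y in D) (h y `^ p * w y)%:E)%E = I%:E.
Proof.
move=> mD DB mh h0 hM; have w0 : forall y, 0 <= w y by case: ww.
exists (fine (\int[lebesgue]_(y in D) (h y `^ p * w y)%:E)%E).
rewrite fineK//; apply: integrable_fin_num => //.
apply: integrableS DB _ => //.
apply: (@le_integrable _ _ _ lebesgue B measurableB _ (fun y => (M `^ p)%:E * (w y)%:E)%E).
- apply/measurable_EFinP; apply: measurable_funM; last exact: weight_measurable.
  exact: (measurableT_comp (measurable_powR _)).
- move=> y By; rewrite -EFinM !abse_EFin lee_fin !ger0_norm ?mulr_ge0 ?powR_ge0//.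
  by rewrite ler_wpM2r// powR_le ?(ltW p0)// hM.
- by apply: integrableZl => //; exact: weight_integrable.
Qed.

Lemma integral_setI_indicator (D P : set E) (f : E -> R) :
  (\int[lebesgue]_(y in D `&` P) (f y)%:E = \int[lebesgue]_(y in D) (\1_P y * f y)%:E)%E.
Proof.
rewrite integral_mkcondr; apply: eq_integral => y _.
by rewrite patchE indicE; case: (y \in P); rewrite ?mul1r ?mul0r.
Qed.

(* At scale 2^-k the local estimate is frozen on the balls of a maximal separated
   net; the bounded overlap of these balls lets the local terms be summed. *)
Lemma scale_estimate : exists A b : R, [/\ 0 < A, 0 < b < 1 &
  forall (h : E -> R) (M : R), measurable_fun B h -> (forall y, 0 <= h y) ->
  (forall y, B y -> h y <= M) ->
  forall k, exists g : E -> R, [/\ measurable_fun B g, forall y, 0 <= g y,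
  forall x I, B x -> (\int[lebesgue]_(y in sh k x) (h y)%:E)%E = I%:E ->
    (r0 * 2 ^- k * (I / ((2 ^- k) ^+ n.+1 * m))) `^ p <= g x &
  (\int[lebesgue]_(y in B) (g y * v y)%:E <=
    (A * b ^+ k)%:E * \int[lebesgue]_(y in B) (h y `^ p * w y)%:E)%E]].
Proof.
have [q [C [pq C0 est]]] := local_estimate.
have q0 : 0 < q by exact: lt_trans pq.
have pq0 : 0 < p / q by rewrite divr_gt0.
have pq1 : 0 < 1 - p / q by rewrite subr_gt0 ltr_pdivrMr// mul1r.
have [_ _ [_ dv] _] := adm.
have [D D0 dbl] := doubling_iter wv dv.
have [g /andP[g0 g1] rev] := reverse_doubling wv dv.
have V0 : 0 < wmass v (eball x0 (4 * r0)).
  by apply: (wmass_gt0 unit_eball_gt0 _ wv v_gt0); rewrite mulr_gt0.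
pose V := wmass v (eball x0 (4 * r0)).
(* [D^3] compares the mass of [B(z, 3s)] with that of a shrunk ball inside it, [7^(n+1)] bounds the
   overlap of the balls [B(z, 3s)], and [V^(1-p/q)] is what remains of their masses after reverse
   doubling. *)
pose A := C * (D ^+ 3) `^ (p / q) * (V `^ (1 - p / q) * (7 ^ n.+1)%:R).
exists A, (g `^ (1 - p / q)); split.
- by rewrite !mulr_gt0// ?powR_gt0 ?exprn_gt0// ltr0n expn_gt0.
- have e1 : 1 `^ (1 - p / q) = 1 :> R by rewrite powR1.
  rewrite powR_gt0//= -[ltRHS]e1.
  by apply: gt0_ltr_powR; rewrite ?nnegrE// ltW.
move=> h M mh h0 hM k; have t0 := pow2_gt0 k.
(* [s] is the radius of [sh k x], whose centre is within [s] of [x]. If [x] is within [s] of the net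
   point [z], then [sh k x] lies in [B(z, 3s)]. *)
pose s := 2 ^- k * r0; have s0 : 0 < s by rewrite mulr_gt0.
have [zs [zsep zsB zsnet]] := net_exists unit_eball_gt0 x0 s0 r00.
have mN z : measurable (B `&` eball z (3 * s)) by apply: measurableI => //; exact: measurable_eball.
have /choice[Hz HzE] z : exists I : R,
    (\int[lebesgue]_(y in B `&` eball z (3 * s)) (h y `^ p * w y)%:E)%E = I%:E.
  by apply: integral_bounded_weight_fin hM => //; exact: subIsetl.
have w0 : forall y, 0 <= w y by case: ww.
have v0 : forall y, 0 <= v y by case: wv.
have hw0 y : 0 <= h y `^ p * w y by rewrite mulr_ge0 ?powR_ge0.
have mhw : measurable_fun B (fun y => (h y `^ p * w y)%:E).
  apply/measurable_EFinP; apply: measurable_funM; last exact: weight_measurable.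
  exact: (measurableT_comp (measurable_powR _)).
have Hz0 z : 0 <= Hz z by rewrite -lee_fin -HzE; apply: integral_ge0 => y _; rewrite lee_fin.
pose W z := wmass v (eball z (3 * s)).
have W0 z : 0 < W z by apply: (wmass_gt0 unit_eball_gt0 _ wv v_gt0); rewrite mulr_gt0.
pose c z := C * (D ^+ 3) `^ (p / q) * (W z `^ (- (p / q)) * Hz z).
have c0 z : 0 <= c z by rewrite !mulr_ge0 ?powR_ge0// ltW.
exists (fun y => \sum_(z <- zs) \1_(eball z s) y * c z); split.
- apply: measurable_sum => z; apply: measurable_funM => //.
  by apply: measurable_indic; exact: measurable_eball.
- by move=> y; apply: sumr_ge0 => z _; rewrite mulr_ge0.
- move=> x I Bx hI; have [z zzs xz] := zsnet _ Bx.
  have shB : sh k x `<=` B by rewrite /B -(shrunk1 x0 r0 x); apply: shrunk_sub.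
  have ctr : enorm (x - ((1 - 2 ^- k) *: x + 2 ^- k *: x0)) < s.
    have -> : x - ((1 - 2 ^- k) *: x + 2 ^- k *: x0) = 2 ^- k *: (x - x0).
      by apply/matrixP => i j; rewrite !mxE; ring.
    by rewrite enormZ gtr0_norm// ltr_pM2l.
  have shN : sh k x `<=` eball z (3 * s).
    apply: eball_sub; apply: le_trans (lerD (enormB_trans _ x _) (lexx _)) _.
    by rewrite (enormB_sym _ x) -/s; lra.
  have msh : measurable (sh k x) by exact: measurable_eball.
  have [H HE] : exists I : R, (\int[lebesgue]_(y in sh k x) (h y `^ p * w y)%:E)%E = I%:E.
    exact: integral_bounded_weight_fin hM.
  apply: (le_trans (est k x h I H Bx mh h0 hI HE)).
  apply: (@le_trans _ _ (c z)); last first.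
    rewrite (big_rem z)//= indicE mem_set// mul1r lerDl.
    by apply: sumr_ge0 => z' _; rewrite mulr_ge0.
  rewrite /c -mulrA ler_pM2l// mulrA; apply: ler_pM.
  + exact: powR_ge0.
  + by rewrite -lee_fin -HE; apply: integral_ge0 => y _; rewrite lee_fin.
  + have vk : 0 < wmass v (sh k x).
      by rewrite /sh /shrunk; apply: (wmass_gt0 unit_eball_gt0 _ wv v_gt0).
    have WD : W z <= D ^+ 3 * wmass v (sh k x).
      apply: (le_trans _ (dbl 3%N _ _ s0)); apply: le_wmass => //.
      apply: eball_sub; apply: le_trans (lerD (enormB_trans _ x _) (lexx _)) _.
      by rewrite (enormB_sym z x) !exprS expr0 !mulr1; lra.
    rewrite !powRN -ler_pdivrMr ?invr_gt0 ?powR_gt0// invrK.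
    rewrite mulrC ler_pdivrMr ?powR_gt0// -powRM ?exprn_ge0 ?(ltW D0) ?(ltW vk)//.
    by apply: powR_le => //; exact: ltW.
  + rewrite -lee_fin -HE -HzE; apply: ge0_subset_integral => //.
    * by apply: measurable_funS mhw => //; exact: subIsetl.
    * by move=> y _; rewrite lee_fin.
    * by move=> y yx; split; [exact: shB|exact: shN].
have [H HE] : exists I : R, (\int[lebesgue]_(y in B) (h y `^ p * w y)%:E)%E = I%:E.
  exact: integral_bounded_weight_fin hM.
have sumH : \sum_(z <- zs) Hz z <= (7 ^ n.+1)%:R * H.
  have cnt y : \sum_(z <- zs) \1_(eball z (3 * s)) y <= (7 ^ n.+1)%:R :> R.
    rewrite (eq_bigr (fun z => ((enorm (z - y) < 3 * s)%R : nat)%:R)).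
      rewrite -natr_sum ler_nat (_ : (\sum_(z <- zs) _)%N = count (fun z => enorm (z - y) < 3 * s)%R zs).
        exact: count_separated_le unit_eball_gt0 _ _ _ s0 zsep.
      by elim: (zs) => [|a l IH]; rewrite ?big_nil// big_cons IH.
    by move=> z _; rewrite indicE enormB_sym; congr ((_ : bool)%:R); apply/idP/idP; rewrite ?inE.
  rewrite -lee_fin -sumEFin.
  under eq_bigr => z _ do rewrite -HzE integral_setI_indicator.
  have mind z : measurable_fun B (fun y => (\1_(eball z (3 * s)) y * (h y `^ p * w y))%:E).
    apply/measurable_EFinP; apply: measurable_funM; last exact/measurable_EFinP.
    by apply: measurable_indic; exact: measurable_eball.
  rewrite -ge0_integral_sum//; last by move=> z y _; rewrite lee_fin mulr_ge0.
  rewrite EFinM -HE -ge0_integralZl_EFin//; last by move=> y _; rewrite lee_fin.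
  apply: ge0_le_integral; first exact: measurable_eball.
  - by move=> y _; apply: sume_ge0 => z _; rewrite lee_fin mulr_ge0.
  - exact: emeasurable_sum.
  - exact: measurable_funeM.
  - move=> y _; rewrite sumEFin -mulr_suml -EFinM lee_fin ler_wpM2r//; exact: cnt.
have intz z : (\int[lebesgue]_(y in B) (\1_(eball z s) y * c z * v y)%:E <= (c z * W z)%:E)%E.
  rewrite (eq_integral (fun y => (c z)%:E * (\1_(eball z s) y * v y)%:E)%E); last first.
    by move=> y _; rewrite -EFinM; congr EFin; ring.
  rewrite ge0_integralZl_EFin//; last 2 first.
  - by move=> y _; rewrite lee_fin mulr_ge0.
  - apply/measurable_EFinP; apply: measurable_funM; last exact: weight_measurable.
    by apply: measurable_indic; exact: measurable_eball.
  rewrite [leRHS]EFinM lee_wpmul2l ?lee_fin// -integral_setI_indicator.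
  rewrite /W -wmassE//; apply: ge0_subset_integral => //.
  - by apply: measurableI => //; exact: measurable_eball.
  - exact: measurable_eball.
  - by apply/measurable_EFinP; apply: weight_measurable => //; exact: measurable_eball.
  - by move=> y _; rewrite lee_fin.
  - by move=> y [_ yz]; apply: lt_trans yz _; lra.
(* Integration against [v] multiplies [(W z)^(-p/q)] by at most [W z]. The surplus [(W z)^(1-p/q)]
   decays in [k] by reverse doubling from [B(z, 3 r0)], which lies in [B(x0, 4 r0)]. *)
have cW z : z \in zs -> c z * W z <=
    C * (D ^+ 3) `^ (p / q) * (g `^ (1 - p / q) ^+ k * V `^ (1 - p / q)) * Hz z.
  move=> zzs.
  have WE : W z `^ (- (p / q)) * W z = W z `^ (1 - p / q).
    rewrite -[X in _ * X](powRr1 (ltW (W0 z))) -powRD; last by rewrite (gt_eqF (W0 z)) implybT.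
    by congr (_ `^ _); ring.
  have -> : c z * W z = C * (D ^+ 3) `^ (p / q) * (W z `^ (- (p / q)) * W z) * Hz z.
    by rewrite /c; ring.
  rewrite ler_wpM2r// ler_wpM2l ?mulr_ge0 ?powR_ge0 ?(ltW C0)// WE.
  rewrite -powR_mulrn ?powR_ge0// powRAC powR_mulrn ?(ltW g0)// -powRM ?exprn_ge0 ?(ltW g0) ?(ltW V0)//.
  apply: powR_le => //; [exact: ltW|exact: ltW|].
  have -> : W z = wmass v (eball z (2 ^- k * (3 * r0))) by rewrite /W /s; congr (wmass v (eball z _)); ring.
  apply: le_trans (rev _ _ _ _) _; first by rewrite mulr_gt0.
  rewrite ler_wpM2l ?exprn_ge0 ?(ltW g0)//; apply: le_wmass => //; apply: eball_sub.
  by have := zsB z zzs; rewrite /eball/= => ?; lra.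
rewrite (eq_integral (fun y => \sum_(z <- zs) (\1_(eball z s) y * c z * v y)%:E)%E); last first.
  by move=> y _; rewrite mulr_suml sumEFin.
rewrite ge0_integral_sum//; last 2 first.
- move=> z; apply/measurable_EFinP; apply: measurable_funM; last exact: weight_measurable.
  apply: measurable_funM => //; apply: measurable_indic; exact: measurable_eball.
- by move=> z y _; rewrite lee_fin mulr_ge0// mulr_ge0.
apply: (@le_trans _ _ (\sum_(z <- zs) (c z * W z)%:E)%E); first exact: lee_sum.
rewrite sumEFin HE -EFinM lee_fin.
apply: (@le_trans _ _ (\sum_(z <- zs)
    C * (D ^+ 3) `^ (p / q) * (g `^ (1 - p / q) ^+ k * V `^ (1 - p / q)) * Hz z)).
  by rewrite big_seq [leRHS]big_seq; apply: ler_sum => z; exact: cW.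
rewrite -mulr_sumr.
apply: le_trans (ler_wpM2l _ sumH) _.
  by rewrite !mulr_ge0 ?powR_ge0 ?exprn_ge0 ?powR_ge0// ltW.
by rewrite le_eqVlt; apply/orP; left; apply/eqP; rewrite /A; ring.
Qed.

Lemma sum_geometric_le (t : R) N : 0 <= t < 1 -> \sum_(k < N) t ^+ k <= (1 - t)^-1.
Proof.
move=> /andP[t0 t1]; have t1' : 0 < 1 - t by rewrite subr_gt0.
rewrite -(ler_pM2l t1') mulfV ?gt_eqF//.
have -> : (1 - t) * \sum_(k < N) t ^+ k = 1 - t ^+ N.
  elim: N => [|N IH]; first by rewrite big_ord0 mulr0 expr0 subrr.
  by rewrite big_ord_recr/= mulrDr IH exprS; ring.
by rewrite gerBl exprn_ge0.
Qed.

(** The functions [g k] bound p-th powers, so their roots are what is summed along the chain. The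
    decay rate is split as [b = a^2]: one factor [a] makes the roots summable once [g k <= a^k T]
    for all [k]; the other makes the sum of the [a^-k g k], which serves as [T], integrable against
    [v]. *)
Lemma poincare : exists2 C : R, 0 < C & forall f, C1_closure B f -> exists c : R,
  (\int[lebesgue]_(y in B) (`|f y - c| `^ p * v y)%:E <=
    C%:E * \int[lebesgue]_(y in B) (enorm (grad f y) `^ p * w y)%:E)%E.
Proof.
have [A [b [A0 /andP[b0 b1] scale]]] := scale_estimate.
pose a := Num.sqrt b.
have a0 : 0 < a by rewrite sqrtr_gt0.
have a1 : a < 1 by rewrite -[ltRHS]sqrtr1 ltr_sqrt.
have ab : a ^+ 2 = b by rewrite sqr_sqrtr// ltW.
pose th := a `^ p^-1.
have th0 : 0 <= th by exact: powR_ge0.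
have th1 : th < 1.
  have e1 : 1 `^ p^-1 = 1 :> R by rewrite powR1.
  by rewrite -[ltRHS]e1; apply: gt0_ltr_powR; rewrite ?invr_gt0 ?nnegrE// ltW.
pose L := (2 ^+ n.+1 / (1 - th)) `^ p.
have L0' : 0 < 2 ^+ n.+1 / (1 - th) by rewrite divr_gt0 ?exprn_gt0 ?subr_gt0.
have L0 : 0 < L by rewrite powR_gt0.
have v0 : forall y, 0 <= v y by case: wv.
exists (L * A / (1 - a)); first by rewrite !mulr_gt0// invr_gt0 subr_gt0.
move=> f C1f; have [M M0 hM] := grad_bounded C1f.
have mh := measurable_enorm_grad C1f.
have h0 y : 0 <= enorm (grad f y) by exact: enorm_ge0.
have /choice[g gP] := scale _ M mh h0 hM.
exists ((\int[lebesgue]_(y in B) f y) / m); set c := _ / m.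
have pointwise x T : B x -> 0 <= T -> (forall k, g k x <= a ^+ k * T) ->
    `|f x - c| `^ p <= L * T.
  move=> Bx T0 gT.
  have /choice[I IE] k : exists I : R,
      (\int[lebesgue]_(y in sh k x) (enorm (grad f y))%:E)%E = I%:E.
    apply: (integral_bounded_fin _ _ mh h0 hM); first exact: measurable_eball.
    by rewrite /B -(shrunk1 x0 r0 x); apply: shrunk_sub.
  have I0 k : 0 <= I k.
    by rewrite -lee_fin -IE; apply: integral_ge0 => y _; rewrite lee_fin.
  pose q k := r0 * 2 ^- k * (I k / ((2 ^- k) ^+ n.+1 * m)).
  have mk k : 0 < (2 ^- k) ^+ n.+1 * m by rewrite mulr_gt0// exprn_gt0.
  have q0 k : 0 <= q k.
    apply: mulr_ge0; first by apply: mulr_ge0; exact: ltW.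
    by rewrite divr_ge0// ltW.
  have qle k : q k <= th ^+ k * T `^ p^-1.
    rewrite -[q k](powRKV (p := p)) ?gt_eqF//.
    have -> : th ^+ k * T `^ p^-1 = (a ^+ k * T) `^ p^-1.
      rewrite powRM ?exprn_ge0 ?(ltW a0)// /th -powR_mulrn ?powR_ge0//.
      by rewrite powRAC powR_mulrn// ltW.
    apply: powR_le; [by rewrite invr_ge0 ltW|exact: powR_ge0|].
    apply: le_trans (gT k); have [_ _ h _] := gP k.
    exact: h.
  have -> : L * T = (2 ^+ n.+1 * (T `^ p^-1 / (1 - th))) `^ p.
    rewrite -[in LHS](powRVK (a := T) (p := p)) ?gt_eqF// /L -powRM ?powR_ge0 ?(ltW L0')//.
    by congr (_ `^ _); ring.
  apply: powR_le; [exact: ltW|exact: normr_ge0|].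
  apply: (@chain_bound _ _ x0 r0 f x C1f Bx m _ q) => //.
    move=> k; rewrite [leLHS]IE lee_fin /q le_eqVlt; apply/orP; left; apply/eqP.
    by field; rewrite !gt_eqF ?mulr_gt0 ?exprn_gt0.
  move=> N; apply: (@le_trans _ _ (\sum_(k < N) th ^+ k * T `^ p^-1)).
    by apply: ler_sum => k _.
  rewrite -mulr_suml mulrC ler_wpM2l ?powR_ge0//.
  by apply: sum_geometric_le; rewrite th0.
pose u k y := L * (a ^- k * g k y) * v y.
have u0 k y : 0 <= u k y.
  have [_ g0 _ _] := gP k.
  by rewrite !mulr_ge0 ?(ltW L0)// invr_ge0 exprn_ge0// ltW.
have ue0 k y : (0 <= (u k y)%:E)%E by rewrite lee_fin.
have mu k : measurable_fun B (fun y => (u k y)%:E).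
  have [mg _ _ _] := gP k.
  apply/measurable_EFinP; apply: measurable_funM; last exact: weight_measurable.
  exact: (measurable_funM (measurable_cst _) (measurable_funM (measurable_cst _) mg)).
have [H HE] : exists I : R,
    (\int[lebesgue]_(y in B) (enorm (grad f y) `^ p * w y)%:E)%E = I%:E.
  exact: integral_bounded_weight_fin hM.
have H0 : 0 <= H.
  have w0 : forall y, 0 <= w y by case: ww.
  by rewrite -lee_fin -HE; apply: integral_ge0 => y _; rewrite lee_fin mulr_ge0 ?powR_ge0.
have mfc : measurable_fun B (fun y => (`|f y - c| `^ p * v y)%:E).
  apply/measurable_EFinP; apply: measurable_funM; last exact: weight_measurable.
  apply: (measurableT_comp (measurable_powR _)).
  apply: (measurableT_comp (@normr_measurable R setT)).
  by apply: (measurable_funB _ (measurable_cst c)); exact: measurable_C1_closure.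
apply: (@le_trans _ _ (\int[lebesgue]_(y in B) (\sum_(k <oo) (u k y)%:E))%E).
  apply: ge0_le_integral; first exact: measurable_eball.
  - by move=> y _; rewrite lee_fin mulr_ge0 ?powR_ge0.
  - exact: mfc.
  - by apply: ge0_emeasurable_sum => // k y By _.
  (* Where [v] vanishes the weighted sum carries no information on [g k], but there the left side is
     zero. *)
  - move=> y By; have [vy|vy] := eqVneq (v y) 0.
      by rewrite vy mulr0; apply: nneseries_ge0.
    have vp : 0 < v y by rewrite lt0r vy v0.
    have term k : ((u k y)%:E <= \sum_(j <oo) (u j y)%:E)%E.
      by rewrite (@nneseriesD1 _ _ k)// leeDl//; apply: nneseries_ge0.
    have : (0 <= \sum_(j <oo) (u j y)%:E)%E by apply: nneseries_ge0.
    move: term; case: (limn _) => [T| |]//; last by move=> *; rewrite leey.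
    move=> term T0; rewrite lee_fin in T0; rewrite lee_fin -ler_pdivlMr//.
    rewrite (_ : T / v y = L * (T / (L * v y))); last by field; rewrite !gt_eqF.
    apply: pointwise => // [|k]; first by rewrite divr_ge0// mulr_ge0// ltW.
    have := term k; rewrite lee_fin /u => h.
    have ak : 0 < a ^+ k by rewrite exprn_gt0.
    rewrite mulrA ler_pdivlMr ?mulr_gt0// -ler_pdivrMl//.
    by apply: le_trans h; rewrite le_eqVlt; apply/orP; left; apply/eqP; ring.
rewrite integral_nneseries//.
apply: (@le_trans _ _ (\sum_(k <oo) ((L * A * H) * a ^+ k)%:E)%E).
  apply: lee_nneseries => [k _ _|k _]; first exact: integral_ge0.
  have [mg g0 _ gint] := gP k; rewrite HE in gint.
  rewrite (eq_integral (fun y => (L * a ^- k)%:E * (g k y * v y)%:E)%E); last first.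
    by move=> y _; rewrite -EFinM /u; congr EFin; ring.
  have ak : 0 < a ^+ k by rewrite exprn_gt0.
  rewrite ge0_integralZl_EFin//; last 3 first.
  - by move=> y _; rewrite lee_fin mulr_ge0.
  - by apply/measurable_EFinP; apply: measurable_funM => //; exact: weight_measurable.
  - by rewrite mulr_ge0 ?invr_ge0 ?(ltW L0) ?(ltW ak).
  apply: (@le_trans _ _ ((L * a ^- k)%:E * ((A * b ^+ k)%:E * H%:E))%E).
    by rewrite lee_wpmul2l// lee_fin mulr_ge0 ?invr_ge0 ?(ltW L0) ?(ltW ak).
  rewrite -!EFinM lee_fin -ab.
  rewrite le_eqVlt; apply/orP; left; apply/eqP.
  rewrite -exprM mul2n -addnn exprD; field.
  by rewrite gt_eqF.
rewrite HE -EFinM; apply: lime_le.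
  by apply: is_cvg_nneseries => k _ _; rewrite lee_fin !mulr_ge0 ?exprn_ge0// ltW.
apply: nearW => N; rewrite big_mkord sumEFin lee_fin -mulr_sumr.
rewrite (_ : L * A / (1 - a) * H = L * A * H * (1 - a)^-1); last by ring.
apply: ler_wpM2l; first by rewrite !mulr_ge0// ltW.
by apply: sum_geometric_le; rewrite a1 ltW.
Qed.

End poincare.

(** * Rapidly convergent subsequences *)

Section subsequences.
Context {R : realType}.

Lemma geometric_increments (u : nat -> R) (c t : R) : 0 <= c -> 0 <= t < 1 ->
  (forall k, `|u k.+1 - u k| <= c * t ^+ k) ->
  exists l : R, u k @[k --> \oo] --> l.
Proof.
move=> c0 /andP[t0 t1] uc; apply/cvg_ex.
have -> : u = (fun k => u 0%N + series (fun k => u k.+1 - u k) k).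
  by apply/funext => k; rewrite /series/= telescope_sumr// subrKC.
apply: is_cvgD; first exact: is_cvg_cst.
apply: normed_cvg; apply: (@series_le_cvg _ _ (geometric c t)).
- by move=> k; exact: normr_ge0.
- by move=> k; rewrite /= mulr_ge0// exprn_ge0.
- exact: uc.
- by apply: is_cvg_geometric_series; rewrite ger0_norm.
Qed.

Lemma sum_geometric_tail (t : R) (i j : nat) : 0 <= t < 1 -> (i <= j)%N ->
  \sum_(i <= k < j) t ^+ k <= (1 - t)^-1.
Proof.
move=> /andP[t0 t1]; have t1' : 0 < 1 - t by rewrite subr_gt0.
move=> ij; rewrite -(ler_pM2l t1') mulfV ?gt_eqF//.
have -> : (1 - t) * \sum_(i <= k < j) t ^+ k = t ^+ i - t ^+ j.
  rewrite -opprB mulNr -[RHS]opprB -telescope_sumr//; congr (- _).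
  rewrite mulr_sumr; apply: eq_bigr => k _; rewrite exprS; ring.
have := exprn_ge0 j t0; have : t ^+ i <= 1 by rewrite exprn_ile1// ltW.
by lra.
Qed.

Lemma increments_le (D : nat -> R) (c t : R) k : 0 <= c -> 0 <= t < 1 -> D k = 0 ->
  (forall j, (k <= j)%N -> D j.+1 <= D j + c * t ^+ j) ->
  forall j, (k <= j)%N -> D j <= c / (1 - t) * t ^+ k.
Proof.
move=> c0 /andP[t0 t1] Dk HD.
have t1' : 0 < 1 - t by rewrite subr_gt0.
have H j : D (k + j)%N <= c / (1 - t) * (t ^+ k - t ^+ (k + j)).
  elim: j => [|j IH]; first by rewrite addn0 Dk subrr mulr0.
  rewrite addnS; apply: le_trans (HD _ (leq_addr _ _)) _.
  apply: (le_trans (lerD IH (lexx _))).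
  rewrite exprS le_eqVlt; apply/orP; left; apply/eqP.
  by field; rewrite gt_eqF.
move=> j kj; rewrite -(subnKC kj); apply: le_trans (H _) _.
by rewrite ler_wpM2l ?divr_ge0 ?(ltW t1')// gerBl exprn_ge0.
Qed.

Lemma increments_limit (u : nat -> R) (l c t : R) : 0 <= c -> 0 <= t < 1 ->
  u k @[k --> \oo] --> l -> (forall k, `|u k.+1 - u k| <= c * t ^+ k) ->
  forall k, `|u k - l| <= c / (1 - t) * t ^+ k.
Proof.
move=> c0 t01 ul uc k.
have h : `|u k - u j| @[j --> \oo] --> `|u k - l|.
  by apply: cvg_norm; apply: cvgB => //; exact: cvg_cst.
rewrite -(cvg_lim (@Rhausdorff R) h); apply: limr_le; first by apply/cvg_ex; eexists; exact: h.
near=> j; apply: (@increments_le (fun j => `|u k - u j|)) => //.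
- by rewrite subrr normr0.
- move=> i _; rewrite (_ : u k - u i.+1 = (u k - u i) - (u i.+1 - u i)); last by ring.
  by apply: le_trans (ler_normB _ _) _; rewrite lerD2l.
- by near: j; exact: nbhs_infty_ge.
Unshelve. all: by end_near. Qed.

Lemma enorm_increments_limit (m q : nat) (a : nat -> 'M[R]_(m, q)) (l : 'M[R]_(m, q)) (c t : R) :
  0 <= c -> 0 <= t < 1 -> (forall i j, a k i j @[k --> \oo] --> l i j) ->
  (forall k, enorm (a k.+1 - a k) <= c * t ^+ k) ->
  forall k, enorm (a k - l) <= c / (1 - t) * t ^+ k.
Proof.
move=> c0 t01 al ac k.
have h : enorm (a k - a j) @[j --> \oo] --> enorm (a k - l).
  apply: enorm_cvg => i j; rewrite !mxE; under eq_fun do rewrite !mxE.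
  by apply: cvgB; [exact: cvg_cst|exact: al].
rewrite -(cvg_lim (@Rhausdorff R) h); apply: limr_le; first by apply/cvg_ex; eexists; exact: h.
near=> j; apply: (@increments_le (fun j => enorm (a k - a j))) => //.
- by rewrite subrr enorm0.
- move=> i _; apply: le_trans (enormB_trans _ (a i) _) _.
  by rewrite lerD2l enormB_sym.
- by near: j; exact: nbhs_infty_ge.
Unshelve. all: by end_near. Qed.

(* A total, hence measurable, choice of a limit: junk where u diverges. *)
Definition ulim (u : nat -> R) : R := fine (limn_esup (fun k => (u k)%:E)).

Lemma cvg_ulim (u : nat -> R) (l : R) : u k @[k --> \oo] --> l -> ulim u = l.
Proof.
move=> ul; have h : (u k)%:E @[k --> \oo] --> l%:E by apply: cvg_EFin => //; exact: nearW.
rewrite /ulim; have := cvg_limn_einf_sup h.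
by move=> [_ ->].
Qed.

Context d (T : measurableType d) (mu : {measure set T -> \bar R}) (D : set T).
Hypothesis mD : measurable D.

Lemma measurable_ulim (f : nat -> T -> R) : (forall k, measurable_fun D (f k)) ->
  measurable_fun D (fun x => ulim (fun k => f k x)).
Proof.
move=> mf; apply: (@measurableT_comp _ _ _ _ _ _ (@fine R)) => //.
by apply: measurable_fun_limn_esup => k; exact/measurable_EFinP.
Qed.

(** The extraction of the Riesz-Fischer theorem: increments of integral at most [4^-k] are weighted
    by [2^k], and their sum [Z] is integrable, hence finite almost everywhere. *)
Lemma fast_subsequence (H : nat -> nat -> T -> R) :
  (forall j k, measurable_fun D (H j k)) -> (forall j k x, 0 <= H j k x) ->
  (forall e : R, 0 < e -> exists N, forall j k, (N <= j)%N -> (N <= k)%N ->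
    (\int[mu]_(x in D) (H j k x)%:E <= e%:E)%E) ->
  exists (s : nat -> nat) (Z : T -> R), [/\ forall k, (k <= s k)%N,
    forall x, 0 <= Z x, mu.-integrable D (EFin \o Z) &
    {ae mu, forall x, D x -> forall k, 2 ^+ k * H (s k) (s k.+1) x <= Z x}].
Proof.
move=> mH H0 Hc.
have /choice[N HN] k : exists N, forall j l, (N <= j)%N -> (N <= l)%N ->
    (\int[mu]_(x in D) (H j l x)%:E <= (4 ^- k)%:E)%E.
  by apply: Hc; rewrite invr_gt0 exprn_gt0.
(* The summand [k] gives [k <= s k]; the partial sum puts both [s k] and [s k.+1] beyond [N k]. *)
pose s k := (k + \sum_(i < k.+1) N i)%N.
have sN k : (N k <= s k)%N by rewrite /s big_ord_recr/= addnA leq_addl.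
have sN' k : (N k <= s k.+1)%N.
  by rewrite /s 2!big_ord_recr/= [X in (_ <= X)%N]addnC -addnA -addnA addnCA leq_addr.
pose F k x := (2 ^+ k * H (s k) (s k.+1) x)%:E.
have F0 k x : (0 <= F k x)%E by rewrite lee_fin mulr_ge0// exprn_ge0.
have mF k : measurable_fun D (F k).
  by apply/measurable_EFinP; apply: measurable_funM.
pose Z x := (\sum_(k <oo) F k x)%E.
have mZ : measurable_fun D Z by apply: ge0_emeasurable_sum.
have Z0 x : (0 <= Z x)%E by apply: nneseries_ge0.
have ZF k x : (F k x <= Z x)%E.
  by rewrite /Z (@nneseriesD1 _ _ k)// leeDl//; apply: nneseries_ge0.
have iZ : (\int[mu]_(x in D) Z x < +oo)%E.
  rewrite /Z integral_nneseries//.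
  apply: (@le_lt_trans _ _ (\sum_(k <oo) ((2^-1) ^+ k)%:E)%E).
    apply: lee_nneseries => [k _ _|k _]; first exact: integral_ge0.
    rewrite /F; under eq_integral do rewrite EFinM.
    rewrite ge0_integralZl_EFin//; last 2 first.
    - by move=> x _; rewrite lee_fin.
    - exact/measurable_EFinP.
    apply: (@le_trans _ _ ((2 ^+ k)%:E * (4 ^- k)%:E)%E).
      by apply: lee_wpmul2l; [rewrite lee_fin exprn_ge0|exact: HN].
    rewrite -EFinM lee_fin -exprVn -exprMn; rewrite (_ : 2 * 4^-1 = 2^-1)//.
    by field.
  apply: (@le_lt_trans _ _ 2%:E); last exact: ltry.
  apply: lime_le.
    by apply: is_cvg_nneseries => k _ _; rewrite lee_fin exprn_ge0.
  apply: nearW => M; rewrite sumEFin lee_fin.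
  have h2 : (0 <= (2^-1 : R)) && ((2^-1 : R) < 1) by apply/andP; split; lra.
  apply: (le_trans (sum_geometric_tail h2 (leq0n M))).
  by rewrite (_ : (1 - 2^-1)^-1 = 2)//; field.
have IZ : mu.-integrable D Z.
  by apply/integrableP; split => //; under eq_integral do rewrite gee0_abs//.
have aeZ := integrable_ae mD IZ.
exists s, (fine \o Z); split.
- by move=> k; rewrite leq_addr.
- by move=> x; rewrite fine_ge0.
- apply/integrableP; split.
    by apply/measurable_EFinP; apply: measurableT_comp.
  apply: le_lt_trans iZ; apply: ge0_le_integral => //.
  + by apply: measurableT_comp => //; apply/measurable_EFinP; apply: measurableT_comp.
  + move=> x Dx /=; rewrite ger0_norm ?fine_ge0//.
    by case: (Z x) (Z0 x) => [r| |]//= _; rewrite leey.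
- apply: filterS aeZ => x + Dx k => /(_ Dx) Zf.
  by rewrite -lee_fin /= fineK//; exact: ZF.
Qed.

End subsequences.

(** * The Neumann problem under a Poincare inequality *)

Lemma mdotE {R : realType} {m : nat} (a b : 'cV[R]_m) : mdot a b = (a^T *m b) ord0 ord0.
Proof. by rewrite mxE; apply: eq_bigr => i _; rewrite big_ord1 !mxE. Qed.

Section linear_bounds.
Context {R : realType} d {T : measurableType d} (mu : {measure set T -> \bar R}) (D : set T).
Hypothesis mD : measurable D.
Implicit Types (h : T -> R) (a b : R).

Lemma integrable_lin a b (k1 k2 : T -> R) :
  mu.-integrable D (EFin \o k1) -> mu.-integrable D (EFin \o k2) ->
  mu.-integrable D (EFin \o (fun x => a * k1 x + b * k2 x)).
Proof.
move=> i1 i2.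
have i : mu.-integrable D (fun x => a%:E * (k1 x)%:E + b%:E * (k2 x)%:E)%E.
  exact: (integrableD mD (integrableZl mD a i1) (integrableZl mD b i2)).
by apply: eq_integrable i => // x _; rewrite /= EFinD !EFinM.
Qed.

Lemma Rintegral_lin a b (k1 k2 : T -> R) :
  mu.-integrable D (EFin \o k1) -> mu.-integrable D (EFin \o k2) ->
  \int[mu]_(x in D) (a * k1 x + b * k2 x) =
  a * \int[mu]_(x in D) k1 x + b * \int[mu]_(x in D) k2 x.
Proof.
move=> i1 i2.
rewrite (RintegralD mD (integrableZl mD a i1) (integrableZl mD b i2)).
by rewrite (RintegralZl a mD i1) (RintegralZl b mD i2).
Qed.

Lemma le_integrable_lin a b h (k1 k2 : T -> R) : measurable_fun D h ->
  mu.-integrable D (EFin \o k1) -> mu.-integrable D (EFin \o k2) ->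
  (forall x, D x -> `|h x| <= a * k1 x + b * k2 x) -> mu.-integrable D (EFin \o h).
Proof.
move=> mh i1 i2 hk; have i := integrable_lin a b i1 i2.
apply: (le_integrable mD _ _ i); first exact/measurable_EFinP.
by move=> x Dx; rewrite lee_fin; apply: le_trans (ler_norm _); exact: hk.
Qed.

Lemma le_Rintegral_lin a b h (k1 k2 : T -> R) : mu.-integrable D (EFin \o h) ->
  mu.-integrable D (EFin \o k1) -> mu.-integrable D (EFin \o k2) ->
  (forall x, D x -> h x <= a * k1 x + b * k2 x) ->
  \int[mu]_(x in D) h x <= a * \int[mu]_(x in D) k1 x + b * \int[mu]_(x in D) k2 x.
Proof.
move=> ih i1 i2 hk; rewrite -(Rintegral_lin a b i1 i2).
exact: (le_Rintegral mD ih (integrable_lin a b i1 i2) hk).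
Qed.

Lemma normr_Rintegral_lin a b h (k1 k2 : T -> R) : mu.-integrable D (EFin \o h) ->
  mu.-integrable D (EFin \o k1) -> mu.-integrable D (EFin \o k2) ->
  (forall x, D x -> `|h x| <= a * k1 x + b * k2 x) ->
  `|\int[mu]_(x in D) h x| <= a * \int[mu]_(x in D) k1 x + b * \int[mu]_(x in D) k2 x.
Proof.
move=> ih i1 i2 hk; apply: le_trans (le_normr_Rintegral mD ih) _.
exact: (le_Rintegral_lin (integrable_norm ih) i1 i2 hk).
Qed.

End linear_bounds.

Section energy.
Context {R : realType} {n : nat}.
Local Notation E := 'rV[R]_n.+1.
Variables (x0 : E) (r0 p : R) (w v : E -> R) (Q : E -> 'M[R]_n.+1).
Let B := eball x0 r0.
Hypotheses (p1 : 1 < p) (wv : weight v) (vB : lebesgue.-integrable B (EFin \o v)).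
Hypotheses (w_gt0 : {ae lebesgue, forall x, 0 < w x})
  (v_gt0 : {ae lebesgue, forall x, 0 < v x}).
Hypothesis mQ : forall i j, measurable_fun B (fun x => Q x i j).
Let S x := psd_sqrt (Q x).
Hypothesis sqrtQ : {ae lebesgue, forall x, B x -> (S x)^T = S x /\ S x *m S x = Q x}.
Hypothesis degenerate : {ae lebesgue, forall x, B x -> forall xi : 'cV[R]_n.+1,
  w x * enorm xi `^ p <= enorm (S x *m xi) `^ p}.
Implicit Types (u f phi : E -> R) (g : E -> 'cV[R]_n.+1) (t : R).

Let p0 : 0 < p. Proof. exact: lt_trans ltr01 p1. Qed.
Let v0 x : 0 <= v x. Proof. by case: wv. Qed.
Let mB : measurable B. Proof. exact: measurable_eball. Qed.
Let mv : measurable_fun B v. Proof. by case: wv => mv _ _; exact: measurable_funS mv. Qed.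

(** A measure on its Carathéodory sigma-algebra is complete, so measurability is not affected by
    null sets. *)
Lemma lebesgue_ae_measurable (f h : E -> R) :
  {ae lebesgue, forall x, B x -> f x = h x} -> measurable_fun B h -> measurable_fun B f.
Proof.
move=> fh mh; apply/measurable_EFinP.
apply: (@ae_measurable_fun _ _ R lebesgue _ B (EFin \o h) (EFin \o f)).
- exact: measure_is_complete_caratheodory.
- by apply: filterS fh => x + Bx => /(_ Bx) /= ->.
- exact/measurable_EFinP.
Qed.

Definition mfield g := forall i, measurable_fun B (fun x => g x i ord0).

(** Almost everywhere [S] is symmetric with square [Q], so the product is [<g1, Q g2>], whose
    measurability is that of the entries of [Q]. *)
Lemma measurable_mdotS g1 g2 : mfield g1 -> mfield g2 ->
  measurable_fun B (fun x => mdot (S x *m g1 x) (S x *m g2 x)).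
Proof.
move=> m1 m2.
apply: (@lebesgue_ae_measurable _ (fun x => mdot (g1 x) (Q x *m g2 x))).
  apply: filterS sqrtQ => x + Bx => /(_ Bx) [St SS].
  by rewrite !mdotE trmx_mul St mulmxA -(mulmxA (g1 x)^T (S x) (S x)) SS mulmxA.
apply: measurable_mdot => i j; rewrite (ord1 j); first exact: m1.
under eq_fun do rewrite mxE.
by apply: measurable_sum => k; apply: measurable_funM; [exact: mQ|exact: m2].
Qed.

Lemma measurable_enormS g : mfield g -> measurable_fun B (fun x => enorm (S x *m g x)).
Proof.
move=> mg; under eq_fun do rewrite enormE.
apply: (@measurableT_comp _ _ _ _ _ _ (@Num.sqrt R)); last exact: measurable_mdotS.
by apply: continuous_measurable_fun; exact: sqrt_continuous.
Qed.

(* in_Lp, in_LQ: membership in L^p(v;B) and in L^p_Q(B); Lp_pow and LQ_pow: the p-th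
   powers of the two norms, with integrands Lp_dens and LQ_dens.  Below, flux g (grad phi)
   and source f phi are the two sides of the weak equation, up to the sign. *)
Definition Lp_dens u x := `|u x| `^ p * v x.
Definition LQ_dens g x := enorm (S x *m g x) `^ p.

Definition in_Lp u := measurable_fun B u /\ lebesgue.-integrable B (EFin \o Lp_dens u).
Definition in_LQ g := mfield g /\ lebesgue.-integrable B (EFin \o LQ_dens g).

Definition Lp_pow u : R := \int[lebesgue]_(x in B) Lp_dens u x.
Definition LQ_pow g : R := \int[lebesgue]_(x in B) LQ_dens g x.

Lemma Lp_dens_ge0 u x : 0 <= Lp_dens u x. Proof. by rewrite mulr_ge0 ?powR_ge0. Qed.
Lemma LQ_dens_ge0 g x : 0 <= LQ_dens g x. Proof. exact: powR_ge0. Qed.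
Lemma Lp_pow_ge0 u : 0 <= Lp_pow u. Proof. by apply: Rintegral_ge0 => x _; exact: Lp_dens_ge0. Qed.
Lemma LQ_pow_ge0 g : 0 <= LQ_pow g. Proof. by apply: Rintegral_ge0 => x _; exact: LQ_dens_ge0. Qed.

Lemma measurable_Lp_dens u : measurable_fun B u -> measurable_fun B (Lp_dens u).
Proof.
move=> mu.
exact: (measurable_funM (measurableT_comp (measurable_powR _) (measurableT_comp (@normr_measurable R setT) mu)) mv).
Qed.

Lemma measurable_LQ_dens g : mfield g -> measurable_fun B (LQ_dens g).
Proof. by move=> mg; apply: (measurableT_comp (measurable_powR _)); exact: measurable_enormS. Qed.

Lemma integral_Lp_pow u : in_Lp u -> (\int[lebesgue]_(x in B) (Lp_dens u x)%:E)%E = (Lp_pow u)%:E.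
Proof. by move=> [_ iu]; rewrite /Lp_pow /Rintegral fineK//; exact: integrable_fin_num. Qed.

Lemma integral_LQ_pow g : in_LQ g -> (\int[lebesgue]_(x in B) (LQ_dens g x)%:E)%E = (LQ_pow g)%:E.
Proof. by move=> [_ ig]; rewrite /LQ_pow /Rintegral fineK//; exact: integrable_fin_num. Qed.

Lemma in_LpP u : measurable_fun B u -> (\int[lebesgue]_(x in B) (Lp_dens u x)%:E < +oo)%E -> in_Lp u.
Proof.
move=> mu iu; split => //; apply/integrableP; split; first exact/measurable_EFinP/measurable_Lp_dens.
by under eq_integral do rewrite gee0_abs ?lee_fin ?Lp_dens_ge0//.
Qed.

Lemma in_LQP g : mfield g -> (\int[lebesgue]_(x in B) (LQ_dens g x)%:E < +oo)%E -> in_LQ g.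
Proof.
move=> mg ig; split => //; apply/integrableP; split; first exact/measurable_EFinP/measurable_LQ_dens.
by under eq_integral do rewrite gee0_abs ?lee_fin ?LQ_dens_ge0//.
Qed.

Lemma Lp_norm_in_Lp u : in_Lp u -> Lp_norm p v B u = (Lp_pow u `^ p^-1)%:E.
Proof. by move=> ou; rewrite /Lp_norm integral_Lp_pow. Qed.

Lemma LQ_norm_in_LQ g : in_LQ g -> LQ_norm p Q B g = (LQ_pow g `^ p^-1)%:E.
Proof. by move=> og; rewrite /LQ_norm integral_LQ_pow. Qed.

Lemma LpP u : Lp p v B u <-> in_Lp u.
Proof.
split=> [[mu /lty_poweRy]|ou]; last by split; [case: ou|rewrite Lp_norm_in_Lp// ltry].
by rewrite invr_eq0 gt_eqF// => /(_ isT) iu; exact: in_LpP.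
Qed.

Lemma LQP g : LQ p Q B g <-> in_LQ g.
Proof.
split=> [[mg /lty_poweRy]|og]; last by split; [case: og|rewrite LQ_norm_in_LQ// ltry].
by rewrite invr_eq0 gt_eqF// => /(_ isT) ig; exact: in_LQP.
Qed.

Lemma le_in_Lp (h : E -> R) u : measurable_fun B u -> lebesgue.-integrable B (EFin \o h) ->
  (forall x, B x -> Lp_dens u x <= h x) -> in_Lp u.
Proof.
move=> mu ih uh; split => //; apply: (le_integrable mB _ _ ih).
  exact/measurable_EFinP/measurable_Lp_dens.
by move=> x Bx /=; rewrite lee_fin ger0_norm ?Lp_dens_ge0// (le_trans (uh _ Bx))// ler_norm.
Qed.

(** * Linear combinations, C^1 functions and test functions *)

Definition ucomb t u1 u2 x : R := u1 x + t * u2 x.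
Definition gcomb t g1 g2 x : 'cV[R]_n.+1 := g1 x + t *: g2 x.

Lemma Lp_dens_comb t u1 u2 x : Lp_dens (ucomb t u1 u2) x <= 2 `^ p * Lp_dens u1 x + 2 `^ p * `|t| `^ p * Lp_dens u2 x.
Proof.
rewrite -mulrA -mulrDr /Lp_dens mulrA -mulrDl mulrA ler_wpM2r// -powRM//.
apply: le_trans (powRD_le (ltW p0) (normr_ge0 _) (mulr_ge0 (normr_ge0 t) (normr_ge0 (u2 x)))).
by apply: powR_le; [exact: ltW|exact: normr_ge0|rewrite -normrM ler_normD].
Qed.

Lemma LQ_dens_comb t g1 g2 x : LQ_dens (gcomb t g1 g2) x <= 2 `^ p * LQ_dens g1 x + 2 `^ p * `|t| `^ p * LQ_dens g2 x.
Proof.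
rewrite -mulrA -mulrDr /LQ_dens -powRM ?enorm_ge0//.
apply: le_trans (powRD_le (ltW p0) (enorm_ge0 _) (mulr_ge0 (normr_ge0 t) (enorm_ge0 _))).
apply: powR_le; [exact: ltW|exact: enorm_ge0|].
by rewrite /gcomb mulmxDr -scalemxAr -enormZ enormD.
Qed.

Lemma mfield_comb t g1 g2 : mfield g1 -> mfield g2 -> mfield (gcomb t g1 g2).
Proof.
move=> m1 m2 i; under eq_fun do rewrite !mxE.
by apply: measurable_funD; [exact: m1|apply: measurable_funM => //; exact: m2].
Qed.

Lemma in_Lp_comb t u1 u2 : in_Lp u1 -> in_Lp u2 -> in_Lp (ucomb t u1 u2).
Proof.
move=> [m1 i1] [m2 i2]; have m : measurable_fun B (ucomb t u1 u2).
  exact: (measurable_funD m1 (measurable_funM (measurable_cst _) m2)).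
split; first exact: m.
apply: (le_integrable_lin mB (measurable_Lp_dens m) i1 i2) => x _.
rewrite ger0_norm ?Lp_dens_ge0//; exact: Lp_dens_comb.
Qed.

Lemma in_LQ_comb t g1 g2 : in_LQ g1 -> in_LQ g2 -> in_LQ (gcomb t g1 g2).
Proof.
move=> [m1 i1] [m2 i2]; have m := mfield_comb t m1 m2.
split; first exact: m.
apply: (le_integrable_lin mB (measurable_LQ_dens m) i1 i2) => x _.
rewrite ger0_norm ?LQ_dens_ge0//; exact: LQ_dens_comb.
Qed.

Lemma Lp_pow_comb t u1 u2 : in_Lp u1 -> in_Lp u2 ->
  Lp_pow (ucomb t u1 u2) <= 2 `^ p * (Lp_pow u1 + `|t| `^ p * Lp_pow u2).
Proof.
move=> o1 o2; rewrite mulrDr mulrA.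
apply: (le_Rintegral_lin mB (in_Lp_comb t o1 o2).2 o1.2 o2.2) => x _.
exact: Lp_dens_comb.
Qed.

Lemma LQ_pow_comb t g1 g2 : in_LQ g1 -> in_LQ g2 ->
  LQ_pow (gcomb t g1 g2) <= 2 `^ p * (LQ_pow g1 + `|t| `^ p * LQ_pow g2).
Proof.
move=> o1 o2; rewrite mulrDr mulrA.
apply: (le_Rintegral_lin mB (in_LQ_comb t o1 o2).2 o1.2 o2.2) => x _.
exact: LQ_dens_comb.
Qed.

Lemma in_LQ_eq g1 g2 : (forall x, B x -> g1 x = g2 x) -> in_LQ g1 -> in_LQ g2.
Proof.
move=> g12 [m1 i1]; split.
  by move=> i; apply: eq_measurable_fun (m1 i) => x; rewrite inE => /g12 ->.
apply: eq_integrable i1; first exact: mB.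
by move=> x; rewrite inE => /g12 h; rewrite /= /LQ_dens h.
Qed.

Lemma LQ_pow_eq g1 g2 : (forall x, B x -> g1 x = g2 x) -> LQ_pow g1 = LQ_pow g2.
Proof. by move=> g12; apply: eq_Rintegral => x; rewrite inE => /g12 h; rewrite /LQ_dens h. Qed.

Lemma grad_comb t phi1 phi2 x : differentiable phi1 x -> differentiable phi2 x ->
  grad (ucomb t phi1 phi2) x = gcomb t (grad phi1) (grad phi2) x.
Proof.
move=> d1 d2; apply/matrixP => i j; rewrite !mxE.
have -> : ucomb t phi1 phi2 = phi1 + t \*: phi2 by apply/funext.
rewrite deriveD; [|exact: diff_derivable|by apply: derivableZ; exact: diff_derivable].
by rewrite deriveZ//; exact: diff_derivable.
Qed.

Lemma C1_comb t phi1 phi2 : C1_closure B phi1 -> C1_closure B phi2 ->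
  C1_closure B (ucomb t phi1 phi2).
Proof.
move=> [c1 d1 [G1 [cG1 G1E]]] [c2 d2 [G2 [cG2 G2E]]]; split.
- move=> x; apply: cvgD; first exact: c1.
  by apply: cvgM; [exact: cvg_cst|exact: c2].
- move=> x Bx; have -> : ucomb t phi1 phi2 = phi1 + t \*: phi2 by apply/funext.
  by apply: differentiableD; [exact: d1|apply: differentiableZ; exact: d2].
- exists (gcomb t G1 G2); split.
    move=> x; apply: cvgD; first exact: cG1.
    by apply: cvgZ; [exact: cvg_cst|exact: cG2].
  by move=> x Bx; rewrite grad_comb ?/gcomb ?G1E ?G2E//; [exact: d1|exact: d2].
Qed.

Lemma C1_in_Lp phi : C1_closure B phi -> in_Lp phi.
Proof.
move=> C1; have [M M0 phiM] := C1_closure_bounded C1.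
have iMv : lebesgue.-integrable B (EFin \o (fun x => M `^ p * v x)).
  exact: (integrableZl mB (M `^ p) vB).
apply: (le_in_Lp (measurable_C1_closure C1) iMv) => x Bx.
by rewrite ler_wpM2r// powR_le ?(ltW p0)//; exact: phiM.
Qed.

Lemma C1_mfield phi : C1_closure B phi -> mfield (grad phi).
Proof. by move=> C1 i; exact: measurable_grad_coord. Qed.

Lemma grad_comb_in t phi1 phi2 : C1_closure B phi1 -> C1_closure B phi2 ->
  forall x, B x -> gcomb t (grad phi1) (grad phi2) x = grad (ucomb t phi1 phi2) x.
Proof. by move=> [_ d1 _] [_ d2 _] x Bx; rewrite grad_comb//; [exact: d1|exact: d2]. Qed.

Lemma in_Lp_integrable u : in_Lp u -> lebesgue.-integrable B (EFin \o (fun x => u x * v x)).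
Proof.
move=> [mu iu].
apply: (le_integrable mB _ _ (integrableD mB vB iu)).
  by apply/measurable_EFinP; exact: measurable_funM.
move=> x Bx /=; rewrite lee_fin normrM (ger0_norm (v0 x)) [leRHS]ger0_norm ?addr_ge0 ?Lp_dens_ge0//.
rewrite /Lp_dens -[X in X + _]mul1r -mulrDl ler_wpM2r//.
have := @young_le _ 1 `|u x| p 1 (ltW p1) ler01 (normr_ge0 _) ltr01.
by rewrite !powR1 !mul1r.
Qed.

Lemma integral_comb t u1 u2 : in_Lp u1 -> in_Lp u2 ->
  \int[lebesgue]_(x in B) (ucomb t u1 u2 x * v x) =
  \int[lebesgue]_(x in B) (u1 x * v x) + t * \int[lebesgue]_(x in B) (u2 x * v x).
Proof.
move=> /in_Lp_integrable i1 /in_Lp_integrable i2.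
rewrite -[X in X + _]mul1r -(Rintegral_lin mB 1 t i1 i2).
by apply: eq_Rintegral => x _; rewrite /ucomb; ring.
Qed.

Definition test_space phi :=
  [/\ C1_closure B phi, in_LQ (grad phi) & \int[lebesgue]_(x in B) (phi x * v x) = 0].

Lemma test_comb t phi1 phi2 : test_space phi1 -> test_space phi2 ->
  test_space (ucomb t phi1 phi2).
Proof.
move=> [C1 o1 i1] [C2 o2 i2]; split; first exact: C1_comb.
  by apply: in_LQ_eq (in_LQ_comb t o1 o2); exact: grad_comb_in.
by rewrite integral_comb ?i1 ?i2 ?mulr0 ?addr0//; exact: C1_in_Lp.
Qed.

(** * The two sides of the weak equation and their convexity *)

Definition source_dens f u x := `|f x| `^ (p - 2) * f x * u x * v x.
Definition source f u : R := \int[lebesgue]_(x in B) source_dens f u x.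

Lemma measurable_source_dens f u : measurable_fun B f -> measurable_fun B u -> measurable_fun B (source_dens f u).
Proof.
move=> mf mu.
have mp : measurable_fun B (fun x => `|f x| `^ (p - 2)).
  exact: (measurableT_comp (measurable_powR _) (measurableT_comp (@normr_measurable R setT) mf)).
exact: (measurable_funM (measurable_funM (measurable_funM mp mf) mu) mv).
Qed.

Lemma source_dens_le e f u x : 0 < e -> `|source_dens f u x| <= e * Lp_dens f x + e `^ (1 - p) * Lp_dens u x.
Proof.
move=> e0; rewrite /source_dens /Lp_dens !mulrA -mulrDl normrM (ger0_norm (v0 x)) ler_wpM2r//.
rewrite !normrM (ger0_norm (powR_ge0 _ _)).
have -> : `|f x| `^ (p - 2) * `|f x| = `|f x| `^ (p - 1).
  have [->|f0] := eqVneq (f x) 0; first by rewrite normr0 mulr0 powR0// gt_eqF// subr_gt0.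
  rewrite -[X in _ * X](powRr1 (normr_ge0 _)) -powRD; last by rewrite normr_eq0 f0 implybT.
  by congr (_ `^ _); ring.
exact: (young_le (ltW p1)).
Qed.

Lemma source_dens_integrable f u : in_Lp f -> in_Lp u -> lebesgue.-integrable B (EFin \o source_dens f u).
Proof.
move=> [mf jf] [mu ju]; apply: (le_integrable_lin mB (measurable_source_dens mf mu) jf ju) => x _.
exact: (source_dens_le f u x ltr01).
Qed.

Lemma source_le e f u : 0 < e -> in_Lp f -> in_Lp u -> `|source f u| <= e * Lp_pow f + e `^ (1 - p) * Lp_pow u.
Proof.
move=> e0 of_ ou.
apply: (normr_Rintegral_lin mB (source_dens_integrable of_ ou) of_.2 ou.2) => x _.
exact: source_dens_le.
Qed.

Lemma source_comb f t u1 u2 : in_Lp f -> in_Lp u1 -> in_Lp u2 ->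
  source f (ucomb t u1 u2) = source f u1 + t * source f u2.
Proof.
move=> of_ o1 o2.
rewrite -[X in X + _]mul1r -(Rintegral_lin mB 1 t (source_dens_integrable of_ o1) (source_dens_integrable of_ o2)).
by apply: eq_Rintegral => x _; rewrite /source_dens /ucomb; ring.
Qed.

Definition flux_dens g1 g2 x := enorm (S x *m g1 x) `^ (p - 2) * mdot (S x *m g1 x) (S x *m g2 x).
Definition flux g1 g2 : R := \int[lebesgue]_(x in B) flux_dens g1 g2 x.

Lemma measurable_flux_dens g1 g2 : mfield g1 -> mfield g2 -> measurable_fun B (flux_dens g1 g2).
Proof.
move=> m1 m2; apply: measurable_funM; last exact: measurable_mdotS.
by apply: (measurableT_comp (measurable_powR _)); exact: measurable_enormS.
Qed.

Lemma flux_dens_le e g1 g2 x : 0 < e -> `|flux_dens g1 g2 x| <= e * LQ_dens g1 x + e `^ (1 - p) * LQ_dens g2 x.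
Proof.
move=> e0; apply: le_trans (powR_sub2_mdot _ _ p1) _.
by apply: (young_le (ltW p1)) => //; exact: enorm_ge0.
Qed.

Lemma flux_dens_integrable g1 g2 : in_LQ g1 -> in_LQ g2 -> lebesgue.-integrable B (EFin \o flux_dens g1 g2).
Proof.
move=> [m1 i1] [m2 i2]; apply: (le_integrable_lin mB (measurable_flux_dens m1 m2) i1 i2) => x _.
exact: (flux_dens_le g1 g2 x ltr01).
Qed.

Lemma flux_le e g1 g2 : 0 < e -> in_LQ g1 -> in_LQ g2 ->
  `|flux g1 g2| <= e * LQ_pow g1 + e `^ (1 - p) * LQ_pow g2.
Proof.
move=> e0 o1 o2.
apply: (normr_Rintegral_lin mB (flux_dens_integrable o1 o2) o1.2 o2.2) => x _.
exact: flux_dens_le.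
Qed.

Lemma flux_comb t g g1 g2 : in_LQ g -> in_LQ g1 -> in_LQ g2 ->
  flux g (gcomb t g1 g2) = flux g g1 + t * flux g g2.
Proof.
move=> o o1 o2.
rewrite -[X in X + _]mul1r -(Rintegral_lin mB 1 t (flux_dens_integrable o o1) (flux_dens_integrable o o2)).
apply: eq_Rintegral => x _.
by rewrite /flux_dens /gcomb mulmxDr -scalemxAr mdotDr mdotZr; ring.
Qed.

Lemma flux_diag g : flux g g = LQ_pow g.
Proof.
by apply: eq_Rintegral => x _; rewrite /flux_dens -sqr_enorm expr2 powR_sub2M// enorm_ge0.
Qed.

Lemma LQ_pow_convex t g1 g2 : 0 < t -> in_LQ g1 -> in_LQ g2 ->
  LQ_pow (gcomb t g1 g2) - LQ_pow g1 <= t * (p * flux (gcomb t g1 g2) g2).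
Proof.
move=> t0 o1 o2; have oc := in_LQ_comb t o1 o2.
rewrite lerBlDl -[X in X + _]mul1r mulrA.
apply: (le_Rintegral_lin mB oc.2 o1.2 (flux_dens_integrable oc o2)) => x _.
rewrite mul1r -lerBlDl -mulrA /LQ_dens /flux_dens /gcomb mulmxDr -scalemxAr.
exact: enorm_powR_convex.
Qed.

(** The midpoint, written as [g1 + (g2 - g1)/2] to match the nested [ucomb] of test functions of
    which it is the gradient. *)
Definition gmid g1 g2 := gcomb 2^-1 g1 (gcomb (-1) g2 g1).

Lemma LQ_pow_uniform_convexity e : 0 < e -> exists2 C, 0 < C & forall g1 g2, in_LQ g1 -> in_LQ g2 ->
  LQ_pow (gcomb (-1) g1 g2) <= e * (LQ_pow g1 + LQ_pow g2) + C * ((LQ_pow g1 + LQ_pow g2) / 2 - LQ_pow (gmid g1 g2)).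
Proof.
move=> e0; have [C C0 H] := @enorm_uniform_convexity R p e n.+1 1 p1 e0.
exists C => // g1 g2 o1 o2.
have om : in_LQ (gmid g1 g2) := in_LQ_comb _ o1 (in_LQ_comb _ o2 o1).
have od : in_LQ (gcomb (-1) g1 g2) := in_LQ_comb _ o1 o2.
have o12 := integrable_lin mB (e + C / 2) (e + C / 2) o1.2 o2.2.
have -> : e * (LQ_pow g1 + LQ_pow g2) + C * ((LQ_pow g1 + LQ_pow g2) / 2 - LQ_pow (gmid g1 g2)) =
    1 * ((e + C / 2) * LQ_pow g1 + (e + C / 2) * LQ_pow g2) + (- C) * LQ_pow (gmid g1 g2).
  by move: (LQ_pow _) (LQ_pow _) (LQ_pow _) => a b c; field.
rewrite /LQ_pow -(Rintegral_lin mB _ _ o1.2 o2.2).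
apply: (le_Rintegral_lin mB od.2 o12 om.2) => x _.
have := H (S x *m g1 x) (S x *m g2 x).
have -> : S x *m g1 x - S x *m g2 x = S x *m gcomb (-1) g1 g2 x.
  by rewrite /gcomb scaleN1r mulmxBr.
have -> : 2^-1 *: (S x *m g1 x + S x *m g2 x) = S x *m gmid g1 g2 x.
  rewrite -mulmxDr scalemxAr; congr (_ *m _).
  by apply/matrixP => i j; rewrite /gmid /gcomb !mxE; field.
rewrite -/(LQ_dens g1 x) -/(LQ_dens g2 x) -/(LQ_dens _ x) -/(LQ_dens _ x) => h; apply: (le_trans h).
rewrite le_eqVlt; apply/orP; left; apply/eqP.
by move: (LQ_dens _ _) (LQ_dens _ _) (LQ_dens _ _) => a b c; field.
Qed.

(** * Completeness and pointwise convergence *)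

Let half0 : 0 <= 2^-1 :> R. Proof. by rewrite invr_ge0. Qed.

(** Increments whose p-th powers are of order [2^-k] are themselves of order [tau^k]. *)
Let tau : R := 2^-1 `^ p^-1.

Let tau01 : 0 <= tau < 1.
Proof.
rewrite powR_ge0/=; have e1 : 1 `^ p^-1 = 1 :> R by rewrite powR1.
rewrite -[ltRHS]e1; apply: gt0_ltr_powR; rewrite ?invr_gt0// ?nnegrE//.
by rewrite invf_lt1// ltr1n.
Qed.

Let tauX k (z : R) : 0 <= z -> (2 ^- k * z) `^ p^-1 = z `^ p^-1 * tau ^+ k.
Proof.
move=> z0; rewrite powRM ?invr_ge0 ?exprn_ge0// mulrC; congr (_ * _).
rewrite -exprVn -(powR_mulrn k half0) powRAC (powR_mulrn k (powR_ge0 _ _)).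
exact: erefl.
Qed.

Let tauXp k (c z : R) : 0 <= c -> 0 <= z ->
  (z `^ p^-1 / (1 - tau) * tau ^+ k * c) `^ p = ((1 - tau) `^ p)^-1 * 2 ^- k * z * c `^ p.
Proof.
move=> c0 z0; have /andP[t0 t1] := tau01; have t1' : 0 <= 1 - tau by rewrite subr_ge0 ltW.
rewrite !powRM ?mulr_ge0 ?invr_ge0 ?exprn_ge0 ?powR_ge0// powRVK ?gt_eqF//.
rewrite -[(1 - tau)^-1]powR_inv1// powRAC powR_inv1 ?powR_ge0//.
rewrite -(powR_mulrn k t0) powRAC (powRVK (lt0r_neq0 p0) half0) (powR_mulrn k half0) exprVn.
by rewrite mulrC [in RHS]mulrC; ring.
Qed.

(** The increments of [phi] are controlled through [v x > 0] and those of [G] through [w x > 0] and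
    the lower bound on [|S x xi|], so both sequences converge geometrically at [x]. The final bounds
    use the increments of [S x *m G k] directly and restore the factor [v x], so that no inverse of
    a weight is left beside [Z]. *)
Lemma pointwise_limit (x : E) (phi : nat -> R) (G : nat -> 'cV[R]_n.+1) (Z : R) :
  B x -> 0 < w x -> 0 < v x -> 0 <= Z ->
  (forall xi : 'cV[R]_n.+1, w x * enorm xi `^ p <= enorm (S x *m xi) `^ p) ->
  (forall k, `|phi k - phi k.+1| `^ p * v x + enorm (S x *m (G k - G k.+1)) `^ p <= 2 ^- k * Z) ->
  let u := ulim phi in let g := (\col_i ulim (fun k => G k i ord0) : 'cV[R]_n.+1) in
  [/\ forall i, G k i ord0 @[k --> \oo] --> g i ord0,
   forall k, `|phi k - u| `^ p * v x <= ((1 - tau) `^ p)^-1 * 2 ^- k * Z &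
   forall k, enorm (S x *m (G k - g)) `^ p <= ((1 - tau) `^ p)^-1 * 2 ^- k * Z].
Proof.
move=> Bx wx vx Z0 deg HZ u g; have /andP[t0 t1] := tau01.
have HZ1 k : `|phi k - phi k.+1| `^ p * v x <= 2 ^- k * Z.
  by apply: le_trans (HZ k); rewrite lerDl powR_ge0.
have HZ2 k : enorm (S x *m (G k - G k.+1)) `^ p <= 2 ^- k * Z.
  by apply: le_trans (HZ k); rewrite lerDr mulr_ge0 ?powR_ge0// ltW.
have root (s c b : R) k : 0 < c -> 0 <= s -> s `^ p * c <= 2 ^- k * b -> 0 <= b ->
    s <= (b / c) `^ p^-1 * tau ^+ k.
  move=> c0 s0 h b0; have bc : 0 <= b / c by rewrite divr_ge0// ltW.
  rewrite -tauX// -[leLHS](powRKV (p := p)) ?gt_eqF//.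
  apply: powR_le; [by rewrite invr_ge0 ltW|exact: powR_ge0|].
  by rewrite mulrA ler_pdivlMr.
have dphi k : `|phi k.+1 - phi k| <= (Z / v x) `^ p^-1 * tau ^+ k.
  by rewrite distrC; exact: root.
have dG k : enorm (G k.+1 - G k) <= (Z / w x) `^ p^-1 * tau ^+ k.
  rewrite enormB_sym; apply: root => //; first exact: enorm_ge0.
  by rewrite mulrC; apply: le_trans (HZ2 k).
have dSG k : enorm (S x *m G k.+1 - S x *m G k) <= Z `^ p^-1 * tau ^+ k.
  rewrite -mulmxBr -(divr1 Z); apply: root => //; first exact: enorm_ge0.
  by rewrite mulr1 -enormN -mulmxN opprB.
have c1 : 0 <= (Z / v x) `^ p^-1 by exact: powR_ge0.
have c2 : 0 <= (Z / w x) `^ p^-1 by exact: powR_ge0.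
have [l ul] := geometric_increments c1 tau01 dphi.
have ue : u = l by exact: cvg_ulim.
have Gl i : G k i ord0 @[k --> \oo] --> g i ord0.
  have [k|li hi] := @geometric_increments _ (fun k => G k i ord0) _ _ c2 tau01.
    apply: le_trans (dG k); have := coord_le_enorm (G k.+1 - G k) i ord0.
    by rewrite !mxE.
  by rewrite mxE (cvg_ulim hi).
split => // k.
  have := increments_limit c1 tau01 ul dphi k; rewrite -ue => h.
  have h' : `|phi k - u| `^ p <= ((Z / v x) `^ p^-1 / (1 - tau) * tau ^+ k * 1) `^ p.
    by rewrite mulr1; apply: powR_le; [exact: ltW| |].
  apply: (@le_trans _ _ (((Z / v x) `^ p^-1 / (1 - tau) * tau ^+ k * 1) `^ p * v x)).
    by rewrite ler_wpM2r// ltW.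
  rewrite tauXp ?divr_ge0 ?(ltW vx)// powR1 mulr1 le_eqVlt; apply/orP; left; apply/eqP.
  by rewrite -[RHS]mulr1 -(mulfV (lt0r_neq0 vx)); ring.
have Gl' i j : G k i j @[k --> \oo] --> g i j by rewrite (ord1 j); exact: Gl.
have := enorm_increments_limit (powR_ge0 _ _) tau01 (mulmx_cvg (A := S x) Gl') dSG k.
rewrite -mulmxBr => h.
apply: (@le_trans _ _ ((Z `^ p^-1 / (1 - tau) * tau ^+ k * 1) `^ p)).
  by rewrite mulr1; apply: powR_le; [exact: ltW|exact: enorm_ge0|].
by rewrite tauXp// powR1 mulr1.
Qed.

Lemma ae_le_in_Lp (Z : E -> R) (c : R) u : measurable_fun B u -> 0 <= c -> (forall x, 0 <= Z x) ->
  lebesgue.-integrable B (EFin \o Z) ->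
  {ae lebesgue, forall x, B x -> Lp_dens u x <= c * Z x} ->
  in_Lp u /\ Lp_pow u <= c * \int[lebesgue]_(x in B) Z x.
Proof.
move=> mu c0 Z0 iZ uZ; have icZ := integrableZl mB c iZ.
have h : (\int[lebesgue]_(x in B) (Lp_dens u x)%:E <= \int[lebesgue]_(x in B) (c * Z x)%:E)%E.
  apply: (ae_ge0_le_integral mB).
  - by move=> x _; rewrite lee_fin Lp_dens_ge0.
  - exact/measurable_EFinP/measurable_Lp_dens.
  - by move=> x _; rewrite lee_fin mulr_ge0.
  - exact: (measurable_int _ icZ).
  - by apply: filterS uZ => x + Bx => /(_ Bx); rewrite lee_fin.
have hE : (\int[lebesgue]_(x in B) (c * Z x)%:E)%E = (c * \int[lebesgue]_(x in B) Z x)%:E.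
  rewrite -(RintegralZl c mB iZ) /Rintegral fineK//.
  exact: (integrable_fin_num mB icZ).
have ou : in_Lp u by apply: in_LpP => //; rewrite (le_lt_trans h)// hE ltry.
by split => //; rewrite -lee_fin -integral_Lp_pow// -hE.
Qed.

Lemma ae_le_in_LQ (Z : E -> R) (c : R) g : mfield g -> 0 <= c -> (forall x, 0 <= Z x) ->
  lebesgue.-integrable B (EFin \o Z) ->
  {ae lebesgue, forall x, B x -> LQ_dens g x <= c * Z x} ->
  in_LQ g /\ LQ_pow g <= c * \int[lebesgue]_(x in B) Z x.
Proof.
move=> mg c0 Z0 iZ uZ; have icZ := integrableZl mB c iZ.
have h : (\int[lebesgue]_(x in B) (LQ_dens g x)%:E <= \int[lebesgue]_(x in B) (c * Z x)%:E)%E.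
  apply: (ae_ge0_le_integral mB).
  - by move=> x _; rewrite lee_fin LQ_dens_ge0.
  - exact/measurable_EFinP/measurable_LQ_dens.
  - by move=> x _; rewrite lee_fin mulr_ge0.
  - exact: (measurable_int _ icZ).
  - by apply: filterS uZ => x + Bx => /(_ Bx); rewrite lee_fin.
have hE : (\int[lebesgue]_(x in B) (c * Z x)%:E)%E = (c * \int[lebesgue]_(x in B) Z x)%:E.
  rewrite -(RintegralZl c mB iZ) /Rintegral fineK//.
  exact: (integrable_fin_num mB icZ).
have og : in_LQ g by apply: in_LQP => //; rewrite (le_lt_trans h)// hE ltry.
by split => //; rewrite -lee_fin -integral_LQ_pow// -hE.
Qed.

Lemma ucombK u1 u2 : ucomb (-1) u1 (ucomb (-1) u1 u2) = u2.
Proof. by apply/funext => x; rewrite /ucomb; ring. Qed.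

Lemma gcombK g1 g2 : gcomb (-1) g1 (gcomb (-1) g1 g2) = g2.
Proof. by apply/funext => x; apply/matrixP => i j; rewrite /gcomb !mxE; ring. Qed.

(** Besides the limit, the extraction provides pointwise convergence of the fields and one
    integrable [Z] for the whole sequence: the two inputs of dominated convergence for the flux. *)
Lemma energy_complete (U : nat -> E -> R) (G : nat -> E -> 'cV[R]_n.+1) :
  (forall k, in_Lp (U k)) -> (forall k, in_LQ (G k)) ->
  (forall e, 0 < e -> exists N, forall j k, (N <= j)%N -> (N <= k)%N ->
    Lp_pow (ucomb (-1) (U j) (U k)) + LQ_pow (gcomb (-1) (G j) (G k)) <= e) ->
  exists (s : nat -> nat) u g (Z : E -> R) (K : R), [/\ forall k, (k <= s k)%N,
    in_Lp u /\ in_LQ g, lebesgue.-integrable B (EFin \o Z),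
    forall k, Lp_pow (ucomb (-1) (U (s k)) u) <= K * 2 ^- k /\
      LQ_pow (gcomb (-1) (G (s k)) g) <= K * 2 ^- k &
    {ae lebesgue, forall x, B x -> (forall i, G (s k) x i ord0 @[k --> \oo] --> g x i ord0) /\
      forall k, LQ_dens (gcomb (-1) (G (s k)) g) x <= Z x}].
Proof.
move=> oU oG HC.
have oUU j k := in_Lp_comb (-1) (oU j) (oU k).
have oGG j k := in_LQ_comb (-1) (oG j) (oG k).
pose H j k x := Lp_dens (ucomb (-1) (U j) (U k)) x + LQ_dens (gcomb (-1) (G j) (G k)) x.
have mH j k : measurable_fun B (H j k).
  exact: (measurable_funD (measurable_Lp_dens (oUU j k).1) (measurable_LQ_dens (oGG j k).1)).
have H0 j k x : 0 <= H j k x by rewrite addr_ge0 ?Lp_dens_ge0 ?LQ_dens_ge0.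
have HC' e : 0 < e -> exists N, forall j k, (N <= j)%N -> (N <= k)%N ->
    (\int[lebesgue]_(x in B) (H j k x)%:E <= e%:E)%E.
  move=> /HC[N HN]; exists N => j k Nj Nk.
  rewrite (eq_integral (fun x => (Lp_dens (ucomb (-1) (U j) (U k)) x)%:E +
      (LQ_dens (gcomb (-1) (G j) (G k)) x)%:E)%E); last by move=> x _; rewrite EFinD.
  rewrite (ge0_integralD _ mB); first last.
  - exact/measurable_EFinP/(measurable_LQ_dens (oGG j k).1).
  - by move=> x _; rewrite lee_fin LQ_dens_ge0.
  - exact/measurable_EFinP/(measurable_Lp_dens (oUU j k).1).
  - by move=> x _; rewrite lee_fin Lp_dens_ge0.
  by rewrite (integral_Lp_pow (oUU j k)) (integral_LQ_pow (oGG j k)) -EFinD lee_fin; exact: HN.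
have [s [Z [sk Z0 iZ HZ]]] := fast_subsequence mB mH H0 HC'.
pose u x := ulim (fun k => U (s k) x).
pose g x := (\col_i ulim (fun k => G (s k) x i ord0) : 'cV[R]_n.+1).
have mu : measurable_fun B u := measurable_ulim (fun k => (oU (s k)).1).
have mg : mfield g.
  move=> i; rewrite (_ : (fun x => g x i ord0) = fun x => ulim (fun k => G (s k) x i ord0)).
    exact: (measurable_ulim (fun k => (oG (s k)).1 i)).
  by apply/funext => x; rewrite mxE.
pose c k : R := ((1 - tau) `^ p)^-1 * 2 ^- k.
have c0 k : 0 <= c k by rewrite mulr_ge0 ?invr_ge0 ?powR_ge0// exprn_ge0.
have main : {ae lebesgue, forall x, B x ->
    [/\ forall i, G (s k) x i ord0 @[k --> \oo] --> g x i ord0,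
     forall k, Lp_dens (ucomb (-1) (U (s k)) u) x <= c k * Z x &
     forall k, LQ_dens (gcomb (-1) (G (s k)) g) x <= c k * Z x]}.
  have wvd : {ae lebesgue, forall x, 0 < w x /\ 0 < v x}.
    by apply: filterS2 w_gt0 v_gt0 => x; split.
  apply: filterS3 HZ degenerate wvd => x HZx degx [wx vx] Bx.
  have [k|h1 h2 h3] := @pointwise_limit x (fun k => U (s k) x) (fun k => G (s k) x) (Z x)
      Bx wx vx (Z0 x) (degx Bx).
    have k0 : 0 < 2 ^+ k :> R by rewrite exprn_gt0.
    have hE : H (s k) (s k.+1) x = `|U (s k) x - U (s k.+1) x| `^ p * v x +
        enorm (S x *m (G (s k) x - G (s k.+1) x)) `^ p.
      by rewrite /H /Lp_dens /LQ_dens /ucomb /gcomb scaleN1r mulN1r.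
    rewrite -hE mulrC (ler_pdivlMr _ _ k0) mulrC; exact: HZx.
  split=> [|k|k]; first exact: h1.
    by rewrite /Lp_dens /ucomb mulN1r; exact: h2.
  by rewrite /LQ_dens /gcomb scaleN1r; exact: h3.
have hv k : {ae lebesgue, forall x, B x -> Lp_dens (ucomb (-1) (U (s k)) u) x <= c k * Z x}.
  by apply: filterS main => x + Bx => /(_ Bx) [].
have hq k : {ae lebesgue, forall x, B x -> LQ_dens (gcomb (-1) (G (s k)) g) x <= c k * Z x}.
  by apply: filterS main => x + Bx => /(_ Bx) [].
have mUu k : measurable_fun B (ucomb (-1) (U (s k)) u).
  exact: (measurable_funD (oU (s k)).1 (measurable_funM (measurable_cst _) mu)).
have V1 k := ae_le_in_Lp (mUu k) (c0 k) Z0 iZ (hv k).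
have V2 k := ae_le_in_LQ (mfield_comb (-1) (oG (s k)).1 mg) (c0 k) Z0 iZ (hq k).
exists s, u, g, (fun x => c 0%N * Z x), (((1 - tau) `^ p)^-1 * \int[lebesgue]_(x in B) Z x).
split; first exact: sk.
- split; first by rewrite -(ucombK (U (s 0%N)) u); exact: (in_Lp_comb _ (oU _) (V1 0%N).1).
  by rewrite -(gcombK (G (s 0%N)) g); exact: (in_LQ_comb _ (oG _) (V2 0%N).1).
- exact: (integrableZl mB (c 0%N) iZ).
- by move=> k; rewrite mulrAC; split; [exact: (V1 k).2|exact: (V2 k).2].
- apply: filterS main => x + Bx => /(_ Bx) [h1 _ h3]; split => // k.
  apply: le_trans (h3 k) _; apply: ler_wpM2r; first exact: Z0.
  rewrite /c ler_wpM2l ?invr_ge0 ?powR_ge0// expr0 invr1.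
  by rewrite invf_le1 ?exprn_gt0// exprn_ege1// ler1n.
Qed.

(** First [e] is taken to make [e * A] small, then [k] large. This turns the Young bounds on
    [source] and [flux] into continuity in the second argument. *)
Lemma young_cvg0 (X b : nat -> R) (A : R) : 0 <= A ->
  (forall e k, 0 < e -> `|X k| <= e * A + e `^ (1 - p) * b k) ->
  b k @[k --> \oo] --> 0 -> X k @[k --> \oo] --> 0.
Proof.
move=> A0 XA /cvgr0Pnorm_lt b0; apply/cvgr0Pnorm_lt => e e0.
have [d d0 dA] : exists2 d, 0 < d & d * A <= e / 2.
  exists (e / 2 / (A + 1)); first by rewrite !divr_gt0// ltr_wpDl.
  rewrite mulrAC ler_pdivrMr ?ltr_wpDl// ler_pM2l ?divr_gt0//; lra.
have q0 : 0 < d `^ (1 - p) by exact: powR_gt0.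
have := b0 _ (divr_gt0 (divr_gt0 e0 (ltr0Sn R 1)) q0); apply: filterS => k bk.
apply: (le_lt_trans (XA d k d0)); rewrite (splitr e); apply: (ler_ltD dA).
rewrite mulrC -(ltr_pdivlMr _ _ q0); exact: (le_lt_trans (ler_norm _) bk).
Qed.

Lemma C1_cst (c : R) : C1_closure B (fun=> c) /\ forall x, grad (fun=> c) x = 0 :> 'cV[R]_n.+1.
Proof.
have gc x : grad (fun=> c) x = 0 :> 'cV[R]_n.+1.
  by apply/matrixP => i j; rewrite !mxE derive_cst.
split=> //; split; first exact: cst_continuous.
  by move=> x _; exact: differentiable_cst.
by exists (fun=> 0); split=> //; exact: cst_continuous.
Qed.

Lemma in_LQ0 : in_LQ (fun=> 0).
Proof.
split=> [i|]; first by under eq_fun do rewrite mxE; exact: measurable_cst.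
apply: (eq_integrable mB (fun=> 0%E)); last exact: integrable0.
by move=> x _; rewrite /= /LQ_dens mulmx0 enorm0 powR0 ?gt_eqF.
Qed.

Lemma LQ_pow0 : LQ_pow (fun=> 0) = 0.
Proof.
rewrite /LQ_pow /LQ_dens; under eq_Rintegral do rewrite mulmx0 enorm0 powR0 ?gt_eqF//.
by rewrite /Rintegral integral0.
Qed.

Lemma in_Lp_cst (c : R) : in_Lp (fun=> c). Proof. exact: C1_in_Lp (C1_cst c).1. Qed.

Lemma source1 u : source (fun=> 1) u = \int[lebesgue]_(x in B) (u x * v x).
Proof. by apply: eq_Rintegral => x _; rewrite /source_dens normr1 powR1 !mul1r. Qed.

Lemma source_cvg f (u_ : nat -> E -> R) u : in_Lp f -> (forall k, in_Lp (u_ k)) -> in_Lp u ->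
  Lp_pow (ucomb (-1) (u_ k) u) @[k --> \oo] --> 0 -> source f (u_ k) @[k --> \oo] --> source f u.
Proof.
move=> of_ ou_ ou c0; apply/subr_cvg0; apply: (young_cvg0 (Lp_pow_ge0 f) _ c0) => e k e0.
have := source_le e0 of_ (in_Lp_comb (-1) (ou_ k) ou).
by rewrite (source_comb (-1) of_ (ou_ k) ou) mulN1r; apply.
Qed.

Lemma flux_cvg g (g_ : nat -> E -> 'cV[R]_n.+1) h : in_LQ g -> (forall k, in_LQ (g_ k)) -> in_LQ h ->
  LQ_pow (gcomb (-1) (g_ k) h) @[k --> \oo] --> 0 -> flux g (g_ k) @[k --> \oo] --> flux g h.
Proof.
move=> og og_ oh c0; apply/subr_cvg0; apply: (young_cvg0 (LQ_pow_ge0 g) _ c0) => e k e0.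
have := flux_le e0 og (in_LQ_comb (-1) (og_ k) oh).
by rewrite (flux_comb (-1) og (og_ k) oh) mulN1r; apply.
Qed.

(** * Approximation by C^1 functions *)

Definition approx (phi : nat -> E -> R) u g :=
  [/\ (forall k : nat, C1_closure B (phi k) /\ in_LQ (grad (phi k))), in_Lp u /\ in_LQ g,
    Lp_pow (ucomb (-1) (phi k) u) @[k --> \oo] --> 0 &
    LQ_pow (gcomb (-1) (grad (phi k)) g) @[k --> \oo] --> 0].

(** Norms and their p-th powers tend to zero together, and the Cauchy condition of [H1] follows from
    the convergence to [(u, g)]. *)
Lemma H1_approx u g : H1 p v Q B u g <-> exists phi : nat -> E -> R, approx phi u g.
Proof.
have sE (f1 f2 : E -> R) : f1 \- f2 = ucomb (-1) f1 f2.
  by apply/funext => x; rewrite /ucomb mulN1r.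
have gE (f1 f2 : E -> 'cV[R]_n.+1) : f1 \- f2 = gcomb (-1) f1 f2.
  by apply/funext => x; rewrite /gcomb scaleN1r.
have ip0 : 0 < p^-1 by rewrite invr_gt0.
split.
- move=> [/LpP ou /LQP og [phi [fin _ cu cg]]].
  have C1k k : C1_closure B (phi k) := (fin k).1.
  have okk k : in_LQ (grad (phi k)).
    apply/LQP; split; first exact: C1_mfield (C1k k).
    apply: le_lt_trans (fin k).2; rewrite /H1_norm leeDr// (Lp_norm_in_Lp (C1_in_Lp (C1k k))).
    by rewrite lee_fin powR_ge0.
  exists phi; split.
  + by move=> k; split; [exact: C1k|exact: okk].
  + by split.
  + have o k := in_Lp_comb (-1) (C1_in_Lp (C1k k)) ou.
    suff h : (Lp_pow (ucomb (-1) (phi k) u) `^ p^-1) `^ p @[k --> \oo] --> 0.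
      by apply: cvg_trans h; apply: near_eq_cvg; apply: nearW => k; rewrite powRVK ?Lp_pow_ge0 ?gt_eqF.
    apply: (@cvg_powR0 _ (fun k => Lp_pow (ucomb (-1) (phi k) u) `^ p^-1) p p0) => [k|]; first exact: powR_ge0.
    have : (Lp_pow (ucomb (-1) (phi k) u) `^ p^-1)%:E @[k --> \oo] --> 0%:E.
      by apply: cvg_trans cu; apply: near_eq_cvg; apply: nearW => k; rewrite sE (Lp_norm_in_Lp (o k)).
    by move/fine_cvgP => [_].
  + have o k := in_LQ_comb (-1) (okk k) og.
    suff h : (LQ_pow (gcomb (-1) (grad (phi k)) g) `^ p^-1) `^ p @[k --> \oo] --> 0.
      by apply: cvg_trans h; apply: near_eq_cvg; apply: nearW => k; rewrite powRVK ?LQ_pow_ge0 ?gt_eqF.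
    apply: (@cvg_powR0 _ (fun k => LQ_pow (gcomb (-1) (grad (phi k)) g) `^ p^-1) p p0) => [k|]; first exact: powR_ge0.
    have : (LQ_pow (gcomb (-1) (grad (phi k)) g) `^ p^-1)%:E @[k --> \oo] --> 0%:E.
      by apply: cvg_trans cg; apply: near_eq_cvg; apply: nearW => k; rewrite gE (LQ_norm_in_LQ (o k)).
    by move/fine_cvgP => [_].
- move=> [phi [ok_phi [ou og] cu cg]].
  have ov k := C1_in_Lp (ok_phi k).1; have oq k := (ok_phi k).2.
  have ovu k := in_Lp_comb (-1) (ov k) ou; have oqg k := in_LQ_comb (-1) (oq k) og.
  split; [exact/LpP|exact/LQP|exists phi; split].
  + move=> k; split; first exact: (ok_phi k).1.
    by rewrite /H1_norm (Lp_norm_in_Lp (ov k)) (LQ_norm_in_LQ (oq k)) -EFinD ltry.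
  + pose a k := Lp_pow (ucomb (-1) (phi k) u); pose b k := LQ_pow (gcomb (-1) (grad (phi k)) g).
    have jk j k : H1_norm p v Q B (phi j \- phi k)
        = (Lp_pow (ucomb (-1) (phi j) (phi k)) `^ p^-1
          + LQ_pow (gcomb (-1) (grad (phi j)) (grad (phi k))) `^ p^-1)%:E.
      have gjk := grad_comb_in (-1) (ok_phi j).1 (ok_phi k).1.
      have oqjk : in_LQ (grad (ucomb (-1) (phi j) (phi k))).
        exact: in_LQ_eq gjk (in_LQ_comb (-1) (oq j) (oq k)).
      rewrite /H1_norm sE (Lp_norm_in_Lp (in_Lp_comb (-1) (ov j) (ov k))) (LQ_norm_in_LQ oqjk).
      by rewrite (LQ_pow_eq gjk) EFinD.
    have abjk j k : Lp_pow (ucomb (-1) (phi j) (phi k)) <= 2 `^ p * (a j + a k) /\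
        LQ_pow (gcomb (-1) (grad (phi j)) (grad (phi k))) <= 2 `^ p * (b j + b k).
      split.
        have -> : ucomb (-1) (phi j) (phi k) =
            ucomb (-1) (ucomb (-1) (phi j) u) (ucomb (-1) (phi k) u).
          by apply/funext => x; rewrite /ucomb; ring.
        by have := Lp_pow_comb (-1) (ovu j) (ovu k); rewrite normrN1 powR1 mul1r.
      have -> : gcomb (-1) (grad (phi j)) (grad (phi k)) =
          gcomb (-1) (gcomb (-1) (grad (phi j)) g) (gcomb (-1) (grad (phi k)) g).
        by apply/funext => x; rewrite /gcomb !scaleN1r opprB addrA addrNK.
      by have := LQ_pow_comb (-1) (oqg j) (oqg k); rewrite normrN1 powR1 mul1r.
    move=> e e0; have [d d0 dE] : exists2 d, 0 < d & (2 `^ p * (d + d)) `^ p^-1 < e / 2.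
      exists ((e / 4) `^ p / 2 `^ p / 2); first by rewrite !divr_gt0 ?powR_gt0 ?divr_gt0.
      rewrite -splitr mulrCA divff ?mulr1 ?gt_eqF ?powR_gt0//.
      rewrite powRKV ?gt_eqF ?divr_ge0 ?(ltW e0)//; lra.
    have [N1 _ HN1] := (cvgr0Pnorm_lt _).1 cu d d0.
    have [N2 _ HN2] := (cvgr0Pnorm_lt _).1 cg d d0.
    exists (maxn N1 N2) => j k; rewrite !geq_max => /andP[j1 j2] /andP[k1 k2].
    have [h1 h2] := abjk j k.
    have m1 := le_lt_trans (ler_norm _) (HN1 j j1); have m2 := le_lt_trans (ler_norm _) (HN1 k k1).
    have m3 := le_lt_trans (ler_norm _) (HN2 j j2); have m4 := le_lt_trans (ler_norm _) (HN2 k k2).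
    have t0 : 0 <= 2 `^ p :> R by exact: powR_ge0.
    rewrite jk lte_fin (splitr e); apply: ltrD; apply: le_lt_trans dE; apply: ge0_ler_powR;
      rewrite ?nnegrE ?(ltW ip0) ?Lp_pow_ge0 ?LQ_pow_ge0 ?(mulr_ge0 t0 (addr_ge0 (ltW d0) (ltW d0)))//.
      exact: le_trans h1 (ler_wpM2l t0 (lerD (ltW m1) (ltW m2))).
    exact: le_trans h2 (ler_wpM2l t0 (lerD (ltW m3) (ltW m4))).
  + rewrite (_ : (fun k => _) = fun k => (Lp_pow (ucomb (-1) (phi k) u) `^ p^-1)%:E); last first.
      by apply/funext => k; rewrite sE (Lp_norm_in_Lp (ovu k)).
    apply: cvg_EFin; first exact: nearW.
    by apply: (@cvg_powR0 _ (fun k => Lp_pow (ucomb (-1) (phi k) u)) _ ip0) => [k|]; [exact: Lp_pow_ge0|exact: cu].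
  + rewrite (_ : (fun k => _) = fun k => (LQ_pow (gcomb (-1) (grad (phi k)) g) `^ p^-1)%:E); last first.
      by apply/funext => k; rewrite gE (LQ_norm_in_LQ (oqg k)).
    apply: cvg_EFin; first exact: nearW.
    by apply: (@cvg_powR0 _ (fun k => LQ_pow (gcomb (-1) (grad (phi k)) g)) _ ip0) => [k|]; [exact: LQ_pow_ge0|exact: cg].
Qed.

(** Since [phi] has [v]-mean zero, the integral of [(phi - c) v] is [- c v(B)]. Young's inequality
    with [e = |c|/2] then gives [e^p v(B) <= Lp_pow (phi - c)]. So the unspecified constant of the
    Poincaré inequality can be replaced by the mean. *)
Lemma Lp_pow_center c phi : in_Lp phi -> \int[lebesgue]_(x in B) (phi x * v x) = 0 ->
  Lp_pow phi <= 2 `^ p * (1 + 2 `^ p) * Lp_pow (ucomb (- c) phi (fun=> 1)).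
Proof.
move=> ophi i0; have o1 := in_Lp_cst 1; have oc := in_Lp_comb (- c) ophi o1.
have two0 : 0 < 2 `^ p :> R by exact: powR_gt0.
have phiE : phi = ucomb c (ucomb (- c) phi (fun=> 1)) (fun=> 1).
  by apply/funext => x; rewrite /ucomb; ring.
have : Lp_pow phi <= 2 `^ p * (Lp_pow (ucomb (- c) phi (fun=> 1)) + `|c| `^ p * Lp_pow (fun=> 1)).
  by rewrite {1}phiE; exact: Lp_pow_comb.
move/le_trans; apply; rewrite -mulrA (ler_pM2l two0) mulrDl mul1r lerD2l.
have [c0|cN0] := eqVneq c 0.
  by rewrite c0 normr0 powR0 ?(gt_eqF p0)// mul0r; exact: mulr_ge0 (ltW two0) (Lp_pow_ge0 _).
have [e e0 eE] : exists2 e, 0 < e & `|c| = e + e.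
  by exists (`|c| / 2); [rewrite divr_gt0 ?normr_gt0|rewrite -splitr].
have mean : source (fun=> 1) (ucomb (- c) phi (fun=> 1)) = - c * Lp_pow (fun=> 1).
  rewrite (source_comb _ o1 ophi o1) source1 i0 add0r; congr (_ * _).
  by apply: eq_Rintegral => x _; rewrite /source_dens /Lp_dens normr1 !powR1 !mul1r.
have := source_le e0 o1 oc; rewrite mean normrM normrN (ger0_norm (Lp_pow_ge0 _)) eE.
rewrite mulrDl lerD2l => /(ler_wpM2l (powR_ge0 e (p - 1))); rewrite !mulrA.
have eN0 : e != 0 by rewrite gt_eqF.
have -> : e `^ (p - 1) * e = e `^ p.
  by rewrite -[X in _ * X]powRr1 ?(ltW e0)// -powRD ?eN0 ?implybT// subrK.
have -> : e `^ (p - 1) * e `^ (1 - p) = 1.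
  by rewrite -powRD ?eN0 ?implybT// addrA subrK subrr powRr0.
rewrite mul1r -[e + e](mulr_natl e 2) (powRM _ (ler0n R 2) (ltW e0)) -mulrA.
by rewrite (ler_pM2l two0).
Qed.

Lemma test_poincare C : (forall f, C1_closure B f -> exists c,
    (\int[lebesgue]_(y in B) (`|f y - c| `^ p * v y)%:E <=
     C%:E * \int[lebesgue]_(y in B) (enorm (grad f y) `^ p * w y)%:E)%E) ->
  measurable_fun B w -> (forall x, 0 <= w x) -> 0 < C ->
  forall phi, test_space phi -> Lp_pow phi <= 2 `^ p * (1 + 2 `^ p) * C * LQ_pow (grad phi).
Proof.
move=> HC mw w0 C0 phi [c1 oq i0]; have [c hc] := HC _ c1; have ophi := C1_in_Lp c1.
apply: (le_trans (Lp_pow_center c ophi i0)); rewrite -[leRHS]mulrA; apply: ler_wpM2l.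
  by rewrite mulr_ge0 ?addr_ge0 ?powR_ge0.
have oc := in_Lp_comb (- c) ophi (in_Lp_cst 1).
rewrite -lee_fin -(integral_Lp_pow oc) EFinM -(integral_LQ_pow oq).
rewrite (_ : integral _ _ _ = \int[lebesgue]_(y in B) (`|phi y - c| `^ p * v y)%:E)%E; last first.
  by apply: eq_integral => x _; rewrite /Lp_dens /ucomb mulr1.
apply: (le_trans hc); apply: lee_wpmul2l; first by rewrite lee_fin ltW.
apply: ae_ge0_le_integral; first exact: mB.
- by move=> x _; rewrite lee_fin mulr_ge0 ?powR_ge0.
- apply/measurable_EFinP; apply: measurable_funM mw.
  exact: (measurableT_comp (measurable_powR p) (measurable_enorm_grad c1)).
- by move=> x _; rewrite lee_fin LQ_dens_ge0.
- exact/measurable_EFinP/measurable_LQ_dens/oq.1.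
- by apply: filterS degenerate => x + Bx => /(_ Bx)/(_ (grad phi x)); rewrite lee_fin mulrC.
Qed.

(** * Minimization of the functional *)

Variable CP : R.
Hypothesis CP0 : 0 < CP.
Hypothesis poincareB : forall phi, test_space phi -> Lp_pow phi <= CP * LQ_pow (grad phi).

Lemma test0 : test_space (fun=> 0).
Proof.
have [c g0] := C1_cst 0; split => //.
  by apply: in_LQ_eq in_LQ0 => x _; rewrite g0.
by under eq_Rintegral do rewrite mul0r; rewrite /Rintegral integral0.
Qed.

Lemma test_in_Lp phi : test_space phi -> in_Lp phi. Proof. by case=> /C1_in_Lp. Qed.

Lemma test_in_LQ phi : test_space phi -> in_LQ (grad phi). Proof. by case. Qed.

(** Chooses the Young parameter so that the second coefficient takes a prescribed value. *)
Lemma powR_solve (c C : R) : 0 < c -> 0 < C -> exists2 e, 0 < e & e `^ (1 - p) * C = c.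
Proof.
move=> c0 C0; have q0 : 1 - p != 0 by rewrite lt_eqF// subr_lt0.
exists ((c / C) `^ (1 - p)^-1); first by rewrite powR_gt0// divr_gt0.
by rewrite (powRVK q0 (divr_ge0 (ltW c0) (ltW C0))) divfK// gt_eqF.
Qed.

Definition functional f phi := p^-1 * LQ_pow (grad phi) + source f phi.

Lemma functional_coercive f : in_Lp f -> exists2 K, 0 <= K &
  forall phi, test_space phi -> LQ_pow (grad phi) <= 2 * p * (functional f phi + K).
Proof.
have p20 : 0 < 2 * p by rewrite mulr_gt0.
have ip20 : 0 < (2 * p)^-1 by rewrite invr_gt0.
(* With [e^(1-p) CP = 1/(2p)], half of the energy term of the functional survives. *)
move=> okf; have [e e0 eE] := powR_solve ip20 CP0.
exists (e * Lp_pow f); first by rewrite mulr_ge0 ?Lp_pow_ge0 ?(ltW e0).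
move=> phi tphi; have := source_le e0 okf (test_in_Lp tphi).
have /(ler_wpM2l (powR_ge0 e (1 - p))) := poincareB tphi.
rewrite mulrA eE /functional => h1; rewrite ler_norml => /andP[h2 _].
rewrite mulrC -ler_pdivrMr// [leLHS]mulrC.
have -> : p^-1 = (2 * p)^-1 * 2 by rewrite invfM mulrAC mulVf ?mul1r.
by move: h1 h2; move: (LQ_pow _) (source _ _) (Lp_pow _) ((2 * p)^-1) (e `^ _ * _) => a b c d q; lra.
Qed.

(** The accuracy is the square of the step [1/(k+1)] of the later perturbation, so it still tends to
    zero after division by that step. *)
Lemma minimizing_sequence f : in_Lp f -> exists (m : R) (psi : nat -> E -> R),
  (forall phi, test_space phi -> m <= functional f phi) /\
  forall k, test_space (psi k) /\ functional f (psi k) < m + k.+1%:R^-1 ^+ 2.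
Proof.
move=> okf; have [K K0 HK] := functional_coercive okf.
pose A := [set functional f phi | phi in test_space].
have A0 : A !=set0 by exists (functional f (fun=> 0)); exists (fun=> 0) => //; exact: test0.
have hA : has_inf A.
  split=> //; exists (- K) => _ [phi tphi <-].
  have := le_trans (LQ_pow_ge0 _) (HK _ tphi).
  rewrite pmulr_rge0 ?mulr_gt0// => h; lra.
have k0 k : 0 < k.+1%:R^-1 ^+ 2 :> R by rewrite exprn_gt0// invr_gt0.
have /choice[psi Hpsi] k : exists phi, test_space phi /\ functional f phi < inf A + k.+1%:R^-1 ^+ 2.
  by have [_ [phi tphi <-] h] := inf_adherent (k0 k) hA; exists phi.
exists (inf A), psi; split=> // phi tphi.
by apply: (ge_inf hA.2); exists phi.
Qed.

Lemma midpoint_arith (m a b c d e : R) : m <= p^-1 * c + (d + 2^-1 * (e + -1 * d)) ->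
  (a + b) / 2 - c <= p * ((p^-1 * a + d + (p^-1 * b + e)) / 2 - m).
Proof.
rewrite -(ler_pM2l p0) => hp.
have pV x : p * (p^-1 * x) = x by rewrite mulrA divff ?mul1r ?gt_eqF.
rewrite mulrBr; have -> : p * ((p^-1 * a + d + (p^-1 * b + e)) / 2) =
    (p * (p^-1 * a) + p * (p^-1 * b)) / 2 + p * ((d + e) / 2) by ring.
have hp2 : p * (p^-1 * c + (d + 2^-1 * (e + -1 * d))) = p * (p^-1 * c) + p * ((d + e) / 2).
  by field; exact: lt0r_neq0.
move: hp; rewrite hp2 !pV; move: (p * m) (p * ((d + e) / 2)) => y z; lra.
Qed.

(** The source term is linear and drops out of the convexity gap, while the midpoint is a test
    function, so its functional is at least [m]. *)
Lemma minimizing_midpoint f m psi1 psi2 : in_Lp f ->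
  (forall phi, test_space phi -> m <= functional f phi) -> test_space psi1 -> test_space psi2 ->
  (LQ_pow (grad psi1) + LQ_pow (grad psi2)) / 2 - LQ_pow (gmid (grad psi1) (grad psi2)) <=
  p * ((functional f psi1 + functional f psi2) / 2 - m).
Proof.
move=> okf mJ t1 t2; have td := test_comb (-1) t2 t1; have tm := test_comb 2^-1 t1 td.
have mE : LQ_pow (grad (ucomb 2^-1 psi1 (ucomb (-1) psi2 psi1))) = LQ_pow (gmid (grad psi1) (grad psi2)).
  apply: LQ_pow_eq => x Bx; case: t1 t2 td => [c1 _ _] [c2 _ _] [cd _ _].
  by rewrite -(grad_comb_in 2^-1 c1 cd Bx) /gmid /gcomb -(grad_comb_in (-1) c2 c1 Bx).
have := mJ _ tm; rewrite /functional mE.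
rewrite (source_comb _ okf (test_in_Lp t1) (test_in_Lp td)) (source_comb _ okf (test_in_Lp t2) (test_in_Lp t1)).
exact: midpoint_arith.
Qed.

Lemma harmonic_sqr_small (d : R) : 0 < d ->
  exists N, forall i, (N <= i)%N -> i.+1%:R^-1 ^+ 2 <= d.
Proof.
move=> d0; have [N _ HN] := (cvgr0Pnorm_lt _).1 (@cvg_harmonic R) _ d0.
exists N => i Ni; have i0 : 0 <= i.+1%:R^-1 :> R by rewrite invr_ge0.
have i1 : i.+1%:R^-1 <= 1 :> R by rewrite invf_le1// ler1n.
have : `|i.+1%:R^-1 : R| < d by exact: (HN i Ni).
rewrite (ger0_norm i0) => /ltW; apply: le_trans.
by rewrite expr2 (ler_piMr i0 i1).
Qed.

(** Near-minimality makes the midpoint gap small, uniform convexity turns this into closeness of the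
    gradients, and the Poincaré inequality gives closeness in [L^p(v)]. Coercivity bounds the
    energies that multiply the small parameter of uniform convexity. *)
Lemma minimizing_cauchy f m (psi : nat -> E -> R) : in_Lp f ->
  (forall phi, test_space phi -> m <= functional f phi) ->
  (forall k, test_space (psi k) /\ functional f (psi k) < m + k.+1%:R^-1 ^+ 2) ->
  forall e, 0 < e -> exists N, forall j k, (N <= j)%N -> (N <= k)%N ->
    Lp_pow (ucomb (-1) (psi j) (psi k)) + LQ_pow (gcomb (-1) (grad (psi j)) (grad (psi k))) <= e.
Proof.
move=> okf mJ Hpsi e e0; have [K K0 HK] := functional_coercive okf.
have tpsi k := (Hpsi k).1.
have k1 k : k.+1%:R^-1 ^+ 2 <= 1 :> R.
  by rewrite expr_le1// ?invr_ge0// invf_le1// ler1n.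
have p20 : 0 < 2 * p by rewrite mulr_gt0.
have JM k : LQ_pow (grad (psi k)) <= 2 * p * (m + 1 + K).
  apply: (le_trans (HK _ (tpsi k))); rewrite (ler_pM2l p20) lerD2r.
  exact: le_trans (ltW (Hpsi k).2) (lerD (lexx m) (k1 k)).
have [M M0 HM] : exists2 M, 0 < M & forall k, LQ_pow (grad (psi k)) <= M.
  exists (2 * p * (m + 1 + K) + 1) => [|k]; last by rewrite (le_trans (JM k))// lerDl.
  by rewrite ltr_wpDl// (le_trans (LQ_pow_ge0 _) (JM 0%N)).
have C10 : 0 < CP + 1 by rewrite ltr_wpDl// ltW.
(* Two energies of size at most [M] times this parameter give half of [e/(CP+1)]. The function part
   costs at most [CP] times the gradient part, whence [CP + 1]. *)
have e'0 : 0 < e / (CP + 1) / (4 * M) by rewrite !divr_gt0// mulr_gt0.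
have [C C0 HC] := LQ_pow_uniform_convexity e'0.
have [d d0 dE] : exists2 d, 0 < d & C * (p * d) = e / (CP + 1) / 2.
  exists (e / (CP + 1) / 2 / (C * p)); first by rewrite !divr_gt0// mulr_gt0.
  by rewrite mulrA mulrC divfK// gt_eqF ?mulr_gt0.
have [N HN] := harmonic_sqr_small d0.
exists N => j k Nj Nk; have [cj _ _] := tpsi j; have [ck _ _] := tpsi k.
have td := test_comb (-1) (tpsi j) (tpsi k).
have gE := LQ_pow_eq (grad_comb_in (-1) cj ck).
have hv := poincareB td; rewrite -gE in hv.
have hq : LQ_pow (gcomb (-1) (grad (psi j)) (grad (psi k))) <= e / (CP + 1).
  apply: (le_trans (HC _ _ (test_in_LQ (tpsi j)) (test_in_LQ (tpsi k)))).
  rewrite [leRHS]splitr; apply: lerD.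
    rewrite -(ler_pdivlMl _ _ e'0).
    have -> : (e / (CP + 1) / (4 * M))^-1 * (e / (CP + 1) / 2) = M + M.
      by field; rewrite !gt_eqF.
    exact: lerD.
  rewrite -dE (ler_pM2l C0).
  apply: (le_trans (minimizing_midpoint okf mJ (tpsi j) (tpsi k))); rewrite (ler_pM2l p0).
  have h i : (N <= i)%N -> functional f (psi i) <= m + d.
    by move=> Ni; apply: (le_trans (ltW (Hpsi i).2)); rewrite lerD2l; exact: HN.
  have := h j Nj; have := h k Nk; move=> hk hj.
  by rewrite lerBlDl (ler_pdivrMr _ _ (ltr0Sn R 1)) mulrDr mulr1 (lerD hj hk).
have eE : CP * (e / (CP + 1)) + e / (CP + 1) = e by field; rewrite gt_eqF.
have := lerD (le_trans hv (ler_wpM2l (ltW CP0) hq)) hq; rewrite eE; apply.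
Qed.

Lemma geometric_cvg0 (K : R) (X : nat -> R) :
  (forall k, 0 <= X k) -> (forall k, X k <= K * 2 ^- k) -> X k @[k --> \oo] --> 0.
Proof.
move=> X0 XK; have half : `|2^-1 : R| < 1 by rewrite ger0_norm// invf_lt1// ltr1n.
have hK : K * 2^-1 ^+ k @[k --> \oo] --> 0.
  by rewrite -[X in _ --> X](mulr0 K); apply: cvgMr; exact: cvg_expr.
apply: (@squeeze_cvgr _ _ _ _ (fun=> 0) (fun k => K * 2^-1 ^+ k)); [|exact: cvg_cst|exact: hK].
by apply: nearW => k; rewrite X0 exprVn XK.
Qed.

Lemma minimizer f : in_Lp f ->
  exists (m : R) (psi : nat -> E -> R) u g (Z : E -> R),
  [/\ forall phi, test_space phi -> m <= functional f phi,
    forall k, test_space (psi k) /\ functional f (psi k) < m + k.+1%:R^-1 ^+ 2,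
    approx psi u g, lebesgue.-integrable B (EFin \o Z) &
    {ae lebesgue, forall x, B x ->
      (forall i, grad (psi k) x i ord0 @[k --> \oo] --> g x i ord0) /\
      forall k, LQ_dens (gcomb (-1) (grad (psi k)) g) x <= Z x}].
Proof.
move=> okf; have [m [psi [mJ Hpsi]]] := minimizing_sequence okf.
have [s [u [g [Z [K [sk [ou og] iZ hK hae]]]]]] := energy_complete
  (fun k => test_in_Lp (Hpsi k).1) (fun k => test_in_LQ (Hpsi k).1) (minimizing_cauchy okf mJ Hpsi).
(* The accuracy survives the passage to a subsequence because [k <= s k]. *)
exists m, (fun k => psi (s k)), u, g, Z; split.
- exact: mJ.
- move=> k; split; first exact: (Hpsi (s k)).1.
  apply: (lt_le_trans (Hpsi (s k)).2); rewrite lerD2l lerXn2r ?nnegrE ?invr_ge0//.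
  by rewrite lef_pV2 ?posrE// ler_nat ltnS.
- split; [|by []| |].
  + by move=> k; have [] := (Hpsi (s k)).1.
  + by apply: (@geometric_cvg0 K) => k; [exact: Lp_pow_ge0|exact: (hK k).1].
  + by apply: (@geometric_cvg0 K) => k; [exact: LQ_pow_ge0|exact: (hK k).2].
- exact: iZ.
- exact: hae.
Qed.

(** Dominated convergence. Young's inequality bounds the integrand by the densities of [G k] and
    [h], and writing [G k = (G k - g) + g] leaves only [Z] and the densities of [g] and [h]. *)
Lemma flux_limit (t : nat -> R) (G : nat -> E -> 'cV[R]_n.+1) g h (Z : E -> R) :
  (forall k, 0 <= t k <= 1) -> t k @[k --> \oo] --> 0 ->
  (forall k, in_LQ (G k)) -> in_LQ g -> in_LQ h -> lebesgue.-integrable B (EFin \o Z) ->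
  {ae lebesgue, forall x, B x -> (forall i, G k x i ord0 @[k --> \oo] --> g x i ord0) /\
    forall k, LQ_dens (gcomb (-1) (G k) g) x <= Z x} ->
  flux (gcomb (t k) (G k) h) h @[k --> \oo] --> flux g h.
Proof.
move=> t01 t0 oG og oh iZ hae.
have oGh k := in_LQ_comb (t k) (oG k) oh.
pose b x := 2 `^ p * 2 `^ p * Z x + 1 * (2 `^ p * 2 `^ p * LQ_dens g x + (2 `^ p + 1) * LQ_dens h x).
have ib : lebesgue.-integrable B (EFin \o b).
  exact: (integrable_lin mB _ _ iZ (integrable_lin mB _ _ og.2 oh.2)).
have two0 : 0 <= 2 `^ p :> R by exact: powR_ge0.
have h1 x k : 0 <= LQ_dens h x /\ LQ_dens (gcomb (t k) (G k) h) x <=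
    2 `^ p * LQ_dens (G k) x + 2 `^ p * LQ_dens h x.
  split; first exact: LQ_dens_ge0.
  apply: (le_trans (LQ_dens_comb _ _ _ _)); rewrite lerD2l ler_wpM2r ?LQ_dens_ge0//.
  have /andP[a0 a1] := t01 k; rewrite (ger0_norm a0) ler_piMr//.
  apply: (@le_trans _ _ (1 `^ p)); last by rewrite powR1.
  by apply: (ge0_ler_powR (ltW p0)); rewrite ?nnegrE.
have h2 x k : LQ_dens (G k) x <= 2 `^ p * LQ_dens (gcomb (-1) (G k) g) x + 2 `^ p * LQ_dens g x.
  have : LQ_dens (gcomb 1 (gcomb (-1) (G k) g) g) x <= _ := LQ_dens_comb _ _ _ _; rewrite normr1 powR1 mulr1.
  by rewrite {1}/LQ_dens /gcomb scaleN1r scale1r addrNK.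
have dom : {ae lebesgue, forall x k, B x -> (`|(flux_dens (gcomb (t k) (G k) h) h x)%:E| <= (b x)%:E)%E}.
  apply: filterS hae => x hx k Bx; have [_ /(_ k) hZ] := hx Bx.
  rewrite abse_EFin lee_fin; apply: (le_trans (flux_dens_le (gcomb (t k) (G k) h) h x ltr01)).
  rewrite powR1 (mul1r (LQ_dens _ _)) mul1r /b mul1r.
  apply: (le_trans (lerD (h1 x k).2 (lexx _))).
  apply: (le_trans (lerD (lerD (ler_wpM2l two0 (h2 x k)) (lexx _)) (lexx _))).
  move: hZ two0; move: (LQ_dens _ x) (LQ_dens g x) (LQ_dens h x) (Z x) (2 `^ p) => a c d z q az q0.
  have -> : q * (q * a + q * c) + q * d + d = q * q * a + (q * q * c + (q + 1) * d) by ring.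
  by rewrite lerD2r; apply: ler_wpM2l => //; exact: mulr_ge0.
have lim : {ae lebesgue, forall x, B x ->
    (flux_dens (gcomb (t k) (G k) h) h x)%:E @[k --> \oo] --> (flux_dens g h x)%:E}.
  apply: filterS hae => x hx Bx; have [hG _] := hx Bx.
  apply: cvg_EFin; first exact: nearW.
  apply: (@powR_sub2_mdot_cvg _ p _ _ (fun k => S x *m gcomb (t k) (G k) h x) (S x *m g x)
    (S x *m h x) p1); apply: mulmx_cvg => i j; rewrite ord1.
  have -> : g x i ord0 = g x i ord0 + 0 * h x i ord0 by rewrite mul0r addr0.
  rewrite (_ : (fun k => _) = fun k => G k x i ord0 + t k * h x i ord0); last first.
    by apply/funext => k; rewrite !mxE.
  by apply: cvgD; [exact: hG|apply: cvgM; [exact: t0|exact: cvg_cst]].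
have [_ _] := @dominated_convergence _ _ R lebesgue B mB
  (fun k x => (flux_dens (gcomb (t k) (G k) h) h x)%:E) (fun x => (flux_dens g h x)%:E) (EFin \o b)
  (fun k => measurable_int _ (flux_dens_integrable (oGh k) oh)) (measurable_int _ (flux_dens_integrable og oh))
  lim ib dom.
rewrite (_ : \int[lebesgue]_(x in B) _ = (flux g h)%:E)%E; last first.
  by rewrite fineK//; exact: integrable_fin_num (flux_dens_integrable og oh).
move=> /fine_cvgP[_]; apply: cvg_trans; apply: near_eq_cvg; exact: nearW.
Qed.

Lemma perturbation_arith (m a b c t P L : R) : 0 < t -> m <= a + (c + t * L) ->
  b + c <= m + t ^+ 2 -> a - b <= t * P -> 0 <= P + L + t.
Proof.
move=> t0 h1 h2 h3; rewrite -(pmulr_rge0 _ t0) !mulrDr -expr2.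
move: h1 h2 h3; move: (t * P) (t * L) (t ^+ 2) => x y z h1 h2 h3; lra.
Qed.

(** [psi k + t k phi] is a test function, so near-minimality of [psi k] and the tangent inequality
    at the perturbed point, divided by [t k], bound flux plus source plus [t k] from below by zero;
    then [k] tends to infinity. The equation comes from [phi] and [- phi]. *)
Lemma euler_lagrange f m (psi : nat -> E -> R) u g (Z : E -> R) phi : in_Lp f ->
  (forall phi, test_space phi -> m <= functional f phi) ->
  (forall k, test_space (psi k) /\ functional f (psi k) < m + k.+1%:R^-1 ^+ 2) ->
  approx psi u g -> lebesgue.-integrable B (EFin \o Z) ->
  {ae lebesgue, forall x, B x ->
    (forall i, grad (psi k) x i ord0 @[k --> \oo] --> g x i ord0) /\
    forall k, LQ_dens (gcomb (-1) (grad (psi k)) g) x <= Z x} ->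
  test_space phi -> 0 <= flux g (grad phi) + source f phi.
Proof.
move=> okf mJ Hpsi [_ [ou og] _ _] iZ hae tphi.
pose t k : R := k.+1%:R^-1.
have t0 k : 0 < t k by rewrite invr_gt0.
have tc : t k @[k --> \oo] --> 0 by exact: cvg_harmonic.
have t01 k : 0 <= t k <= 1 by rewrite (ltW (t0 k)) invf_le1// ler1n.
have oG k := test_in_LQ (Hpsi k).1; have oh := test_in_LQ tphi.
have c := flux_limit t01 tc oG og oh iZ hae.
have hk k : 0 <= (flux (gcomb (t k) (grad (psi k)) (grad phi)) (grad phi) + source f phi) + t k.
  have tk := (Hpsi k).1; have tpk := test_comb (t k) tk tphi.
  have := mJ _ tpk; rewrite /functional (source_comb _ okf (test_in_Lp tk) (test_in_Lp tphi)).
  case: (tk) (tphi) => ck _ _ [cphi _ _].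
  rewrite -(LQ_pow_eq (grad_comb_in (t k) ck cphi)) => h1.
  have := (Hpsi k).2; rewrite /functional => /ltW h2.
  have := LQ_pow_convex (t0 k) (oG k) oh.
  have ip0 : 0 <= p^-1 by rewrite invr_ge0 ltW.
  move=> /(ler_wpM2l ip0); rewrite mulrBr mulrCA (mulrA p^-1) mulVf ?gt_eqF// mul1r => h3.
  exact: (perturbation_arith (t0 k) h1 h2 h3).
have cc : (flux (gcomb (t k) (grad (psi k)) (grad phi)) (grad phi) + source f phi) + t k
    @[k --> \oo] --> flux g (grad phi) + source f phi + 0.
  by apply: cvgD; [apply: cvgD; [exact: c|exact: cvg_cst]|exact: tc].
rewrite addr0 in cc; rewrite -(cvg_lim (@Rhausdorff R) cc).
by apply: limr_ge; [apply/cvg_ex; eexists; exact: cc|exact: nearW].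
Qed.

(** * The weak Neumann problem in terms of flux and source *)

Lemma source_fin u : in_Lp u ->
  (\int[lebesgue]_(x in B) (u x * v x)%:E)%E = (\int[lebesgue]_(x in B) (u x * v x))%:E.
Proof. by move=> ou; rewrite fineK//; exact: integrable_fin_num (in_Lp_integrable ou). Qed.

Lemma approx_in_Lp (psi : nat -> E -> R) u g : approx psi u g ->
  [/\ in_Lp u, in_LQ g, forall k, in_Lp (psi k) & forall k, in_LQ (grad (psi k))].
Proof.
case=> H [ou og] _ _; split; [exact: ou|exact: og| |]; move=> k; last exact: (H k).2.
exact: C1_in_Lp (H k).1.
Qed.

Lemma H1_mean0P u g : H1_mean0 p v Q B u g <->
  (exists psi : nat -> E -> R, approx psi u g) /\ \int[lebesgue]_(x in B) (u x * v x) = 0.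
Proof.
split.
  move=> [/H1_approx[psi h]]; have [ou _ _ _] := approx_in_Lp h.
  by rewrite (source_fin ou) => -[i0]; split=> //; exists psi.
move=> [[psi h] i0]; have [ou _ _ _] := approx_in_Lp h.
by split; [apply/H1_approx; exists psi|rewrite (source_fin ou) i0].
Qed.

(** The constant sequence [phi] represents the pair [(phi, grad phi)] in the completion. *)
Lemma test_spaceP phi : test_space phi <-> C1_closure B phi /\ H1_mean0 p v Q B phi (grad phi).
Proof.
split.
  move=> tphi; have [c o i0] := tphi; split; first exact: c.
  apply/H1_mean0P; split; last exact: i0.
  exists (fun=> phi); split; [by []|split; [exact: C1_in_Lp c|exact: o]| |].
    rewrite (_ : (fun _ => _) = fun=> 0); first exact: cvg_cst.
    apply/funext => _; rewrite /Lp_pow /Lp_dens; under eq_Rintegral => x _.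
      rewrite /ucomb mulN1r subrr normr0 powR0 ?mul0r ?(gt_eqF p0)//; over.
    by rewrite /Rintegral integral0.
  rewrite (_ : (fun _ => _) = fun=> LQ_pow (fun=> 0)); first by rewrite LQ_pow0; exact: cvg_cst.
  by apply/funext => _; apply: LQ_pow_eq => x _; rewrite /gcomb scaleN1r subrr.
move=> [c /H1_mean0P[[psi h] i0]]; have [_ o _ _] := approx_in_Lp h.
by split.
Qed.

Lemma flux_eq g h1 h2 : (forall x, B x -> h1 x = h2 x) -> flux g h1 = flux g h2.
Proof. by move=> h; apply: eq_Rintegral => x; rewrite inE => /h hx; rewrite /flux_dens hx. Qed.

Lemma integral_weak g h : in_LQ g -> in_LQ h ->
  (\int[lebesgue]_(x in B) (enorm (S x *m g x) `^ (p - 2) *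
     ((h x)^T *m Q x *m g x) ord0 ord0)%:E)%E = (flux g h)%:E.
Proof.
move=> og oh; have ae_eq : {ae lebesgue, forall x, B x ->
    enorm (S x *m g x) `^ (p - 2) * ((h x)^T *m Q x *m g x) ord0 ord0 = flux_dens g h x}.
  apply: filterS sqrtQ => x + Bx => /(_ Bx)[ST SS].
  by rewrite /flux_dens mdotC mdotE trmx_mul ST -SS !mulmxA.
have mpr := measurable_flux_dens og.1 oh.1.
rewrite fineK; last exact: integrable_fin_num (flux_dens_integrable og oh).
apply: ae_eq_integral; first exact: mB.
- exact/measurable_EFinP/(lebesgue_ae_measurable ae_eq mpr).
- exact/measurable_EFinP.
- by apply: filterS ae_eq => x + Bx => /(_ Bx) ->.
Qed.

Lemma weak_solutionP f u g : in_Lp f -> weak_solution p v Q B f u g <->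
  [/\ exists psi : nat -> E -> R, approx psi u g, \int[lebesgue]_(x in B) (u x * v x) = 0 &
    forall phi, test_space phi -> flux g (grad phi) = - source f phi].
Proof.
move=> okf; have eqv phi : in_LQ g -> test_space phi ->
    (\int[lebesgue]_(x in B) (enorm (psd_sqrt (Q x) *m g x) `^ (p - 2) *
       ((grad phi x)^T *m Q x *m g x) ord0 ord0)%:E =
     - \int[lebesgue]_(x in B) (`|f x| `^ (p - 2) * f x * phi x * v x)%:E)%E <->
    flux g (grad phi) = - source f phi.
  move=> og tphi; rewrite (integral_weak og (test_in_LQ tphi)).
  rewrite (_ : integral _ _ _ = (source f phi)%:E); last first.
    by rewrite fineK//; exact: integrable_fin_num (source_dens_integrable okf (test_in_Lp tphi)).
  by rewrite -EFinN; split=> [[]|->].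
split.
  move=> [/H1_mean0P[[psi h] i0] H]; split=> //; first by exists psi.
  move=> phi tphi; have [_ og _ _] := approx_in_Lp h; apply/(eqv _ og tphi).
  by have [c m] := (test_spaceP phi).1 tphi; exact: H.
move=> [[psi h] i0 H]; have [_ og _ _] := approx_in_Lp h; split.
  by apply/H1_mean0P; split=> //; exists psi.
by move=> phi c m; have tphi := (test_spaceP phi).2 (conj c m); apply/(eqv _ og tphi); exact: H.
Qed.

Lemma neumann_existence : neumann_solvable p v Q B.
Proof.
move=> f /LpP okf; have [m [psi [u [g [Z [mJ Hpsi ha iZ hae]]]]]] := minimizer okf.
exists u, g; apply/(weak_solutionP _ _ okf); have [ou og ov oq] := approx_in_Lp ha.
split; first by exists psi.
  rewrite -source1; have [_ _ cu _] := ha.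
  have := source_cvg (in_Lp_cst 1) ov ou cu.
  under eq_fun => k do (have [[_ _ h0] _] := Hpsi k; rewrite source1 h0).
  by move=> h; apply: (cvg_unique _ h); [exact: Rhausdorff|exact: cvg_cst].
move=> phi tphi; have h1 := euler_lagrange okf mJ Hpsi ha iZ hae tphi.
(* [phi + (-2) phi] is [- phi], for the opposite inequality. *)
have tN := test_comb (-2) tphi tphi.
have h2 := euler_lagrange okf mJ Hpsi ha iZ hae tN.
have ophi := test_in_Lp tphi; have oqphi := test_in_LQ tphi; case: (tphi) => cphi _ _.
rewrite -(flux_eq g (grad_comb_in (-2) cphi cphi)) (flux_comb (-2) og oqphi oqphi) in h2.
rewrite (source_comb (-2) okf ophi ophi) in h2.
move: h1 h2; move: (flux _ _) (source _ _) => a b h1 h2; lra.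
Qed.

(** * The bound on solutions *)

Hypothesis vB0 : 0 < \int[lebesgue]_(x in B) v x.

(** The [v]-mean [c k] is subtracted from [psi k]. It tends to the [v]-mean of [u], which is zero,
    so the limit is unchanged; gradients do not see the constants. *)
Lemma approx_test (psi : nat -> E -> R) u g : approx psi u g ->
  \int[lebesgue]_(x in B) (u x * v x) = 0 ->
  exists phi : nat -> E -> R, approx phi u g /\ forall k, test_space (phi k).
Proof.
move=> ha u0; have [ou og ov oq] := approx_in_Lp ha; have [H _ cu cg] := ha.
have o1 := in_Lp_cst 1; have [c1 g1] := C1_cst 1.
pose c k := (\int[lebesgue]_(x in B) (psi k x * v x)) / \int[lebesgue]_(x in B) v x.
have cc : c k @[k --> \oo] --> 0.
  have := source_cvg o1 ov ou cu; rewrite source1 u0 => h.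
  rewrite -(mul0r (\int[lebesgue]_(x in B) v x)^-1); apply: cvgM; last exact: cvg_cst.
  by move: h; under eq_fun do rewrite source1.
have gE k x : B x -> gcomb (- c k) (grad (psi k)) (grad (fun=> 1)) x =
    grad (ucomb (- c k) (psi k) (fun=> 1)) x.
  by move=> Bx; exact: (grad_comb_in (- c k) (H k).1 c1 Bx).
have gE' k x : B x -> grad (psi k) x = grad (ucomb (- c k) (psi k) (fun=> 1)) x.
  by move=> Bx; rewrite -(gE k x Bx) /gcomb g1 scaler0 addr0.
have tphi k : test_space (ucomb (- c k) (psi k) (fun=> 1)).
  split; first exact: C1_comb (H k).1 c1.
    exact: in_LQ_eq (gE' k) (oq k).
  rewrite (integral_comb _ (ov k) o1); under [X in _ + _ * X]eq_Rintegral do rewrite mul1r.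
  by rewrite mulNr divfK ?gt_eqF// subrr.
exists (fun k => ucomb (- c k) (psi k) (fun=> 1)); split; last exact: tphi.
split.
- by move=> k; have [? ? _] := tphi k.
- by split.
- have up k : Lp_pow (ucomb (-1) (ucomb (- c k) (psi k) (fun=> 1)) u) <=
      2 `^ p * (Lp_pow (ucomb (-1) (psi k) u) + `|c k| `^ p * Lp_pow (fun=> 1)).
    have -> : ucomb (-1) (ucomb (- c k) (psi k) (fun=> 1)) u =
        ucomb (- c k) (ucomb (-1) (psi k) u) (fun=> 1).
      by apply/funext => x; rewrite /ucomb addrAC.
    by have := Lp_pow_comb (- c k) (in_Lp_comb (-1) (ov k) ou) o1; rewrite normrN.
  apply: (@squeeze_cvgr _ _ _ _ (fun=> 0)
    (fun k => 2 `^ p * (Lp_pow (ucomb (-1) (psi k) u) + `|c k| `^ p * Lp_pow (fun=> 1)))).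
  + by apply: nearW => k; rewrite Lp_pow_ge0 up.
  + exact: cvg_cst.
  + have z : 2 `^ p * (0 + 0 * Lp_pow (fun=> 1)) = 0 by rewrite mul0r addr0 mulr0.
    rewrite -[X in _ --> X]z; apply: cvgMr; apply: (cvgD cu); apply: cvgMl.
    apply: (@cvg_powR0 _ (fun k => `|c k|)) => [|k|]; [exact: p0|exact: normr_ge0|].
    exact/norm_cvg0P.
- rewrite (_ : (fun k => _) = fun k => LQ_pow (gcomb (-1) (grad (psi k)) g)); first exact: cg.
  by apply/funext => k; apply: LQ_pow_eq => x Bx; rewrite /gcomb (gE' k x Bx).
Qed.

(** The solution need not be C^1, so the equation is tested with mean-zero approximants, and
    continuity of flux and source gives [LQ_pow g = - source f u]. The Poincaré inequality reaches
    [u] by the same limit, with a factor [2^p] for each use of the triangle inequality. *)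
Lemma energy_bound : exists2 D, 0 < D & forall f u g, in_Lp f -> weak_solution p v Q B f u g ->
  Lp_pow u <= D * Lp_pow f.
Proof.
have two0 : 0 < 2 `^ p :> R by exact: powR_gt0.
have C0 : 0 < 2 `^ p * (CP * 2 `^ p) by rewrite !mulr_gt0.
have half : 0 < 2^-1 :> R by rewrite invr_gt0.
(* [e^(1-p)] times the constant bounding [Lp_pow u] by [LQ_pow g] is [1/2], so half of the energy is
   absorbed and [LQ_pow g <= 2 e Lp_pow f]. *)
have [e e0 eE] := powR_solve half C0.
exists (2 `^ p * (CP * 2 `^ p) * (2 * e)); first by rewrite !mulr_gt0.
move=> f u g okf /(weak_solutionP _ _ okf)[[psi ha] u0 H].
have [phi [{}ha tphi]] := approx_test ha u0; have [ou og ov oq] := approx_in_Lp ha.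
have [_ _ cu cg] := ha.
have energy : LQ_pow g = - source f u.
  have h1 := flux_cvg og oq og cg; have h2 := source_cvg okf ov ou cu.
  rewrite flux_diag in h1.
  have h3 : flux g (grad (phi k)) @[k --> \oo] --> - source f u.
    by under eq_fun => k do rewrite (H _ (tphi k)); exact: cvgN h2.
  by apply: (cvg_unique _ h1 h3); exact: Rhausdorff.
have uC : Lp_pow u <= 2 `^ p * (CP * 2 `^ p) * LQ_pow g.
  have hk k : Lp_pow u <= 2 `^ p * (CP * (2 `^ p * (LQ_pow g + LQ_pow (gcomb (-1) (grad (phi k)) g)))
      + Lp_pow (ucomb (-1) (phi k) u)).
    have := Lp_pow_comb (-1) (ov k) (in_Lp_comb (-1) (ov k) ou).
    rewrite ucombK normrN1 powR1 mul1r => h; apply: (le_trans h).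
    rewrite (ler_pM2l two0) lerD2r; apply: (le_trans (poincareB (tphi k))); rewrite (ler_pM2l CP0).
    have := LQ_pow_comb 1 og (in_LQ_comb (-1) (oq k) og).
    rewrite normr1 powR1 mul1r; apply: le_trans.
    rewrite (_ : gcomb 1 _ _ = grad (phi k)); first exact: lexx.
    by apply/funext => x; rewrite /gcomb scaleN1r scale1r addrC addrNK.
  have cl : 2 `^ p * (CP * (2 `^ p * (LQ_pow g + LQ_pow (gcomb (-1) (grad (phi k)) g)))
      + Lp_pow (ucomb (-1) (phi k) u)) @[k --> \oo] -->
      2 `^ p * (CP * (2 `^ p * (LQ_pow g + 0)) + 0).
    apply: cvgMr; apply: cvgD cu; apply: cvgMr; apply: cvgMr; apply: cvgD cg; exact: cvg_cst.
  have -> : 2 `^ p * (CP * 2 `^ p) * LQ_pow g = 2 `^ p * (CP * (2 `^ p * (LQ_pow g + 0)) + 0).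
    by rewrite !addr0 !mulrA.
  rewrite -(cvg_lim (@Rhausdorff R) cl).
  by apply: limr_ge; [apply/cvg_ex; eexists; exact: cl|exact: nearW].
have Mg : LQ_pow g <= 2 * e * Lp_pow f.
  have := source_le e0 okf ou; rewrite ler_norml => /andP[h _].
  have := ler_wpM2l (powR_ge0 e (1 - p)) uC; rewrite (mulrA _ _ (LQ_pow g)) eE.
  move: h energy; move: (LQ_pow g) (source f u) (Lp_pow f) (e `^ _ * _) => a b c d h -> h2; lra.
by apply: (le_trans uC); rewrite -[leRHS]mulrA (ler_pM2l C0).
Qed.

Theorem neumann_property_of_poincare : neumann_property p v Q B.
Proof.
split; first exact: neumann_existence.
have [D D0 H] := energy_bound; exists (D `^ p^-1); first exact: powR_gt0.
move=> f u g /LpP okf hw; have [/H1_mean0P[[psi /approx_in_Lp[ou _ _ _]] _] _] := hw.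
rewrite (Lp_norm_in_Lp ou) (Lp_norm_in_Lp okf) -EFinM lee_fin -(powRM _ (ltW D0) (Lp_pow_ge0 f)).
apply: ge0_ler_powR; [by rewrite invr_ge0 ltW| | |exact: H hw].
  by rewrite nnegrE Lp_pow_ge0.
by rewrite nnegrE mulr_ge0 ?Lp_pow_ge0 ?(ltW D0).
Qed.

End energy.

(** * The degenerate matrix *)

Lemma rational_vectors_dense {R : realType} m (xi : 'cV[R]_m) :
  exists q : nat -> 'cV[rat]_m, forall i j, (map_mx ratr (q k) : 'cV[R]_m) i j @[k --> \oo] --> xi i j.
Proof.
have /choice[q hq] k : exists q : 'cV[rat]_m, forall i, `|ratr (q i ord0) - xi i ord0| < k.+1%:R^-1.
  have /choice[c hc] i : exists c : rat, `|ratr c - xi i ord0| < k.+1%:R^-1.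
    have k0 : 0 < k.+1%:R^-1 :> R by rewrite invr_gt0.
    have [c] := @rat_in_itvoo R (xi i ord0 - k.+1%:R^-1) (xi i ord0 + k.+1%:R^-1)
      ltac:(by rewrite ltrBlDr -addrA ltrDl addr_gt0).
    by rewrite in_itv/= => /andP[a b]; exists c; rewrite ltr_distl a.
  by exists (\col_i c i) => i; rewrite mxE.
exists q => i j; rewrite ord1; apply/subr_cvg0/norm_cvg0P.
apply: (@squeeze_cvgr _ _ _ _ (fun=> 0) (@harmonic R)); [|exact: cvg_cst|exact: cvg_harmonic].
by apply: nearW => k; rewrite normr_ge0/= mxE ltW.
Qed.

(** The exceptional null set depends on [xi]. A countable union of such sets serves all rational
    vectors, and both sides are continuous in [xi]. *)
Lemma ae_forall_vector {R : realType} {n : nat} (p : R) (D : set 'rV[R]_n.+1)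
    (w : 'rV[R]_n.+1 -> R) (S : 'rV[R]_n.+1 -> 'M[R]_n.+1) : 0 < p ->
  (forall xi : 'cV[R]_n.+1, {ae lebesgue, forall x, D x ->
     w x * enorm xi `^ p <= enorm (S x *m xi) `^ p}) ->
  {ae lebesgue, forall x, D x -> forall xi : 'cV[R]_n.+1,
     w x * enorm xi `^ p <= enorm (S x *m xi) `^ p}.
Proof.
(* An enumeration of the rational vectors; a number that encodes none is sent to zero. *)
move=> p0 H; pose vec k : 'cV[R]_n.+1 := map_mx ratr (odflt 0 (unpickle k) : 'cV[rat]_n.+1).
have := ae_foralln (fun k => H (vec k)); apply: filterS => x Hx Dx xi.
have [q qxi] := rational_vectors_dense xi.
have vq k : vec (pickle (q k)) = map_mx ratr (q k) by rewrite /vec pickleK.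
have e1 : w x * enorm (map_mx ratr (q k) : 'cV[R]_n.+1) `^ p @[k --> \oo] -->
    w x * enorm xi `^ p.
  apply: cvgMr; apply: (cvg_powR p0) => [k|]; first exact: enorm_ge0.
  exact: enorm_cvg.
have e2 : enorm (S x *m (map_mx ratr (q k) : 'cV[R]_n.+1)) `^ p @[k --> \oo] -->
    enorm (S x *m xi) `^ p.
  apply: (cvg_powR p0) => [k|]; first exact: enorm_ge0.
  by apply: enorm_cvg; exact: mulmx_cvg.
apply: (ler_cvg_to e1 e2); apply: nearW => k.
by rewrite -vq; exact: Hx.
Qed.

(** If the set of roots were empty, [psd_sqrt A] would be the default [0], against the lower bound
    at a basis vector. So the chosen matrix is a genuine root. *)
Lemma psd_sqrt_of_degenerate {R : realType} {n : nat} (p c : R) (A : 'M[R]_n.+1) :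
  0 < p -> 0 < c ->
  (forall xi : 'cV[R]_n.+1, c * enorm xi `^ p <= enorm (psd_sqrt A *m xi) `^ p) ->
  (psd_sqrt A)^T = psd_sqrt A /\ psd_sqrt A *m psd_sqrt A = A.
Proof.
move=> p0 c0; rewrite /psd_sqrt; case: xgetP => [S _ [[ST _] SS] _|_ H]; first by split.
have := H (delta_mx ord0 ord0); rewrite mul0mx enorm0 powR0 ?gt_eqF// leNgt mulr_gt0//.
rewrite powR_gt0// lt_neqAle enorm_ge0 andbT eq_sym; apply/eqP => /enorm_eq0/matrixP/(_ ord0 ord0).
by rewrite !mxE/= => /eqP; rewrite oner_eq0.
Qed.

(** By completeness every function is measurable on a null set, with integral zero. All norms
    vanish, since the exponent [p^-1] is nonzero, and the zero pair is a solution. *)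
Lemma neumann_property_null {R : realType} {n : nat} (p : R) (v : 'rV[R]_n.+1 -> R)
    (Q : 'rV[R]_n.+1 -> 'M[R]_n.+1) (B : set 'rV[R]_n.+1) : 0 < p ->
  measurable B -> lebesgue B = 0%E -> neumann_property p v Q B.
Proof.
move=> p0 mB B0.
have mA (A : set 'rV[R]_n.+1) : A `<=` B -> measurable A.
  by move=> AB; apply: measure_is_complete_caratheodory; exists B.
have mf (f : 'rV[R]_n.+1 -> \bar R) : measurable_fun B f by move=> _ Y mY; apply: mA => x [].
have i0 f : (\int[lebesgue]_(x in B) f x = 0)%E := null_set_integral mB (mf f) B0.
have pN0 : p^-1 != 0 by rewrite invr_eq0 gt_eqF.
have Lp0 u : Lp_norm p v B u = 0%E by rewrite /Lp_norm i0 poweR0r.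
have LQ0 g : LQ_norm p Q B g = 0%E by rewrite /LQ_norm i0 poweR0r.
split; last by exists 1 => // f u g _ _; rewrite !Lp0 mule0.
move=> f _; exists (fun=> 0), (fun=> 0); split; last by move=> phi _ _; rewrite !i0 oppe0.
split; last exact: i0.
split; [by split; [exact: measurable_cst|rewrite Lp0]| |].
  by split; [move=> i; under eq_fun do rewrite mxE; exact: measurable_cst|rewrite LQ0].
exists (fun _ _ => 0); split.
- move=> k; split; last by rewrite /H1_norm Lp0 LQ0 adde0.
  split; [exact: cst_continuous|by move=> x _; exact: differentiable_cst|].
  exists (fun=> 0); split; first exact: cst_continuous.
  by move=> x _; apply/matrixP => i j; rewrite !mxE derive_cst.
- by move=> e e0; exists 0%N => j k _ _; rewrite /H1_norm Lp0 LQ0 adde0.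
- by under eq_fun do rewrite Lp0; exact: cvg_cst.
- by under eq_fun do rewrite LQ0; exact: cvg_cst.
Qed.

Theorem corollary5p3 (R : realType) (n : nat) (p : R)
    (Omega : set 'rV[R]_n.+1) (Q : 'rV[R]_n.+1 -> 'M[R]_n.+1)
    (w v : 'rV[R]_n.+1 -> R) (x0 : 'rV[R]_n.+1) (r0 : R) :
  1 < p ->
  domain Omega ->
  (forall x, Omega x -> psd (Q x)) ->
  (forall i j, measurable_fun Omega (fun x => Q x i j)) ->
  0 < r0 ->
  closure (eball x0 r0) `<=` Omega ->
  admissible p w v ->
  (forall xi : 'cV[R]_n.+1, {ae lebesgue, forall x, Omega x ->
     w x * enorm xi `^ p <= enorm (psd_sqrt (Q x) *m xi) `^ p}) ->
  neumann_property p v Q (eball x0 r0) /\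
  neumann_solvable p v Q (eball x0 r0).
Proof.
move=> p1 [_ oO _] _ mQ r00 BO adm deg.
suff H : neumann_property p v Q (eball x0 r0) by split=> //; case: H.
have p0 : 0 < p := lt_trans ltr01 p1.
set B := eball x0 r0; have mB : measurable B by exact: measurable_eball.
have BOm : B `<=` Omega by apply: subset_trans BO; exact: subset_closure.
have Bfin : (lebesgue B < +oo)%E by exact: lebesgue_eball_lty.
have [B0|BN0] := eqVneq (lebesgue B) 0%E; first exact: neumann_property_null.
have [m BE m0] : exists2 m, lebesgue B = m%:E & 0 < m.
  have Bfin' : lebesgue B \is a fin_num by rewrite ge0_fin_numE.
  exists (fine (lebesgue B)); first by rewrite fineK.
  by rewrite fine_gt0// Bfin lt0e BN0 measure_ge0.
have [[ww wv] wlev [[_ w0 _] _] _] := adm.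
have v0 : {ae lebesgue, forall x, 0 < v x}.
  by apply: filterS2 w0 wlev => x; exact: lt_le_trans.
have vB : lebesgue.-integrable B (EFin \o v) := weight_integrable x0 r0 wv.
have mQB i j : measurable_fun B (fun x => Q x i j).
  by apply: measurable_funS (mQ i j) => //; exact: open_measurable_rV.
have degB : {ae lebesgue, forall x, B x -> forall xi : 'cV[R]_n.+1,
    w x * enorm xi `^ p <= enorm (psd_sqrt (Q x) *m xi) `^ p}.
  apply: filterS (ae_forall_vector p0 deg) => x h Bx; exact: h (BOm _ Bx).
have sqrtQ : {ae lebesgue, forall x, B x -> (psd_sqrt (Q x))^T = psd_sqrt (Q x) /\
    psd_sqrt (Q x) *m psd_sqrt (Q x) = Q x}.
  apply: filterS2 w0 degB => x wx h Bx.
  exact: (psd_sqrt_of_degenerate p0 wx (h Bx)).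
have [C C0 HC] := poincare r00 p1 adm BE m0.
have vB0 : 0 < \int[lebesgue]_(x in B) v x.
  rewrite -lte_fin fineK; last exact: integrable_fin_num.
  by have [mv vx _] := wv; apply: integral_gt0 => //; [rewrite BE lte_fin|exact: measurable_funS mv].
have mw : measurable_fun B w by case: ww => mw _ _; exact: measurable_funS mw.
have wx x : 0 <= w x by case: ww.
have CP0 : 0 < 2 `^ p * (1 + 2 `^ p) * C by rewrite !mulr_gt0 ?addr_gt0 ?powR_gt0.
apply: (neumann_property_of_poincare p1 wv vB w0 v0 mQB sqrtQ degB CP0 _ vB0).
exact: (test_poincare p1 wv vB mQB sqrtQ degB HC mw wx C0).
Qed.
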